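(* Let $Q_h=h(\mathrm{Id}-\Pi_h)$ and $b_h=h\partial_v+v/2$. The function $$m_h(v,\eta)=2\int_0^1(y+1)^{d-2}\,e^{-\frac yh\left(\frac{|v|^2}2+2|\eta|^2\right)}\,dy,\qquad(v,\eta)\in\mathbb R^{2d},$$ belongs to $S^{1/2}(\langle(v,\eta)\rangle^{-2})$ and $$Q_h=b_h^*\circ\mathrm{Op}_h(m_h\,\mathrm{Id})\circ b_h .$$
   Context: $h\in(0,1]$ is the semiclassical parameter and functions depend on $(x,v)\in\mathbb R^d\times\mathbb R^d$. $\Pi_h$ is the orthogonal projection of $L^2(\mathbb R^{2d})$ onto $\mu_h\,L^2(\mathbb R^d_x)$, where $\mu_h(v)=(2\pi h)^{-d/4}e^{-|v|^2/(4h)}$. $\partial_v$ is the gradient in $v$, so $b_h$ maps scalar functions to $\mathbb R^d$- (or $\mathbb C^d$-) valued functions; $b_h^*$ is its formal adjoint, $b_h^*w=-h\,\mathrm{div}_vw+\frac12v\cdot w$. $\langle Z\rangle=(1+|Z|^2)^{1/2}$. For $\kappa\in[0,1/2]$, $k\in\mathbb R$, $S^\kappa(\langle(v,\eta)\rangle^k)$ is the set of ($h$-dependent) $a_h\in\mathcal C^\infty(\mathbb R^{2d})$ such that for all $\alpha\in\mathbb N^{2d}$ there is $C_\alpha>0$ (independent of $h$) with $|\partial^\alpha a_h(v,\eta)|\le C_\alpha h^{-\kappa|\alpha|}\langle(v,\eta)\rangle^k$. The Weyl quantization, acting in the variable $v$ only (with $x$ as a parameter), is $$\mathrm{Op}_h(a_h)u(v)=(2\pi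 h)^{-d}\int_{\mathbb R^d}\int_{\mathbb R^d}e^{\frac ih(v-v')\cdot\eta}a_h\Big(\frac{v+v'}2,\eta\Big)u(v')\,dv'\,d\eta,$$ as an oscillating integral if necessary; it is applied entrywise to matrix-valued symbols, $\mathrm{Id}$ being the $d\times d$ identity matrix. *)

(* Defs.v *)
From HB Require Import structures.
From mathcomp Require Import all_boot all_order all_algebra.
From mathcomp Require Import all_classical all_reals all_analysis.
From mathcomp.real_closed Require Export complex.
Set Implicit Arguments.
Unset Strict Implicit.
Unset Printing Implicit Defensive.
Import Order.TTheory GRing.Theory Num.Theory.
Import numFieldNormedType.Exports.
Local Open Scope classical_set_scope.
Local Open Scope complex_scope.
Local Open Scope ring_scope.

(** Lebesgue measure on R^n, points of R^n being row vectors ['rV[R]_n]. *)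

Definition measure_rV_display : measure_display -> measure_display.
Proof. exact. Qed.

Section measurable_rV.
Context {disp : measure_display} {T : measurableType disp} (n : nat).

Let coor (i : 'I_n) (x : 'rV[T]_n) : T := x ord0 i.

Let rV_set0 : g_sigma_preimage coor set0.
Proof. exact: sigma_algebra0. Qed.

Let rV_setC A : g_sigma_preimage coor A -> g_sigma_preimage coor (~` A).
Proof. exact: sigma_algebraC. Qed.

Let rV_bigcup (F : (set 'rV[T]_n)^nat) :
  (forall i, g_sigma_preimage coor (F i)) ->
  g_sigma_preimage coor (\bigcup_i (F i)).
Proof. exact: sigma_algebra_bigcup. Qed.

(* The product sigma-algebra. *)
HB.instance Definition _ := @isMeasurable.Build (measure_rV_display disp)
  'rV[T]_n (g_sigma_preimage coor) rV_set0 rV_setC rV_bigcup.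

Lemma measurable_coor (i : 'I_n) :
  measurable_fun [set: 'rV[T]_n] (fun x : 'rV[T]_n => x ord0 i).
Proof.
move=> _ Y mY; rewrite setTI; apply: sub_sigma_algebra => /=.
rewrite -bigcup_seq/=; exists i => /=; first by rewrite mem_index_enum.
by exists Y => //; rewrite setTI.
Qed.

Lemma measurable_fun_rVP d1 (T1 : measurableType d1) (f : T1 -> 'rV[T]_n) :
  measurable_fun [set: T1] f <->
  forall i, measurable_fun [set: T1] (fun x => f x ord0 i).
Proof.
split=> [mf i|mf].
  by apply: (measurableT_comp (f := fun x : 'rV[T]_n => x ord0 i)) => //;
    exact: measurable_coor.
apply: (@measurability _ _ _ _ _ _
  (\big[setU/set0]_(i < n) preimage_set_system setT (coor i) measurable)).
- by [].
- rewrite -bigcup_seq => _ [B [i _ [C mC <-]] <-].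
  by have := mf i measurableT C mC; rewrite !setTI.
Qed.

End measurable_rV.

Section lebesgue_rV.
Variable R : realType.

Definition rV_cons n (p : R * 'rV[R]_n) : 'rV[R]_n.+1 :=
  row_mx (const_mx p.1 : 'rV_1) p.2.

Lemma measurable_rV_cons n :
  measurable_fun [set: R * 'rV[R]_n] (@rV_cons n).
Proof.
apply/measurable_fun_rVP => i; rewrite /rV_cons.
have [j ->|j ->] := split_ordP (i : 'I_(1 + n)).
- rewrite (_ : (fun _ => _) = fst) //; apply/funext => p.
  by rewrite (@row_mxEl _ 1 1 n) mxE.
- rewrite (_ : (fun _ => _) = (fun x : 'rV[R]_n => x ord0 j) \o snd); last first.
    by apply/funext => p /=; rewrite (@row_mxEr _ 1 1 n).
  by apply: measurableT_comp => //; exact: measurable_coor.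
Qed.

Section lebesgue_rV_step.
Variables (n : nat) (mu : {sigma_finite_measure set 'rV[R]_n -> \bar R}).

Definition lebesgue_rV_step : set 'rV[R]_n.+1 -> \bar R :=
  pushforward (lebesgue_measure \x mu)%E (@rV_cons n).

Let step0 : lebesgue_rV_step set0 = 0%E.
Proof. by rewrite /lebesgue_rV_step /pushforward preimage_set0 measure0. Qed.

Let step_ge0 A : (0 <= lebesgue_rV_step A)%E.
Proof. by apply: (@measure_ge0 _ _ _ (lebesgue_measure \x mu)%E). Qed.

Let measurable_preimage A : measurable A -> measurable (@rV_cons n @^-1` A).
Proof. by move=> mA; rewrite -[X in measurable X]setTI; exact: measurable_rV_cons. Qed.

Let step_sigma_additive : semi_sigma_additive lebesgue_rV_step.
Proof.
move=> F mF tF mUF; rewrite /lebesgue_rV_step /pushforward preimage_bigcup.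
apply: measure_semi_sigma_additive.
- by move=> k; exact: measurable_preimage.
- apply/trivIsetP => /= i j _ _ ij; rewrite -preimage_setI.
  by move/trivIsetP : tF => /(_ _ _ _ _ ij) ->//; rewrite preimage_set0.
- by rewrite -preimage_bigcup; exact: measurable_preimage.
Qed.

HB.instance Definition _ := isMeasure.Build _ _ _ lebesgue_rV_step
  step0 step_ge0 step_sigma_additive.

Let step_sigma_finite : sigma_finite setT lebesgue_rV_step.
Proof.
have /sigma_finiteP[F [TF ndF Foo]] := sigma_finiteT (@lebesgue_measure R).
have /sigma_finiteP[G [TG ndG Goo]] := sigma_finiteT mu.
pose g (x : 'rV[R]_n.+1) : R * 'rV[R]_n :=
  (x ord0 ord0, \row_j x ord0 (lift ord0 j)).
have mg : measurable_fun setT g.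
  apply: measurable_fun_pair; first exact: measurable_coor.
  apply/measurable_fun_rVP => i; under eq_fun do rewrite mxE.
  exact: measurable_coor.
have gK : cancel (@rV_cons n) g.
  case=> t x; congr pair; rewrite /= /rV_cons.
    have -> : (ord0 : 'I_n.+1) = @lshift 1 n ord0 by exact/val_inj.
    by rewrite (@row_mxEl _ 1 1 n) mxE.
  apply/rowP => j; rewrite mxE.
  have -> : lift ord0 j = @rshift 1 n j by exact/val_inj.
  by rewrite (@row_mxEr _ 1 1 n).
exists (fun k => g @^-1` (F k `*` G k)).
  rewrite -preimage_bigcup; apply/esym/seteqP; split=> // x _ /=.
  have [k _ Fk] : (\bigcup_i F i) (g x).1 by rewrite -TF.
  have [l _ Gl] : (\bigcup_i G i) (g x).2 by rewrite -TG.
  exists (maxn k l) => //; split.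
  - by move: Fk; exact/subsetPset/ndF/leq_maxl.
  - by move: Gl; exact/subsetPset/ndG/leq_maxr.
move=> k; have [mF Fk] := Foo k; have [mG Gk] := Goo k; split.
  by rewrite -[X in measurable X]setTI; apply: mg => //; exact: measurableX.
rewrite /lebesgue_rV_step /pushforward -comp_preimage.
rewrite (_ : g \o _ = id); last by apply/funext => p /=; exact: gK.
rewrite preimage_id.
have := product_measure1E (@lebesgue_measure R) mu mF mG => ->.
by rewrite lte_mul_pinfty// ge0_fin_numE.
Qed.

HB.instance Definition _ := Measure_isSigmaFinite.Build _ _ _ lebesgue_rV_step
  step_sigma_finite.

End lebesgue_rV_step.

Fixpoint lebesgue_rV n : {sigma_finite_measure set 'rV[R]_n -> \bar R} :=
  if n is n'.+1 then lebesgue_rV_step (lebesgue_rV n')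
  else @dirac _ 'rV[R]_0 0 R.

End lebesgue_rV.

Notation normc := ComplexField.Normc.normc.
Local Notation Re := complex.Re.
Local Notation Im := complex.Im.

Section complex_functions.
Variable R : realType.

(* e^{it} for real t. *)
Definition expi (t : R) : R[i] := cos t +i* sin t.

Definition cintegral disp (T : measurableType disp)
    (mu : {measure set T -> \bar R}) (f : T -> R[i]) : R[i] :=
  (\int[mu]_t Re (f t)) +i* (\int[mu]_t Im (f t)).

Definition L2 disp (T : measurableType disp) (mu : {measure set T -> \bar R})
    (f : T -> R[i]) : Prop :=
  [/\ measurable_fun [set: T] (fun t => Re (f t)),
      measurable_fun [set: T] (fun t => Im (f t)) &
      (\int[mu]_t (normc (f t) ^+ 2)%:E < +oo)%E].

Definition inner disp (T : measurableType disp) (mu : {measure set T -> \bar R})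
    (f g : T -> R[i]) : R[i] :=
  cintegral mu (fun t => f t * (g t)^*).

(* [p] represents the orthogonal projection of [u] onto the subspace [E]. *)
Definition is_orth_proj disp (T : measurableType disp)
    (mu : {measure set T -> \bar R}) (E : set (T -> R[i])) (u p : T -> R[i]) :=
  E p /\ forall w, E w -> inner mu (fun t => u t - p t) w = 0.

(* A chosen representative; the projection is unique up to a null set. *)
Definition orth_proj disp (T : measurableType disp)
    (mu : {measure set T -> \bar R}) (E : set (T -> R[i])) (u : T -> R[i]) :
    T -> R[i] :=
  xget (fun=> 0) [set p | is_orth_proj mu E u p].

End complex_functions.

Section phase_space.
Variables (R : realType) (d : nat).

Local Notation space := 'rV[R]_d.
Local Notation space2 := ('rV[R]_d * 'rV[R]_d)%type.

Definition lebesgue_space2 : {measure set space2 -> \bar R} :=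
  (lebesgue_rV R d \x lebesgue_rV R d)%E.

Definition dot (v w : space) : R := \sum_(j < d) v ord0 j * w ord0 j.
Definition sqnorm (v : space) : R := dot v v.
Definition jap (z : space2) : R := Num.sqrt (1 + sqnorm z.1 + sqnorm z.2).

(* The coordinate directions of R^{2d}. *)
Definition dir (i : 'I_d + 'I_d) : space2 :=
  match i with
  | inl j => (delta_mx ord0 j, 0)
  | inr j => (0, delta_mx ord0 j)
  end.

Definition partial (i : 'I_d + 'I_d) (f : space2 -> R[i]) (z : space2) : R[i] :=
  'D_(dir i) (fun y => Re (f y)) z +i* 'D_(dir i) (fun y => Im (f y)) z.

Definition partials (s : seq ('I_d + 'I_d)) (f : space2 -> R[i]) :
    space2 -> R[i] :=
  foldr partial f s.

Definition multi_index := {ffun 'I_d + 'I_d -> nat}.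
Definition mabs (alpha : multi_index) : nat := (\sum_i alpha i)%N.
Definition mpartial (alpha : multi_index) : (space2 -> R[i]) -> space2 -> R[i] :=
  partials (flatten [seq nseq (alpha i) i | i <- enum {: 'I_d + 'I_d}]).

(* C^infty: all iterated partial derivatives exist and are continuous. *)
Definition smooth (f : space2 -> R[i]) : Prop :=
  forall s : seq ('I_d + 'I_d),
    [/\ continuous (fun z => Re (partials s f z)),
        continuous (fun z => Im (partials s f z)) &
        forall i z, derivable (fun y => Re (partials s f y)) z (dir i) /\
                    derivable (fun y => Im (partials s f y)) z (dir i)].

Definition schwartz (u : space2 -> R[i]) : Prop :=
  smooth u /\
  forall (alpha : multi_index) (N : nat), exists C : R, forall z,
    jap z ^+ N * normc (mpartial alpha u z) <= C.

(* S^kappa(<(v, eta)>^k); the constants do not depend on h in ]0, 1]. *)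
Definition symbol_class (kappa k : R) (a : R -> space2 -> R[i]) : Prop :=
  (forall h, 0 < h <= 1 -> smooth (a h)) /\
  forall alpha : multi_index, exists2 C : R, 0 < C &
    forall h z, 0 < h <= 1 ->
      normc (mpartial alpha (a h) z)
        <= C * h `^ (- (kappa * (mabs alpha)%:R)) * jap z `^ k.

(* Weyl quantization. The integral in v' is taken first: for u Schwartz and a
   of polynomial growth with its derivatives, integrations by parts in v' show
   that it decays rapidly in eta, so that the iterated integral converges
   absolutely and is the value of the oscillating integral. *)
Definition weyl (h : R) (a : space2 -> R[i]) (u : space -> R[i]) (v : space) :
    R[i] :=
  (((2 * pi * h) ^+ d)^-1)%:C *
  cintegral (lebesgue_rV R d) (fun eta =>
    cintegral (lebesgue_rV R d) (fun v' =>
      expi (h^-1 * dot (v - v') eta) * a (2^-1 *: (v + v'), eta) * u v')).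

(* Entrywise quantization of a matrix-valued symbol, acting in v only on
   functions of (x, v). *)
Definition weyl_mx (h : R) (A : space2 -> 'M[R[i]]_d)
    (w : space2 -> 'cV[R[i]]_d) (z : space2) : 'cV[R[i]]_d :=
  \col_i \sum_(j < d)
    weyl h (fun y => A y i j) (fun v' => w (z.1, v') j ord0) z.2.

Definition b_op (h : R) (u : space2 -> R[i]) (z : space2) : 'cV[R[i]]_d :=
  \col_j (h%:C * partial (inr j) u z + (z.2 ord0 j / 2)%:C * u z).

Definition b_adj (h : R) (w : space2 -> 'cV[R[i]]_d) (z : space2) : R[i] :=
  - h%:C * (\sum_(j < d) partial (inr j) (fun y => w y j ord0) z)
  + 2^-1%:C * \sum_(j < d) (z.2 ord0 j)%:C * w z j ord0.

Definition mu_h (h : R) (v : space) : R :=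
  (2 * pi * h) `^ (- (d%:R / 4)) * expR (- (sqnorm v / (4 * h))).

Definition mu_L2x (h : R) : set (space2 -> R[i]) :=
  [set w | exists2 g, L2 (lebesgue_rV R d) g &
             w = fun z => (mu_h h z.2)%:C * g z.1].

Definition Pi_op (h : R) : (space2 -> R[i]) -> space2 -> R[i] :=
  orth_proj lebesgue_space2 (mu_L2x h).

Definition Q_op (h : R) (u : space2 -> R[i]) (z : space2) : R[i] :=
  h%:C * (u z - Pi_op h u z).

(* The exponent d - 2 is an integer, negative for d = 1. *)
Definition m_symbol (h : R) (z : space2) : R[i] :=
  (2 * \int[lebesgue_measure]_(y in `[0, 1])
     ((y + 1) ^ (d%:Z - 2) *
      expR (- (y / h) * (sqnorm z.1 / 2 + 2 * sqnorm z.2))))%:C.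

(* Id is the d x d identity matrix. *)
Definition m_Id (h : R) (z : space2) : 'M[R[i]]_d := (m_symbol h z)%:M.

Definition adj_symbol (A : space2 -> 'M[R[i]]_d) (z : space2) : 'M[R[i]]_d :=
  (map_mx (@conjc R) (A z))^T.

(* For u in L^2: f = (b_h^* o Op_h(A) o b_h) u as tempered distributions. Each
   factor acts on distributions by duality, through its formal adjoint; that
   of Op_h(A) is Op_h(A^* ). *)
Definition distr_eq (h : R) (A : space2 -> 'M[R[i]]_d)
    (f u : space2 -> R[i]) : Prop :=
  forall phi, schwartz phi ->
    inner lebesgue_space2 f phi =
    inner lebesgue_space2 u
      ((b_adj h \o weyl_mx h (adj_symbol A) \o b_op h) phi).

End phase_space.

(* Main.v *)
Require Import Defs.
From HB Require Import structures.
From mathcomp Require Import all_boot all_order all_algebra.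
From mathcomp Require Import all_classical all_reals all_analysis.
From mathcomp Require Import measurable_realfun.
From mathcomp Require Import ring lra.
Set Implicit Arguments.
Unset Strict Implicit.
Unset Printing Implicit Defensive.
Import Order.TTheory GRing.Theory Num.Theory.
Import numFieldNormedType.Exports.
Local Open Scope classical_set_scope.
Local Open Scope ring_scope.

(** Write q(v, eta) = |v|^2/2 + 2 |eta|^2. The symbol m_h is an average over
    y in ]0, 1], with weight 2 (1+y)^(d-2), of the Gaussians e^(-(y/h) q), and
    the Weyl quantization of a Gaussian is an explicit Gaussian kernel. Hence
    Op_h(m_h) is the integral over y in ]0, 1] of (2/(1+y)^2) T_y, where T_y
    has the Mehler kernel
      ((1+y)/(2 pi h))^d (pi h/(2 y))^(d/2)
        e^(- |v-v'|^2/(8 y h) - y |v+v'|^2/(8 h)).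
    With y = tanh(t/2), T_y is the semigroup e^(-tN) of the harmonic oscillator
    N, where h N is the sum over j of b_j^* b_j, with
    b_j = h d/dv_j + v_j/2. Since b_j lowers the level of N by one, formally
      sum_j b_j^* (2/(1+y)^2 T_y) b_j = - h (d/dy) T_y,
    and T_0 = Id, while T_1 is the projection on the Gaussian mu_h. Integrating
    over [0, 1] gives h (Id - Pi_h).

    The proof replaces functional calculus by the kernels. The generator
    identity becomes pointwise once the b_j are moved onto the kernel by
    integrations by parts: both sides are the kernel times the same quadratic
    polynomial ([generator_kernel], [is_derive_mehler_op_y]). The kernel
    degenerates as y tends to 0, so boundary values and v-derivatives are read
    off another form of T_y, obtained by v' = s v + sigma z: a Gaussian average
    of w(s v + sigma z) which is continuous up to y = 0 ([mehler_op],
    [mehler_op_kernel]). [core_identity] combines the two by the fundamental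
    theorem of calculus.

    The Weyl quantization is an iterated integral that converges absolutely in
    eta only after the integration in v'. For a rapidly decreasing w the inner
    integral is bounded by a product of 1/(1+eta_j^2), uniformly in y, by two
    integrations by parts in each coordinate ([osc_decay]); this justifies
    Fubini and leaves the Fourier transform of a Gaussian ([weyl_eval]). Real
    and imaginary parts of e^(i t) are treated together as cos(t + dl), with
    dl = 0 or dl = -pi/2. Schwartz functions are assumed to decay only for
    derivatives taken in one fixed order of the directions; symmetry of mixed
    derivatives ([clairaut]) gives all the others, and thus the hypotheses of
    these lemmas on each fibre.

    For u in L^2, Pi_h u is almost everywhere mu_h(v) times the integral of
    u(x, v') mu_h(v') in v' ([gauss_proj_orth], [orth_proj_unique]); the Schwartz
    case follows, and the distributional identity is the Schwartz case for the
    test function together with the symmetry of Pi_h ([orth_proj_adj]).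

    For the symbol class, every derivative of m_h is a sum of products of
    coordinates of (v, eta) with derivatives of the radial profile, each of which
    brings a factor y/h under the integral. Pairing every coordinate z_i with one
    factor (y/h)^(1/2), which the Gaussian absorbs, leaves (y/h)^(n/2) for a
    derivative of order n ([sterm], [sterm_sbound]). The remaining integral of
    e^(-y q/2) over [0, 1] is of size 1/(1+q). *)

(** * Real-valued integrals: Fubini and differentiation under the integral *)

Section real_integrals.
Context {R : realType}.

Section two_spaces.
Context d1 d2 (X : measurableType d1) (Y : measurableType d2).
Variables (m1 : {sigma_finite_measure set X -> \bar R})
  (m2 : {sigma_finite_measure set Y -> \bar R}).

Lemma Rintegral_ae_eq (f g : Y -> R) :
  measurable_fun setT f -> measurable_fun setT g ->
  {ae m2, forall y, f y = g y} -> \int[m2]_y f y = \int[m2]_y g y.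
Proof.
move=> mf mg fg; congr fine; apply: ae_eq_integral => //.
- exact/measurable_EFinP.
- exact/measurable_EFinP.
- by apply: filterS fg => y /= -> _.
Qed.

(** Holds even where some slice is not integrable: positive and negative parts
    are measurable by Tonelli, and [fine] is total. *)
Lemma measurable_fun_Rintegral (F : X * Y -> R) : measurable_fun setT F ->
  measurable_fun setT (fun x => \int[m2]_y F (x, y)).
Proof.
move=> mF; rewrite /Rintegral.
apply: (measurableT_comp (f := @fine R)) => //.
rewrite (_ : (fun x => _) = (fun x => \int[m2]_y ((EFin \o F)^\+ (x, y)) - \int[m2]_y ((EFin \o F)^\- (x, y)))%E); last first.
  apply/funext => x; rewrite [LHS]integralE.
  under eq_integral do rewrite (funepos_comp (EFin \o F) (fun y => (x, y))).
  by under [X in (_ - X)%E = _]eq_integral do rewrite (funeneg_comp (EFin \o F) (fun y => (x, y))).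
apply: emeasurable_funB; apply: measurable_fun_fubini_tonelli_F => //.
- by apply: measurable_funepos; exact/measurable_EFinP.
- by apply: measurable_funeneg; exact/measurable_EFinP.
Qed.

Lemma integrable_prod_dom (F : X * Y -> R) (A : X -> R) (B : Y -> R) :
  measurable_fun setT F ->
  m1.-integrable setT (EFin \o A) -> m2.-integrable setT (EFin \o B) ->
  (forall x y, `|F (x, y)| <= A x * B y) ->
  (m1 \x m2)%E.-integrable setT (EFin \o F).
Proof.
move=> mF iA iB FAB; apply/integrable12ltyP; first exact/measurable_EFinP.
have /integrableP[mA iA'] := iA; have /integrableP[mB iB'] := iB.
have mB' : measurable_fun setT (fun y => `|(B y)%:E|%E).
  by apply: measurableT_comp => //; exact: mB.
have mF' : measurable_fun setT (fun z : X * Y => `|(F z)%:E|%E).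
  by apply: measurableT_comp => //; exact/measurable_EFinP.
apply: (@le_lt_trans _ _ (\int[m1]_x (`|A x|%:E * \int[m2]_y `|(B y)%:E|))%E).
  apply: ge0_le_integral => //=.
  - by move=> x _; exact: integral_ge0.
  - exact: (measurable_fun_fubini_tonelli_F (fun z : X * Y => `|(F z)%:E|%E)).
  - apply: emeasurable_funM => //; apply/measurable_EFinP.
    by apply: measurableT_comp => //; exact/measurable_EFinP.
  - move=> x _; rewrite -ge0_integralZl//=.
    apply: ge0_le_integral => //= [||y _].
    + exact: (measurableT_comp mF' (pair1_measurable x)).
    + exact: (measurable_funeM _ mB').
    + by rewrite lee_fin (le_trans (FAB _ _))// (le_trans (ler_norm _))// normrM.
have mA' : measurable_fun setT (fun x => `|(A x)%:E|%E).
  by apply: measurableT_comp => //; exact: mA.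
rewrite ge0_integralZr//=; last exact: integral_ge0.
by apply: lte_mul_pinfty => //; [exact: integral_ge0|rewrite ge0_fin_numE//; exact: integral_ge0].
Qed.

(** The inner real integral agrees with the extended one on almost every slice,
    where the slice is integrable. *)
Lemma RFubini (F : X * Y -> R) : (m1 \x m2)%E.-integrable setT (EFin \o F) ->
  \int[m1]_x \int[m2]_y F (x, y) = \int[(m1 \x m2)%E]_z F z.
Proof.
move=> iF; congr fine; rewrite -(integral12_prod_meas1 iF).
have mF : measurable_fun setT F by apply/measurable_EFinP; exact: (measurable_int _ iF).
apply: ae_eq_integral => //.
- by apply/measurable_EFinP; exact: measurable_fun_Rintegral.
- exact: (measurable_fubini_F iF).
- have := ae_integrable1 iF; apply: filterS => x ix _.
  by rewrite /Rintegral fineK//; exact: integrable_fin_num.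
Qed.

End two_spaces.

Lemma RFubini_swap d1 d2 (X : measurableType d1) (Y : measurableType d2)
  (m1 : {sigma_finite_measure set X -> \bar R})
  (m2 : {sigma_finite_measure set Y -> \bar R}) (F : X -> Y -> R) :
  (m1 \x m2)%E.-integrable setT (fun z => (F z.1 z.2)%:E) ->
  \int[m1]_x \int[m2]_y F x y = \int[m2]_y \int[m1]_x F x y.
Proof.
move=> iF; rewrite (RFubini (F := fun z => F z.1 z.2) iF).
rewrite /Rintegral -(integral21_prod_meas1 iF); congr fine.
have mF : measurable_fun setT (fun z => F z.1 z.2).
  by apply/measurable_EFinP; exact: (measurable_int _ iF).
apply: ae_eq_integral => //.
- exact: (measurable_fubini_G iF).
- apply/measurable_EFinP; apply: (@measurable_fun_Rintegral _ _ _ _ m1 (fun z => F z.2 z.1)).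
  exact: (measurableT_comp mF (@measurable_swap _ _ Y X)).
- have := ae_integrable2 iF; apply: filterS => y iy _.
  by rewrite /= fineK//; exact: integrable_fin_num.
Qed.

(** Dominated differentiation in the form used throughout: the dominating
    function is only compared with the derivative near the point. *)
Lemma is_derive_Rintegral d (Y : measurableType d)
    (mu : {measure set Y -> \bar R}) (B : set Y) (f df : R -> Y -> R) (a e : R) (G : Y -> R) :
  measurable B -> 0 < e ->
  (forall x, `|x - a| < e -> mu.-integrable B (EFin \o f x)) ->
  (forall x y, B y -> `|x - a| < e -> is_derive x 1 (f ^~ y) (df x y)) ->
  mu.-integrable B (EFin \o G) ->
  (forall x y, B y -> `|x - a| < e -> `|df x y| <= G y) ->
  is_derive a 1 (fun x => \int[mu]_(y in B) f x y) (\int[mu]_(y in B) df a y).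
Proof.
move=> mB e0 If Df IG dfG.
have IP x : `]a - e, a + e[%classic x -> `|x - a| < e.
  by rewrite /= in_itv/= ltr_distl => ->.
have Ia : `]a - e, a + e[%classic a by rewrite /= in_itv/= ltrBlDr ltrDl e0.
have d1 x y : `]a - e, a + e[%classic x -> B y -> (partial1of2 f) x y = df x y.
  by move=> /IP ax By; rewrite partial1of2E; have := Df x y By ax => -[_ ->].
have IG' : mu.-integrable B (EFin \o (fun y => `|G y|)) by exact: integrable_norm.
have If' x : `]a - e, a + e[%classic x -> mu.-integrable B (EFin \o f x).
  by move=> /IP; exact: If.
have Df' x y : `]a - e, a + e[%classic x -> B y -> derivable (f ^~ y) x 1.
  by move=> /IP ax By; have [] := Df x y By ax.
have Gb x y : `]a - e, a + e[%classic x -> B y -> `|(partial1of2 f) x y| <= `|G y|.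
  move=> Ix By; rewrite d1//; apply: le_trans (ler_norm _); exact: dfG (IP _ Ix).
have G0 y : 0 <= `|G y| by [].
split; first exact: (derivable_under_integral mB Ia If' Df' G0 IG' Gb).
have := differentiation_under_integral mB Ia If' Df' G0 IG' Gb.
rewrite derive1E => ->; apply: eq_Rintegral => y; rewrite inE => By.
exact: d1.
Qed.

End real_integrals.

(** * Borel measurability and iterated integrals on R^n *)

Section grid.
Context {R : realType}.

(** Discretization with countably many measurable cells makes [f] a pointwise
    limit of functions that take countably many values. *)
Lemma measurable_fun_grid d (T : measurableType d) (I : countType)
    (enc : nat -> T -> I) (dec : nat -> I -> T) (f : T -> R) :
  (forall k c, measurable (enc k @^-1` [set c])) ->
  (forall x, f (dec k (enc k x)) @[k --> \oo] --> f x) ->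
  measurable_fun setT f.
Proof.
move=> menc cf; apply: (@measurable_fun_cvg _ _ _ _ (fun k x => f (dec k (enc k x)))).
  move=> k _ B mB; rewrite setTI.
  rewrite (_ : _ @^-1` B = \bigcup_c (if pselect (B (f (dec k c))) then enc k @^-1` [set c] else set0)).
    apply: countable_bigcupT_measurable; first exact: countableP.
    by move=> c; case: (pselect (B (f (dec k c)))) => ? /=.
  apply/seteqP; split=> x /=.
    by move=> Bx; exists (enc k x) => //=; case: pselect.
  by move=> [c _]; case: (pselect (B (f (dec k c)))) => //= Bc; rewrite /set1/= => ->.
by move=> x _; exact: cf.
Qed.

Definition grid n (k : nat) (x : 'rV[R]_n) : 'rV[int]_n :=
  \row_j Num.floor (k.+1%:R * x ord0 j).
Definition ungrid n (k : nat) (c : 'rV[int]_n) : 'rV[R]_n :=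
  \row_j ((c ord0 j)%:~R / k.+1%:R).

Lemma measurable_grid n k (c : 'rV[int]_n) : measurable (@grid n k @^-1` [set c] : set 'rV[measurableTypeR R]_n).
Proof.
rewrite (_ : _ @^-1` _ = \bigcap_(j in [set: 'I_n]) [set x : 'rV[R]_n | x ord0 j \in `[(c ord0 j)%:~R / k.+1%:R, ((c ord0 j) + 1)%:~R / k.+1%:R[]).
  apply: fin_bigcap_measurable => [|j _]; first exact: finite_finset.
  have := @measurable_coor _ (measurableTypeR R) n j measurableT (`[(c ord0 j)%:~R / k.+1%:R, ((c ord0 j) + 1)%:~R / k.+1%:R[%classic) (measurable_itv _).
  by rewrite setTI.
apply/seteqP; split=> x /=.
  move=> <- j _ /=; rewrite mxE in_itv/= ler_pdivrMr// ltr_pdivlMr//.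
  by rewrite [x ord0 j * _]mulrC floor_le_tmp floorD1_gt.
move=> cx; apply/rowP => j; rewrite mxE; apply/floor_def.
have /= := cx j I; rewrite in_itv/= ler_pdivrMr// ltr_pdivlMr//.
by rewrite [x ord0 j * _]mulrC.
Qed.

Lemma mx_norm_le n (x : 'rV[R]_n) (e : R) : 0 <= e ->
  (forall j, `|x ord0 j| <= e) -> `|x| <= e.
Proof.
move=> e0 xe; rewrite [leLHS]/Num.norm /= mx_normrE; apply/bigmax_leP; split=> //.
by move=> [i j] _ /=; rewrite (ord1 i).
Qed.

Lemma cvg_grid n (x : 'rV[R]_n) : ungrid k (grid k x) @[k --> \oo] --> x.
Proof.
apply/cvgrPdist_le => e e0; near=> k.
have ke : k.+1%:R^-1 <= e by near: k; apply: filterS (near_infty_natSinv_lt (PosNum e0)) => k /=; exact: ltW.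
apply: mx_norm_le => [|j]; first exact: ltW.
rewrite !mxE; apply: le_trans ke.
have k0 : 0 < k.+1%:R :> R by [].
have fl : (Num.floor (k.+1%:R * x ord0 j))%:~R <= k.+1%:R * x ord0 j by rewrite floor_le_tmp.
have fg : k.+1%:R * x ord0 j < (Num.floor (k.+1%:R * x ord0 j) + 1)%:~R by rewrite floorD1_gt.
rewrite intrD in fg.
set a := (_%:~R) in fl fg *.
rewrite ler_norml; apply/andP; split.
  by rewrite lerBrDr (le_trans (y := 0 + a / k.+1%:R)) // ?lerD2r ?oppr_le0 ?invr_ge0// add0r ler_pdivrMr// mulrC.
by rewrite lerBlDr -[X in _ <= X + _]mul1r -mulrDl ler_pdivlMr// mulrC addrC ltW.
Unshelve. all: end_near. Qed.

(** The measurable structure on R^n is the product sigma-algebra, the topology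
    comes from the sup norm; cubes of side 1/(k+1) link the two. *)
Lemma continuous_measurable_rV n (f : 'rV[R]_n -> R) :
  continuous f -> measurable_fun [set: 'rV[R]_n] f.
Proof.
move=> cf; apply: (@measurable_fun_grid _ _ _ (@grid n) (@ungrid n)).
  by move=> k c; exact: measurable_grid.
by move=> x; apply: continuous_cvg; [exact: cf|exact: cvg_grid].
Qed.

Lemma continuous_measurable_rV2 n (f : 'rV[R]_n * 'rV[R]_n -> R) :
  continuous f -> measurable_fun [set: 'rV[R]_n * 'rV[R]_n] f.
Proof.
move=> cf; apply: (@measurable_fun_grid _ _ ('rV[int]_n * 'rV[int]_n)%type
   (fun k x => (grid k x.1, grid k x.2)) (fun k c => (ungrid k c.1, ungrid k c.2))).
  move=> k [c1 c2].
  rewrite (_ : _ @^-1` _ = (@grid n k @^-1` [set c1]) `*` (@grid n k @^-1` [set c2])).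
    by apply: measurableX; exact: measurable_grid.
  by apply/seteqP; split=> -[x1 x2] /= [-> ->].
move=> [x1 x2] /=; apply: (cvg_comp _ f); last exact: cf.
have := cvg_pair (@cvg_grid n x1) (@cvg_grid n x2); apply.
Qed.

End grid.

Section lebesgue_integral_rV.
Context {R : realType}.
Notation leb := (lebesgue_rV R).

Lemma rV_consE0 n (p : R * 'rV[R]_n) : rV_cons p ord0 ord0 = p.1.
Proof.
have -> : (ord0 : 'I_n.+1) = @lshift 1 n ord0 by exact/val_inj.
by rewrite /rV_cons (@row_mxEl _ 1 1 n) mxE.
Qed.

Lemma rV_consES n (p : R * 'rV[R]_n) j : rV_cons p ord0 (lift ord0 j) = p.2 ord0 j.
Proof.
have -> : lift ord0 j = @rshift 1 n j by exact/val_inj.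
by rewrite /rV_cons (@row_mxEr _ 1 1 n).
Qed.

Lemma ge0_integral_rV_cons n (f : 'rV[R]_n.+1 -> \bar R) :
  measurable_fun setT f -> (forall x, 0 <= f x)%E ->
  (\int[leb n.+1]_x f x = \int[lebesgue_measure \x leb n]_x f (rV_cons x))%E.
Proof.
move=> mf f0.
have mc : measurable_fun [set: (measurableTypeR R * 'rV[R]_n)%type] (@rV_cons R n) := @measurable_rV_cons R n.
pose mm : {measure set (measurableTypeR R * 'rV[R]_n) -> \bar R} := (@lebesgue_measure R \x leb n)%E.
have := ge0_integral_pushforward mc mm measurableT mf (fun y _ => f0 y).
rewrite preimage_setT => <-.
by apply: eq_measure_integral.
Qed.

Lemma ge0_integral_rVS n (f : 'rV[R]_n.+1 -> \bar R) :
  measurable_fun setT f -> (forall x, 0 <= f x)%E ->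
  (\int[leb n.+1]_x f x = \int[lebesgue_measure]_t \int[leb n]_x f (rV_cons (t, x)))%E.
Proof.
move=> mf f0; rewrite ge0_integral_rV_cons// fubini_tonelli1//.
exact: (measurableT_comp mf (@measurable_rV_cons R n)).
Qed.

Lemma integrable_rVSP n (f : 'rV[R]_n.+1 -> R) : measurable_fun setT f ->
  (leb n.+1).-integrable setT (EFin \o f) <->
  ((@lebesgue_measure R) \x leb n)%E.-integrable setT (EFin \o (f \o @rV_cons R n)).
Proof.
move=> mf; split=> /integrableP[_ fi]; apply/integrableP; split.
- by apply/measurable_EFinP; exact: (measurableT_comp mf (@measurable_rV_cons R n)).
- move: fi; rewrite ge0_integral_rV_cons//.
  by apply: measurableT_comp => //; exact/measurable_EFinP.
- exact/measurable_EFinP.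
- rewrite ge0_integral_rV_cons//.
  by apply: measurableT_comp => //; exact/measurable_EFinP.
Qed.

Lemma Rintegral_rVS n (f : 'rV[R]_n.+1 -> R) :
  (leb n.+1).-integrable setT (EFin \o f) ->
  \int[leb n.+1]_x f x = \int[lebesgue_measure]_t \int[leb n]_x f (rV_cons (t, x)).
Proof.
move=> fi; have mf : measurable_fun setT f by apply/measurable_EFinP; exact: (measurable_int _ fi).
have fi' := (integrable_rVSP mf).1 fi.
have -> := RFubini fi'; congr fine.
have mc : measurable_fun [set: (measurableTypeR R * 'rV[R]_n)%type] (@rV_cons R n) := @measurable_rV_cons R n.
pose mm : {measure set (measurableTypeR R * 'rV[R]_n) -> \bar R} := (@lebesgue_measure R \x leb n)%E.
have := @integral_pushforward _ _ _ _ R _ mc mm setT _ (measurable_int _ fi) fi' measurableT.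
rewrite preimage_setT => <-.
by apply: eq_measure_integral.
Qed.

Lemma Rintegral_rV0 (f : 'rV[R]_0 -> R) : \int[leb 0]_x f x = f 0.
Proof.
rewrite /Rintegral (eq_integral (cst (f 0)%:E)).
  by have := integral_dirac (0 : 'rV[R]_0) measurableT (measurable_cst (f 0)%:E) ; rewrite /= => ->; rewrite /dirac indicE in_setT mul1e.
by move=> x _; rewrite (_ : x = 0)//; apply/rowP => -[].
Qed.

End lebesgue_integral_rV.

(** * Affine changes of variables, weights and integration by parts *)

Section affine.
Context {R : realType}.
Notation leb := (lebesgue_rV R).
Notation mu := (@lebesgue_measure R).

(** The image of Lebesgue measure under the affine map, rescaled, gives every
    interval its length, so it is Lebesgue measure. *)
Lemma ge0_integral_affine1 (a s : R) (f : R -> \bar R) : 0 < s ->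
  measurable_fun setT f -> (forall x, 0 <= f x)%E ->
  (s%:E * \int[mu]_x f (a + s * x)%R = \int[mu]_x f x)%E.
Proof.
move=> s0 mf f0.
pose phi : measurableTypeR R -> measurableTypeR R := fun x => a + s * x.
have mphi : measurable_fun [set: measurableTypeR R] phi.
  by apply: measurable_funD => //; exact: measurable_funM.
pose nn := NngNum (ltW s0).
pose nu0 : {measure set (measurableTypeR R) -> \bar R} := mscale nn (pushforward mu phi).
pose nu := nu0 mphi.
have munu A : measurable A -> mu A = nu A.
  apply: lebesgue_measure_unique => _ [[u v] _ <-] /=.
  rewrite /nu/= /mscale/= /pushforward.
  rewrite (_ : _ @^-1` _ = `](u - a) / s, (v - a) / s]%classic); last first.
    apply/seteqP; split=> x /=; rewrite !in_itv/= /phi.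
      by rewrite ltr_pdivrMr// ler_pdivlMr// ltrBlDl lerBrDl [x * s]mulrC.
    by rewrite ltr_pdivrMr// ler_pdivlMr// ltrBlDl lerBrDl [x * s]mulrC.
  rewrite !lebesgue_measure_itv/= !lte_fin ltr_pM2r ?invr_gt0// ltrD2r.
  case: ifPn => _; last by rewrite mule0.
  rewrite -!EFinB -EFinM; congr EFin; field.
  by rewrite lt0r_neq0.
rewrite [RHS](@eq_measure_integral _ _ _ _ nu); last by move=> A mA _; exact: munu.
rewrite ge0_integral_mscale//; congr (_ * _)%E.
by rewrite (ge0_integral_pushforward mphi)// preimage_setT.
Qed.

Lemma affineE n (a x : 'rV[R]_n) s j : (a + s *: x) ord0 j = a ord0 j + s * x ord0 j.
Proof. by rewrite !mxE. Qed.

Lemma rV_cons_affine n (a : 'rV[R]_n.+1) s t (x : 'rV[R]_n) :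
  a + s *: rV_cons (t, x) =
  rV_cons (a ord0 ord0 + s * t, (\row_j a ord0 (lift ord0 j)) + s *: x).
Proof.
apply/rowP => j; case: (unliftP ord0 j) => [k|] ->.
  by rewrite [RHS]rV_consES affineE rV_consES affineE mxE.
by rewrite [RHS]rV_consE0 affineE rV_consE0.
Qed.

Lemma measurable_affine n (a : 'rV[R]_n) s :
  measurable_fun [set: 'rV[R]_n] (fun x => a + s *: x).
Proof.
apply/measurable_fun_rVP => i.
rewrite (_ : (fun _ => _) = (fun x : 'rV[R]_n => a ord0 i + s * x ord0 i)).
  by apply: measurable_funD => //; apply: measurable_funM => //; exact: measurable_coor.
by apply/funext => x; rewrite !mxE.
Qed.

Lemma ge0_integral_affine n (a : 'rV[R]_n) (s : R) (f : 'rV[R]_n -> \bar R) : 0 < s ->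
  measurable_fun setT f -> (forall x, 0 <= f x)%E ->
  ((s ^+ n)%:E * \int[leb n]_x f (a + s *: x)%R = \int[leb n]_x f x)%E.
Proof.
move=> s0; elim: n a f => [|n IH] a f mf f0.
  rewrite expr0 mul1e; apply: eq_integral => x _; congr f.
  by apply/rowP => -[].
have mfa : measurable_fun setT (fun x : 'rV[R]_n.+1 => f (a + s *: x)).
  exact: (measurableT_comp mf (measurable_affine a s)).
have mfc := measurableT_comp mf (@measurable_rV_cons R n).
rewrite !ge0_integral_rVS// exprS EFinM -muleA.
pose g t := (\int[leb n]_x f (rV_cons (t, x)))%E.
have mg : measurable_fun setT g.
  by apply: (@measurable_fun_fubini_tonelli_F _ _ _ _ _ (leb n) (f \o @rV_cons R n)) => // z; exact: f0.
have g0 t : (0 <= g t)%E by exact: integral_ge0.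
rewrite -/g -(ge0_integral_affine1 (a ord0 ord0) s0 mg g0); congr (_ * _)%E.
rewrite -ge0_integralZl//; last 3 first.
- apply: (@measurable_fun_fubini_tonelli_F _ _ _ _ _ (leb n) (fun z => f (a + s *: rV_cons z))) => //.
  exact: (measurableT_comp mfa (@measurable_rV_cons R n)).
- by move=> t _; exact: integral_ge0.
- by rewrite lee_fin exprn_ge0// ltW.
apply: eq_integral => t _.
under eq_integral do rewrite rV_cons_affine.
rewrite (IH _ (fun x => f (rV_cons (a ord0 ord0 + s * t, x)))) //.
exact: (measurableT_comp mfc (pair1_measurable _)).
Qed.

Section change_of_variables.
Context d (Y : measurableType d) (nu : {measure set Y -> \bar R}).
Variables (phi : Y -> Y) (c : R).
Hypotheses (mphi : measurable_fun setT phi) (c0 : 0 < c).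
Hypothesis nu_phi : forall f : Y -> \bar R, measurable_fun setT f ->
  (forall x, 0 <= f x)%E -> (c%:E * \int[nu]_x f (phi x) = \int[nu]_x f x)%E.

(** For a map that scales the integrals of nonnegative functions by a constant,
    integrability follows from that of the norm, and the formula from the
    positive and negative parts. *)
Lemma integrable_change (f : Y -> R) : nu.-integrable setT (EFin \o f) ->
  nu.-integrable setT (EFin \o (f \o phi)).
Proof.
move=> /integrableP[mf fi]; apply/integrableP; split.
  exact: (measurableT_comp mf mphi).
have mf' : measurable_fun setT (fun x => `|(f x)%:E|%E) by exact: measurableT_comp.
have := nu_phi mf' (fun=> abse_ge0 _).
move: fi => /= fi E; rewrite -E in fi.
rewrite ltey; apply/eqP => Ey; move: fi; rewrite Ey.
by rewrite gt0_muley ?lte_fin.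
Qed.

Lemma Rintegral_change (f : Y -> R) : nu.-integrable setT (EFin \o f) ->
  \int[nu]_x f x = c * \int[nu]_x f (phi x).
Proof.
move=> fi; have fai := integrable_change fi.
have mf := measurable_int _ fi.
rewrite {1}/Rintegral.
have -> : (\int[nu]_x (f x)%:E)%E = (c%:E * \int[nu]_x (f (phi x))%:E)%E.
  rewrite integralE [in RHS]integralE muleBr//; last first.
    apply: fin_num_adde_defr.
    exact: integrable_pos_fin_num.
  rewrite -(nu_phi (measurable_funepos mf))//.
  rewrite -(nu_phi (measurable_funeneg mf))//.
  congr (_ * _ - _ * _)%E; apply: eq_integral => x _.
    exact: (esym (congr1 (fun g => g x) (funepos_comp (EFin \o f) phi))).
  exact: (esym (congr1 (fun g => g x) (funeneg_comp (EFin \o f) phi))).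
by rewrite fineM//; exact: integrable_fin_num.
Qed.

End change_of_variables.

Lemma integrable_affine n (a : 'rV[R]_n) (s : R) (f : 'rV[R]_n -> R) : 0 < s ->
  (leb n).-integrable setT (EFin \o f) ->
  (leb n).-integrable setT (EFin \o (fun x => f (a + s *: x))).
Proof.
move=> s0; apply: (integrable_change (measurable_affine a s) (exprn_gt0 n s0)).
by move=> g mg g0; exact: ge0_integral_affine.
Qed.

Lemma Rintegral_affine n (a : 'rV[R]_n) (s : R) (f : 'rV[R]_n -> R) : 0 < s ->
  (leb n).-integrable setT (EFin \o f) ->
  \int[leb n]_x f x = s ^+ n * \int[leb n]_x f (a + s *: x).
Proof.
move=> s0; apply: (Rintegral_change (measurable_affine a s) (exprn_gt0 n s0)).
by move=> g mg g0; exact: ge0_integral_affine.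
Qed.

Lemma measurable_affine1 (a s : R) : measurable_fun [set: measurableTypeR R] (fun x : R => a + s * x).
Proof. by apply: measurable_funD => //; exact: measurable_funM. Qed.

Lemma integrable_affine1 (a s : R) (f : R -> R) : 0 < s ->
  mu.-integrable setT (EFin \o f) ->
  mu.-integrable setT (EFin \o (fun x => f (a + s * x))).
Proof.
move=> s0; apply: (integrable_change (measurable_affine1 a s) s0).
by move=> g mg g0; exact: ge0_integral_affine1.
Qed.

Lemma Rintegral_affine1 (a s : R) (f : R -> R) : 0 < s ->
  mu.-integrable setT (EFin \o f) ->
  \int[mu]_x f x = s * \int[mu]_x f (a + s * x).
Proof.
move=> s0; apply: (Rintegral_change (measurable_affine1 a s) s0).
by move=> g mg g0; exact: ge0_integral_affine1.
Qed.

End affine.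

Section weights.
Context {R : realType}.
Notation leb := (lebesgue_rV R).
Notation mu := (@lebesgue_measure R).

Lemma oneDsqr_gt0 (x : R) : 0 < oneDsqr x.
Proof. exact: lt_le_trans ltr01 (oneDsqr_ge1 x). Qed.

Lemma oneDsqr_ge0 (x : R) : 0 <= oneDsqr x.
Proof. exact/ltW/oneDsqr_gt0. Qed.

Lemma integrable_oneDsqrV : mu.-integrable setT (fun x : R => ((oneDsqr x)^-1)%:E).
Proof.
apply/integrableP; split.
  apply/measurable_EFinP; apply: continuous_measurable_fun; exact: continuous_oneDsqrV.
under eq_integral do rewrite gee0_abs ?lee_fin ?invr_ge0 ?oneDsqr_ge0//.
rewrite (@ge0_symfun_integralT _ (fun x => (oneDsqr x)^-1)).
- rewrite (_ : [set x | _] = `[0, +oo[%classic); last first.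
    by apply/seteqP; split => x/=; rewrite in_itv/= andbT.
  by rewrite integral0y_oneDsqr -EFinM ltry.
- by move=> x; rewrite invr_ge0 oneDsqr_ge0.
- exact: continuous_oneDsqrV.
- by move=> x /=; rewrite /oneDsqr sqrrN.
Qed.

Lemma integrable_rV_prod n (f : 'I_n -> R -> R) :
  (forall j, mu.-integrable setT (EFin \o f j)) ->
  (leb n).-integrable setT (fun x : 'rV[R]_n => (\prod_j f j (x ord0 j))%:E).
Proof.
elim: n f => [|n IH] f fi.
  apply/integrableP; split.
    rewrite (_ : (fun _ => _) = cst 1%:E)//.
    by apply/funext => x; rewrite big_ord0.
  under eq_integral do rewrite big_ord0.
  have := integral_dirac (0 : 'rV[R]_0) measurableT (measurable_cst `|1%:E : \bar R|%E).
  by rewrite /= => ->; rewrite /dirac indicE in_setT mul1e normr1 ltry.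
have mf j : measurable_fun setT (f j) by apply/measurable_EFinP; exact: (measurable_int _ (fi j)).
apply/(@integrable_rVSP _ _ (fun x : 'rV[R]_n.+1 => (\prod_j f j (x ord0 j)))).
  apply: measurable_prod => j _; apply: measurableT_comp => //; exact: measurable_coor.
apply: (@integrable_prod_dom R _ _ (measurableTypeR R) 'rV[R]_n mu (leb n) ((fun x : 'rV[R]_n.+1 => \prod_j f j (x ord0 j)) \o @rV_cons R n) (fun t => `|f ord0 t|) (fun x => `|\prod_j f (lift ord0 j) (x ord0 j)|)).
- apply: (measurableT_comp _ (@measurable_rV_cons R n)).
  apply: measurable_prod => j _; apply: measurableT_comp => //; exact: measurable_coor.
- exact: integrable_norm.
- by apply: integrable_norm; apply: (IH (fun j => f (lift ord0 j))).
- move=> t x /=; rewrite big_ord_recl rV_consE0 normrM.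
  by rewrite (eq_bigr (fun j => f (lift ord0 j) (x ord0 j)))// => j _; rewrite rV_consES.
Qed.

(** The product of the 1/(1+x_j^2): an integrable weight that splits over the
    coordinates, so that coordinatewise estimates can be multiplied. *)
Definition wt n (x : 'rV[R]_n) : R := \prod_j (oneDsqr (x ord0 j))^-1.

Lemma integrable_wt n : (leb n).-integrable setT (EFin \o @wt n).
Proof. exact: (@integrable_rV_prod n (fun _ t => (oneDsqr t)^-1) (fun=> integrable_oneDsqrV)). Qed.

Lemma wt_gt0 n (x : 'rV[R]_n) : 0 < wt x.
Proof. by apply: prodr_gt0 => j _; rewrite invr_gt0 oneDsqr_gt0. Qed.

Lemma oneDsqrV_shift (x t : R) : `|t| <= 1 ->
  (oneDsqr (x + t))^-1 <= 3 * (oneDsqr x)^-1.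
Proof.
rewrite ler_norml => /andP[t1 t2].
rewrite ler_pdivlMr ?oneDsqr_gt0// mulrC ler_pdivrMr ?oneDsqr_gt0//.
by rewrite /oneDsqr; have := sqr_ge0 (2 * x + 3 * t); nra.
Qed.

(** Comparability under bounded shifts gives one dominating function for all
    small translates. *)
Lemma wt_shift n (x : 'rV[R]_n) (j : 'I_n) (t : R) : `|t| <= 1 ->
  wt (x + t *: delta_mx ord0 j) <= 3 * wt x.
Proof.
move=> t1; rewrite /wt (bigD1 j)//= [X in _ <= 3 * X](bigD1 j)//= mulrA.
rewrite !mxE !eqxx mulr1; apply: ler_pM.
- by rewrite invr_ge0 oneDsqr_ge0.
- by apply: prodr_ge0 => k _; rewrite invr_ge0 oneDsqr_ge0.
- exact: oneDsqrV_shift.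
- apply: ler_prod => k kj; rewrite invr_ge0 oneDsqr_ge0/= !mxE eqxx (negPf kj)/=.
  by rewrite mulr0 addr0.
Qed.

(** The integral of F along a measure preserving flow does not depend on time,
    and its derivative at time 0 is the integral of dF. *)
Lemma Rintegral_flow d (Y : measurableType d) (nu : {measure set Y -> \bar R})
    (tau : R -> Y -> Y) (F dF : Y -> R) (G : Y -> R) :
  (forall t, `|t| < 1 -> nu.-integrable setT (EFin \o (F \o tau t))) ->
  (forall t, `|t| < 1 -> \int[nu]_y F (tau t y) = \int[nu]_y F y) ->
  (forall y, tau 0 y = y) ->
  (forall t y, `|t| < 1 -> is_derive (t : R) (1 : R) (fun t : R => F (tau t y)) (dF (tau t y))) ->
  nu.-integrable setT (EFin \o G) ->
  (forall t y, `|t| < 1 -> `|dF (tau t y)| <= G y) ->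
  \int[nu]_y dF y = 0.
Proof.
move=> iF cF tau0 DF iG dFG.
have D0 : is_derive (0 : R) 1 (fun t => \int[nu]_y F (tau t y)) (\int[nu]_y dF (tau 0 y)).
  apply: (@is_derive_Rintegral _ _ _ nu setT _ (fun t y => dF (tau t y)) 0 1 G) => //.
  - by move=> t; rewrite subr0; exact: iF.
  - by move=> t y _; rewrite subr0; exact: DF.
  - by move=> t y _; rewrite subr0; exact: dFG.
have D0' : is_derive (0 : R) 1 (fun t => \int[nu]_y F (tau t y)) 0.
  apply: (@near_eq_is_derive R R R (cst (\int[nu]_y F y)) _ 0 1 0).
    by apply: filterS (@nbhs0_lt R R 1 ltr01) => t t1; rewrite /= cF.
transitivity (\int[nu]_y dF (tau 0 y)); first by apply: eq_Rintegral => y _; rewrite tau0.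
by rewrite -(@derive_val _ _ _ _ _ _ _ D0) (@derive_val _ _ _ _ _ _ _ D0').
Qed.

Lemma integrable_wt_dom n (F : 'rV[R]_n -> R) C : measurable_fun setT F ->
  (forall x, `|F x| <= C * wt x) -> (leb n).-integrable setT (EFin \o F).
Proof.
move=> mF FC; apply: (@le_integrable _ _ _ _ _ _ _ (fun x => (C * wt x)%:E)) => //.
- exact/measurable_EFinP.
- by move=> x _ /=; rewrite lee_fin (le_trans (FC x))// ler_norm.
- exact: (integrableZl _ _ (integrable_wt n)).
Qed.

Lemma is_derive_line (V : normedModType R) (f : V -> R) (p e : V) (t : R) (df : R) :
  is_derive (p + t *: e) e f df -> is_derive t 1 (fun t => f (p + t *: e)) df.
Proof.
move=> [Df <-]; have E : (fun h : R => h^-1 *: ((f \o shift (p + t *: e)) (h *: e) - f (p + t *: e))) =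
   (fun h => h^-1 *: (((fun t => f (p + t *: e)) \o shift t) (h *: 1) - f (p + t *: e))).
  apply/funext => h /=; congr (_ *: (f _ - _)).
  by rewrite scalerDl /GRing.scale/= mulr1 addrC -addrA; congr (_ + _); rewrite addrC.
split; first by move: Df; rewrite /derivable E.
by rewrite /derive E.
Qed.

(** Integration by parts on R^n, as translation invariance of the measure. *)
Lemma Rintegral_partial n (j : 'I_n) (F dF : 'rV[R]_n -> R) C :
  measurable_fun setT F ->
  (forall x, is_derive x (delta_mx ord0 j) F (dF x)) ->
  (forall x, `|F x| <= C * wt x) -> (forall x, `|dF x| <= C * wt x) ->
  \int[leb n]_x dF x = 0.
Proof.
move=> mF DF FC dFC; have iF := integrable_wt_dom mF FC.
have C0 : 0 <= C.
  by rewrite -(pmulr_lge0 C (wt_gt0 (0 : 'rV[R]_n))); apply: le_trans (FC 0).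
apply: (@Rintegral_flow _ _ (leb n) (fun t x => x + t *: delta_mx ord0 j) F dF (fun x => C * (3 * wt x))).
- move=> t _; have := integrable_affine (t *: delta_mx ord0 j) ltr01 iF.
  by apply: eq_integrable => // x _ /=; rewrite scale1r addrC.
- move=> t _; rewrite (Rintegral_affine (t *: delta_mx ord0 j) ltr01 iF) expr1n mul1r.
  by apply: eq_Rintegral => x _; rewrite scale1r addrC.
- by move=> y; rewrite scale0r addr0.
- move=> t y _; exact: is_derive_line.
- exact: (integrableZl measurableT C (integrableZl measurableT 3 (integrable_wt n))).
- move=> t y t1; apply: le_trans (dFC _) _; apply: ler_wpM2l => //.
  by apply: wt_shift; exact: ltW.
Qed.

End weights.

(** * Directional derivatives and continuity of real functions *)

Section calculus.
Context {R : realType} {V : normedModType R}.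
Implicit Types (f g : V -> R) (x v : V).

(** Reduces directional derivatives to derivatives on the line, where the chain
    rule is available. *)
Lemma is_deriveP f x v df :
  is_derive x v f df <-> is_derive (0 : R) (1 : R) (fun t : R => f (x + t *: v)) df.
Proof.
have E : (fun h : R => h^-1 *: ((f \o shift x) (h *: v) - f x)) =
   (fun h => h^-1 *: (((fun t => f (x + t *: v)) \o shift 0) (h *: 1) - f (x + 0 *: v))).
  apply/funext => h /=; rewrite scale0r !addr0; congr (_ *: (f _ - _)).
  by rewrite /GRing.scale/= mulr1 addrC.
split=> -[Df <-].
  by split; [move: Df; rewrite /derivable E|rewrite /derive E].
by split; [move: Df; rewrite /derivable E|rewrite /derive E].
Qed.

Lemma is_derive_c x v (c : R) : is_derive x v (fun=> c) 0.
Proof. exact: is_derive_cst. Qed.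

Lemma is_derive_add f g x v df dg : is_derive x v f df -> is_derive x v g dg ->
  is_derive x v (fun y => f y + g y) (df + dg).
Proof. exact: is_deriveD. Qed.

Lemma is_derive_opp f x v df : is_derive x v f df ->
  is_derive x v (fun y => - f y) (- df).
Proof. exact: is_deriveN. Qed.

Lemma is_derive_sub f g x v df dg : is_derive x v f df -> is_derive x v g dg ->
  is_derive x v (fun y => f y - g y) (df - dg).
Proof. exact: is_deriveB. Qed.

Lemma is_derive_mul f g x v df dg : is_derive x v f df -> is_derive x v g dg ->
  is_derive x v (fun y => f y * g y) (f x * dg + g x * df).
Proof. exact: is_deriveM. Qed.

Lemma is_derive_scale (c : R) f x v df : is_derive x v f df ->
  is_derive x v (fun y => c * f y) (c * df).
Proof. exact: is_deriveZ. Qed.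

Lemma is_derive_bigsum (I : Type) (s : seq I) (P : pred I) (F : I -> V -> R) (dF : I -> R) x v :
  (forall i, P i -> is_derive x v (F i) (dF i)) ->
  is_derive x v (fun y => \sum_(i <- s | P i) F i y) (\sum_(i <- s | P i) dF i).
Proof.
move=> DF; elim: s => [|i s IH].
  rewrite big_nil (_ : (fun _ => _) = cst 0); first exact: is_derive_cst.
  by apply/funext => y; rewrite big_nil.
rewrite big_cons (_ : (fun _ => _) = (fun y => if P i then F i y + \sum_(j <- s | P j) F j y else \sum_(j <- s | P j) F j y)); last first.
  by apply/funext => y; rewrite big_cons.
by case: ifP => Pi //; apply: is_derive_add => //; exact: DF.
Qed.

Lemma is_derive_chain (g : R -> R) f x v dg df :
  is_derive (f x) (1 : R) g dg -> is_derive x v f df ->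
  is_derive x v (fun y => g (f y)) (dg * df).
Proof.
move=> Dg /is_deriveP Df; apply/is_deriveP.
apply: (@is_derive1_comp R g (fun t => f (x + t *: v)) 0 dg df) => //.
by rewrite scale0r addr0.
Qed.

Lemma is_derive_exp f x v df : is_derive x v f df ->
  is_derive x v (fun y => expR (f y)) (expR (f x) * df).
Proof. by apply: is_derive_chain; exact: is_derive_expR. Qed.

Lemma is_derive_sine f x v df : is_derive x v f df ->
  is_derive x v (fun y => sin (f y)) (cos (f x) * df).
Proof. by apply: is_derive_chain; exact: is_derive_sin. Qed.

Lemma is_derive_cosine f x v df : is_derive x v f df ->
  is_derive x v (fun y => cos (f y)) (- sin (f x) * df).
Proof. by apply: is_derive_chain; exact: is_derive_cos. Qed.

Lemma is_derive_pow n f x v df : is_derive x v f df ->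
  is_derive x v (fun y => f y ^+ n) (n%:R * f x ^+ n.-1 * df).
Proof.
apply: (@is_derive_chain (fun t => t ^+ n)).
have := @is_deriveX R R id n (f x) 1 1 (is_derive_id _ _).
rewrite /GRing.scale/= mulr1 (_ : id ^+ n = (fun t => t ^+ n))//.
by apply/funext => t; rewrite exprfctE.
Qed.

Lemma is_derive_inv f x v df : f x != 0 -> is_derive x v f df ->
  is_derive x v (fun y => (f y)^-1) (- (f x) ^- 2 * df).
Proof.
move=> f0; apply: (@is_derive_chain (fun t => t^-1)).
have := @is_deriveV R id (f x) 1 1 f0 (is_derive_id _ _).
by rewrite /GRing.scale/= mulr1.
Qed.

Lemma is_derive_val f x v df df' : df = df' -> is_derive x v f df -> is_derive x v f df'.
Proof. by move=> ->. Qed.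

Lemma is_derive_ext f g x v df : f =1 g -> is_derive x v f df -> is_derive x v g df.
Proof. by move=> /funext ->. Qed.

End calculus.

Section continuity.
Context {R : realType} {T : topologicalType}.
Implicit Types (f g : T -> R).

Lemma continuous_c (c : R) : continuous (fun _ : T => c).
Proof. by move=> x; exact: cvg_cst. Qed.

Lemma continuous_add f g : continuous f -> continuous g -> continuous (fun x => f x + g x).
Proof. by move=> cf cg x; apply: cvgD; [exact: cf|exact: cg]. Qed.

Lemma continuous_opp f : continuous f -> continuous (fun x => - f x).
Proof. by move=> cf x; apply: cvgN; exact: cf. Qed.

Lemma continuous_mul f g : continuous f -> continuous g -> continuous (fun x => f x * g x).
Proof. by move=> cf cg x; apply: cvgM; [exact: cf|exact: cg]. Qed.

Lemma continuous_chain (g : R -> R) f : continuous g -> continuous f -> continuous (fun x => g (f x)).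
Proof. by move=> cg cf x; apply: continuous_comp; [exact: cf|exact: cg]. Qed.

Lemma continuous_exp f : continuous f -> continuous (fun x => expR (f x)).
Proof. by apply: continuous_chain; exact: continuous_expR. Qed.

Lemma continuous_pow n f : continuous f -> continuous (fun x => f x ^+ n).
Proof. by apply: (@continuous_chain (fun t => t ^+ n)); exact: exprn_continuous. Qed.

Lemma continuous_inv f : (forall x, f x != 0) -> continuous f -> continuous (fun x => (f x)^-1).
Proof. by move=> f0 cf x; apply: cvgV => //; exact: cf. Qed.

Lemma continuous_sum (I : Type) (s : seq I) (F : I -> T -> R) :
  (forall i, continuous (F i)) -> continuous (fun x => \sum_(i <- s) F i x).
Proof.
move=> cF; elim: s => [|i s IH].
  by rewrite (_ : (fun _ => _) = fun=> 0); [exact: continuous_c|apply/funext => x; rewrite big_nil].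
rewrite (_ : (fun _ => _) = (fun x => F i x + \sum_(j <- s) F j x)); first exact: continuous_add.
by apply/funext => x; rewrite big_cons.
Qed.

End continuity.

(** * The Fourier transform of Gaussians on the line *)

Section gaussian.
Context {R : realType}.
Notation leb := (lebesgue_rV R).
Notation mu := (@lebesgue_measure R).

(** Half of the exponent absorbs one factor 1 + s at each step. *)
Lemma expR_poly_bound (N : nat) (a : R) : 0 < a ->
  exists C, forall s, 0 <= s -> expR (- (a * s)) * (1 + s) ^+ N <= C.
Proof.
elim: N a => [|N IH] a a0.
  by exists 1 => s s0; rewrite expr0 mulr1 -expR0 ler_expR oppr_le0 mulr_ge0// ltW.
have a20 : 0 < a / 2 by rewrite divr_gt0.
have [C CH] := IH _ a20; exists (C * (1 + 2 / a)) => s s0.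
have -> : expR (- (a * s)) * (1 + s) ^+ N.+1 =
  (expR (- (a / 2 * s)) * (1 + s) ^+ N) * (expR (- (a / 2 * s)) * (1 + s)).
  rewrite [- (a * s)](_ : _ = - (a / 2 * s) + - (a / 2 * s)); last by field.
  by rewrite expRD exprSr; ring.
have s1 : 0 <= 1 + s by rewrite addr_ge0.
apply: ler_pM => //.
- by rewrite mulr_ge0 ?expR_ge0 ?exprn_ge0.
- by rewrite mulr_ge0 ?expR_ge0.
- exact: CH.
- rewrite expRN mulrC ler_pdivrMr ?expR_gt0//.
  apply: (@le_trans _ _ ((1 + 2 / a) * (1 + a / 2 * s))).
    have -> : (1 + 2 / a) * (1 + a / 2 * s) = 1 + s + (2 / a + a / 2 * s).
      by field; rewrite gt_eqF.
    by rewrite lerDl addr_ge0// ?divr_ge0 ?mulr_ge0 ?(ltW a0)// ltW.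
  apply: ler_wpM2l; last exact: expR_ge1Dx.
  by rewrite addr_ge0// divr_ge0// ltW.
Qed.

Definition gauss1 (a x : R) : R := expR (- (a * x ^+ 2)).

Lemma gauss1_ge0 a x : 0 <= gauss1 a x. Proof. exact: expR_ge0. Qed.

Lemma gauss1_bound (a : R) : 0 < a -> exists C,
  0 <= C /\ forall x, (1 + `|x|) * gauss1 a x <= C * (oneDsqr x)^-1.
Proof.
move=> a0; have [C CH] := expR_poly_bound 2 a0; exists (2 * C); split.
  rewrite mulr_ge0//; apply: le_trans (CH 0 (lexx _)).
  by rewrite mulr_ge0 ?expR_ge0// addr0 expr1n.
move=> x; rewrite ler_pdivlMr ?oneDsqr_gt0//.
have := CH (x ^+ 2) (sqr_ge0 _); rewrite -/(gauss1 a x) -/(oneDsqr x) => CHx.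
apply: (@le_trans _ _ (2 * (gauss1 a x * oneDsqr x ^+ 2))); last by rewrite ler_wpM2l.
rewrite expr2 [(1 + _) * _]mulrC -!mulrA [2 * _]mulrCA; apply: ler_wpM2l; first exact: gauss1_ge0.
rewrite mulrA; apply: ler_wpM2r; first exact: oneDsqr_ge0.
rewrite /oneDsqr -(real_normK (num_real x)); have := sqr_ge0 (`|x| - 1); have := sqr_ge0 (`|x|); lra.
Qed.

Lemma continuous_gauss1 a : continuous (gauss1 a).
Proof.
apply: continuous_exp; apply: continuous_opp; apply: continuous_mul; first exact: continuous_c.
exact: exprn_continuous.
Qed.

Lemma measurable_gauss1 a : measurable_fun setT (gauss1 a).
Proof. exact: (continuous_measurable_fun (@continuous_gauss1 a)). Qed.

Lemma integrable_oneDsqr_dom (F : R -> R) C : measurable_fun setT F ->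
  (forall x, `|F x| <= C * (oneDsqr x)^-1) -> mu.-integrable setT (EFin \o F).
Proof.
move=> mF FC; apply: (le_integrable _ _ _ (integrableZl measurableT C integrable_oneDsqrV)) => //.
- exact/measurable_EFinP.
- by move=> x _ /=; rewrite lee_fin (le_trans (FC x))// ler_norm.
Qed.

Lemma integrable_gauss1 a : 0 < a -> mu.-integrable setT (EFin \o gauss1 a).
Proof.
move=> a0; have [C [C0 CH]] := gauss1_bound a0.
apply: (@integrable_oneDsqr_dom _ C); first exact: measurable_gauss1.
move=> x; rewrite ger0_norm ?gauss1_ge0//; apply: le_trans (CH x).
by rewrite ler_peMl ?gauss1_ge0// lerDl.
Qed.

Lemma Rintegral_gauss1 a : 0 < a -> \int[mu]_x gauss1 a x = Num.sqrt (pi / a).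
Proof.
move=> a0; have s0 : 0 < Num.sqrt a by rewrite sqrtr_gt0.
have E1 : \int[mu]_x (@gauss_fun R x) = Num.sqrt pi.
  by rewrite /Rintegral integralT_gauss.
have := Rintegral_affine1 0 s0 (@integrableT_gauss R).
rewrite E1 sqrtrM ?pi_ge0// sqrtrV ?(ltW a0)// => ->.
rewrite mulrAC divff ?gt_eqF// mul1r; apply: eq_Rintegral => x _.
by rewrite /gauss_fun /gauss1 add0r exprMn sqr_sqrtr// ltW.
Qed.

Lemma is_derive_gauss1 (a x : R) : is_derive x (1 : R) (gauss1 a) (- (2 * a * x) * gauss1 a x).
Proof.
have := is_derive_exp (is_derive_opp (is_derive_scale a (is_derive_pow 2 (is_derive_id x (1 : R))))).
by apply: is_derive_val; rewrite /gauss1/= expr1; ring.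
Qed.

Lemma norm_mul_le (c g : R) : `|c| <= 1 -> `|c * g| <= `|g|.
Proof. by move=> c1; rewrite normrM ler_piMl. Qed.

Lemma cos_norm_le1 (t : R) : `|cos t| <= 1.
Proof. by rewrite ler_norml cos_geN1 cos_le1. Qed.

Lemma sin_norm_le1 (t : R) : `|sin t| <= 1.
Proof. by rewrite ler_norml sin_geN1 sin_le1. Qed.

Lemma measurable_trig (g : R -> R) (x dl : R) (f : R -> R) : continuous g -> measurable_fun setT f ->
  measurable_fun setT (fun t => g (x * t + dl) * f t).
Proof.
move=> cg mf; apply: measurable_funM => //; apply: continuous_measurable_fun.
apply: continuous_chain => //; apply: continuous_add; last exact: continuous_c.
by apply: continuous_mul; [exact: continuous_c|move=> z; exact: cvg_id].
Qed.

Lemma is_derive_aff (x dl t : R) : is_derive t (1 : R) (fun t : R => x * t + dl) x.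
Proof.
have := is_derive_add (is_derive_scale x (is_derive_id t (1 : R))) (is_derive_c t (1 : R) dl).
by apply: is_derive_val; rewrite mulr1 addr0.
Qed.

(** Translation invariance applied to the derivative of
    sin(x t + dl) e^(-a t^2). *)
Lemma integral_cos_gauss1_ode a (dl x : R) : 0 < a ->
  x * (\int[mu]_t (cos (x * t + dl) * gauss1 a t)) =
  2 * a * (\int[mu]_t (sin (x * t + dl) * (t * gauss1 a t))).
Proof.
move=> a0; have [C [C0 CH]] := gauss1_bound a0.
have gb t : `|gauss1 a t| <= C * (oneDsqr t)^-1.
  by rewrite ger0_norm ?gauss1_ge0//; apply: le_trans (CH t); rewrite ler_peMl ?gauss1_ge0// lerDl.
have tgb t : `|t * gauss1 a t| <= C * (oneDsqr t)^-1.
  rewrite normrM (ger0_norm (gauss1_ge0 _ _)); apply: le_trans (CH t).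
  by rewrite ler_wpM2r ?gauss1_ge0// lerDr.
have mtg : measurable_fun setT (fun t : R => t * gauss1 a t).
  by apply: measurable_funM => //; exact: measurable_gauss1.
have i1 : mu.-integrable setT (EFin \o (fun t => cos (x * t + dl) * gauss1 a t)).
  apply: (@integrable_oneDsqr_dom _ C); first by apply: measurable_trig; [exact: continuous_cos|exact: measurable_gauss1].
  by move=> t; apply: le_trans (gb t); exact: norm_mul_le (cos_norm_le1 _).
have i2 : mu.-integrable setT (EFin \o (fun t => sin (x * t + dl) * (t * gauss1 a t))).
  apply: (@integrable_oneDsqr_dom _ C); first by apply: measurable_trig; [exact: continuous_sin|exact: mtg].
  by move=> t; apply: le_trans (tgb t); exact: norm_mul_le (sin_norm_le1 _).
have i3 : mu.-integrable setT (EFin \o (fun t => sin (x * t + dl) * gauss1 a t)).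
  apply: (@integrable_oneDsqr_dom _ C); first by apply: measurable_trig; [exact: continuous_sin|exact: measurable_gauss1].
  by move=> t; apply: le_trans (gb t); exact: norm_mul_le (sin_norm_le1 _).
apply/eqP; rewrite -subr_eq0 -!RintegralZl// -RintegralB//; last 2 first.
- exact: (integrableZl measurableT x i1).
- exact: (integrableZl measurableT (2 * a) i2).
pose C' := `|x| * C + 2 * a * C.
apply/eqP; apply: (@Rintegral_flow _ _ _ mu (fun s t => t + s) (fun t => sin (x * t + dl) * gauss1 a t) _
  (fun t => C' * (3 * (oneDsqr t)^-1))).
- move=> t _; have := integrable_affine1 t ltr01 i3.
  by apply: eq_integrable => // s _ /=; rewrite mul1r (addrC t).
- move=> t _; rewrite (Rintegral_affine1 t ltr01 i3) mul1r.
  by apply: eq_Rintegral => s _; rewrite mul1r (addrC t).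
- by move=> t; rewrite addr0.
- move=> s t _.
  have D : is_derive (t + s) (1 : R) (fun t => sin (x * t + dl) * gauss1 a t)
     (x * (cos (x * (t + s) + dl) * gauss1 a (t + s)) - 2 * a * (sin (x * (t + s) + dl) * ((t + s) * gauss1 a (t + s)))).
    have := is_derive_mul (is_derive_sine (is_derive_aff x dl (t + s))) (is_derive_gauss1 a (t + s)).
    by apply: is_derive_val; ring.
  have /= := is_derive_line (V := R) (p := t) (e := 1) (t := s) (f := fun t => sin (x * t + dl) * gauss1 a t).
  rewrite /GRing.scale/= mulr1 => /(_ _ D).
  by apply: is_derive_ext => u; rewrite mulr1.
- exact: (integrableZl measurableT C' (integrableZl measurableT 3 integrable_oneDsqrV)).
- move=> s t s1; set u := t + s.
  apply: (@le_trans _ _ (C' * (oneDsqr u)^-1)); last first.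
    apply: ler_wpM2l; last exact: oneDsqrV_shift (ltW s1).
    by rewrite addr_ge0// !mulr_ge0// ltW.
  apply: le_trans (ler_normB _ _) _; rewrite !normrM /C' mulrDl -!mulrA; apply: lerD.
    apply: ler_wpM2l => //; apply: le_trans (gb u).
    by rewrite -normrM; exact: norm_mul_le (cos_norm_le1 _).
  rewrite (ger0_norm (ler0n _ 2)) (ger0_norm (ltW a0)) ler_wpM2l// ler_wpM2l ?(ltW a0)//.
  by apply: le_trans (tgb u); rewrite -!normrM; exact: norm_mul_le (sin_norm_le1 _).
Qed.

(** As a function of x the integral satisfies F' = - x/(2a) F, so that
    F(x) e^(x^2/(4a)) is constant. The phase dl covers sine and cosine, and
    becomes the sum of the other coordinates in the induction on dimension. *)
Lemma integral_cos_gauss1 a (dl x : R) : 0 < a ->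
  \int[mu]_t (cos (x * t + dl) * gauss1 a t) =
  cos dl * (Num.sqrt (pi / a) * expR (- (x ^+ 2 / (4 * a)))).
Proof.
move=> a0; have [C [C0 CH]] := gauss1_bound a0.
pose F x := \int[mu]_t (cos (x * t + dl) * gauss1 a t).
have DF y : is_derive y (1 : R) F (- (y / (2 * a)) * F y).
  have : is_derive y (1 : R) F (\int[mu]_t (- sin (y * t + dl) * (t * gauss1 a t))).
    apply: (@is_derive_Rintegral _ _ _ mu setT _ (fun y t => - sin (y * t + dl) * (t * gauss1 a t)) y 1 (fun t => C * (oneDsqr t)^-1)) => //.
    - move=> z _; apply: (@integrable_oneDsqr_dom _ C); first by apply: measurable_trig; [exact: continuous_cos|exact: measurable_gauss1].
      move=> t; apply: (@le_trans _ _ `|gauss1 a t|); first exact: norm_mul_le (cos_norm_le1 _).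
      by rewrite ger0_norm ?gauss1_ge0//; apply: le_trans (CH t); rewrite ler_peMl ?gauss1_ge0// lerDl.
    - move=> z t _ _.
      have Dz : is_derive z (1 : R) (fun z : R => z * t + dl) t.
        by have := is_derive_aff t dl z; apply: is_derive_ext => s; rewrite mulrC.
      have := is_derive_mul (is_derive_cosine Dz) (is_derive_c z (1 : R) (gauss1 a t)).
      by apply: is_derive_val; ring.
    - exact: (integrableZl measurableT C integrable_oneDsqrV).
    - move=> z t _ _; apply: (@le_trans _ _ `|t * gauss1 a t|).
        by apply: norm_mul_le; rewrite normrN sin_norm_le1.
      rewrite normrM (ger0_norm (gauss1_ge0 _ _)); apply: le_trans (CH t).
      by rewrite ler_wpM2r ?gauss1_ge0// lerDr.
  apply: is_derive_val; rewrite /F.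
  have E := integral_cos_gauss1_ode dl y a0.
  have i2 : mu.-integrable setT (EFin \o (fun t => sin (y * t + dl) * (t * gauss1 a t))).
    apply: (@integrable_oneDsqr_dom _ C).
      by apply: measurable_trig; [exact: continuous_sin|apply: measurable_funM => //; exact: measurable_gauss1].
    move=> t; apply: (@le_trans _ _ `|t * gauss1 a t|); first exact: norm_mul_le (sin_norm_le1 _).
    rewrite normrM (ger0_norm (gauss1_ge0 _ _)); apply: le_trans (CH t).
    by rewrite ler_wpM2r ?gauss1_ge0// lerDr.
  under eq_Rintegral do rewrite mulNr -mulN1r.
  rewrite RintegralZl// mulN1r mulNr; congr (- _).
  by rewrite mulrAC E mulrAC divff ?mul1r// gt_eqF// mulr_gt0.
(* The integrating factor of F' = - x/(2a) F. *)
pose H y := F y * expR (y ^+ 2 / (4 * a)).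
have DH y : is_derive y (1 : R) H 0.
  have De : is_derive y (1 : R) (fun y : R => expR (y ^+ 2 / (4 * a))) (expR (y ^+ 2 / (4 * a)) * (y / (2 * a))).
    have := is_derive_exp (is_derive_mul (is_derive_pow 2 (is_derive_id y (1 : R))) (is_derive_c y (1 : R) (4 * a)^-1)).
    by apply: is_derive_val; rewrite /= expr1; field; rewrite gt_eqF.
  by have := is_derive_mul (DF y) De; apply: is_derive_val; ring.
have := is_derive_0_is_cst x 0 DH; rewrite /H expr0n/= mul0r expR0 mulr1.
have -> : F 0 = cos dl * Num.sqrt (pi / a).
  rewrite -Rintegral_gauss1// -RintegralZl//; last exact: integrable_gauss1.
  by rewrite /F; apply: eq_Rintegral => t _; rewrite mul0r add0r.
by move=> E; rewrite mulrA -E expRN mulfK// gt_eqF// expR_gt0.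
Qed.

End gaussian.

(** * Gaussians on R^n *)

Section rV_functions.
Context {R : realType}.
Notation leb := (lebesgue_rV R).
Notation mu := (@lebesgue_measure R).

Lemma sqnormE n (v : 'rV[R]_n) : sqnorm v = \sum_j v ord0 j ^+ 2.
Proof. by apply: eq_bigr => j _; rewrite expr2. Qed.

Lemma sqnorm_ge0 n (v : 'rV[R]_n) : 0 <= sqnorm v.
Proof. by rewrite sqnormE; apply: sumr_ge0 => j _; exact: sqr_ge0. Qed.

Lemma dotC n (v w : 'rV[R]_n) : dot v w = dot w v.
Proof. by apply: eq_bigr => j _; rewrite mulrC. Qed.

Lemma dotDl n (u v w : 'rV[R]_n) : dot (u + v) w = dot u w + dot v w.
Proof. by rewrite -big_split; apply: eq_bigr => j _; rewrite mxE mulrDl. Qed.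

Lemma dotZl n c (v w : 'rV[R]_n) : dot (c *: v) w = c * dot v w.
Proof. by rewrite /dot mulr_sumr; apply: eq_bigr => j _; rewrite mxE mulrA. Qed.

Lemma dotNl n (v w : 'rV[R]_n) : dot (- v) w = - dot v w.
Proof. by rewrite -scaleN1r dotZl mulN1r. Qed.

Lemma dotDr n (u v w : 'rV[R]_n) : dot u (v + w) = dot u v + dot u w.
Proof. by rewrite dotC dotDl !(dotC _ u). Qed.

Lemma dotZr n c (v w : 'rV[R]_n) : dot v (c *: w) = c * dot v w.
Proof. by rewrite dotC dotZl dotC. Qed.

Lemma dotNr n (v w : 'rV[R]_n) : dot v (- w) = - dot v w.
Proof. by rewrite dotC dotNl dotC. Qed.

Lemma dot_rV_cons n (x : 'rV[R]_n.+1) t (y : 'rV[R]_n) :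
  dot x (rV_cons (t, y)) = x ord0 ord0 * t + dot (\row_j x ord0 (lift ord0 j)) y.
Proof.
rewrite /dot big_ord_recl rV_consE0; congr (_ + _).
by apply: eq_bigr => j _; rewrite rV_consES mxE.
Qed.

Lemma sqnorm_recl n (x : 'rV[R]_n.+1) :
  sqnorm x = x ord0 ord0 ^+ 2 + sqnorm (\row_j x ord0 (lift ord0 j)).
Proof. by rewrite !sqnormE big_ord_recl; congr (_ + _); apply: eq_bigr => j _; rewrite mxE. Qed.

Lemma sqnorm_rV_cons n t (y : 'rV[R]_n) : sqnorm (rV_cons (t, y)) = t ^+ 2 + sqnorm y.
Proof.
rewrite sqnorm_recl rV_consE0; congr (_ + sqnorm _).
by apply/rowP => j; rewrite mxE rV_consES.
Qed.

Lemma coor_sq_le n (v : 'rV[R]_n) j : v ord0 j ^+ 2 <= sqnorm v.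
Proof.
rewrite sqnormE (bigD1 j)//= lerDl; apply: sumr_ge0 => k _; exact: sqr_ge0.
Qed.

Lemma coor_le n (v : 'rV[R]_n) j : `|v ord0 j| <= 1 + sqnorm v.
Proof.
have := coor_sq_le v j; rewrite -(real_normK (num_real _)) => H.
by have := sqr_ge0 (`|v ord0 j| - 1); nra.
Qed.

(** Each of the n factors 1 + v_j^2 of 1/wt is at most 1 + |v|^2. *)
Lemma wt_ge n (v : 'rV[R]_n) : 1 <= wt v * (1 + sqnorm v) ^+ n.
Proof.
rewrite -[X in _ ^+ X](card_ord n) -prodr_const -big_split/=.
apply: (@le_trans _ _ (\prod_(j < n) 1)); first by rewrite big1.
apply: ler_prod => j _; rewrite ler01/= mulrC ler_pdivlMr ?oneDsqr_gt0// mul1r.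
by rewrite /oneDsqr lerD2l coor_sq_le.
Qed.

Lemma continuous_coor n (j : 'I_n) : continuous (fun v : 'rV[R]_n => v ord0 j).
Proof. exact: coord_continuous. Qed.

Lemma continuous_dot (T : topologicalType) n (f g : T -> 'rV[R]_n) :
  (forall j, continuous (fun t => f t ord0 j)) ->
  (forall j, continuous (fun t => g t ord0 j)) -> continuous (fun t => dot (f t) (g t)).
Proof. by move=> cf cg; apply: continuous_sum => j; exact: continuous_mul. Qed.

Lemma measurable_dot d (T : measurableType d) n (f g : T -> 'rV[R]_n) :
  measurable_fun setT f -> measurable_fun setT g ->
  measurable_fun setT (fun t => dot (f t) (g t)).
Proof.
move=> /measurable_fun_rVP mf /measurable_fun_rVP mg.
by apply: measurable_sum => j; apply: measurable_funM.
Qed.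

Lemma measurable_rVD d (T : measurableType d) n (f g : T -> 'rV[R]_n) :
  measurable_fun setT f -> measurable_fun setT g ->
  measurable_fun setT (fun t => f t + g t).
Proof.
move=> /measurable_fun_rVP mf /measurable_fun_rVP mg; apply/measurable_fun_rVP => i.
rewrite (_ : (fun _ => _) = (fun t => f t ord0 i + g t ord0 i)); first exact: measurable_funD.
by apply/funext => t; rewrite mxE.
Qed.

Lemma measurable_rVZ d (T : measurableType d) n (c : T -> R) (f : T -> 'rV[R]_n) :
  measurable_fun setT c -> measurable_fun setT f ->
  measurable_fun setT (fun t => c t *: f t).
Proof.
move=> mc /measurable_fun_rVP mf; apply/measurable_fun_rVP => i.
rewrite (_ : (fun _ => _) = (fun t => c t * f t ord0 i)); first exact: measurable_funM.
by apply/funext => t; rewrite mxE.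
Qed.

Lemma measurable_rVN d (T : measurableType d) n (f : T -> 'rV[R]_n) :
  measurable_fun setT f -> measurable_fun setT (fun t => - f t).
Proof.
move=> mf; rewrite (_ : (fun _ => _) = (fun t => (-1 : R) *: f t)); first exact: measurable_rVZ.
by apply/funext => t; rewrite scaleN1r.
Qed.

Lemma measurable_expo d (T : measurableType d) (f : T -> R) :
  measurable_fun setT f -> measurable_fun setT (fun t => expR (f t)).
Proof. by move=> mf; apply: measurableT_comp. Qed.

Lemma measurable_cosine d (T : measurableType d) (f : T -> R) :
  measurable_fun setT f -> measurable_fun setT (fun t => cos (f t)).
Proof.
by move=> mf; apply: (measurableT_comp (f := @cos R)) => //; apply: continuous_measurable_fun; exact: continuous_cos.
Qed.

End rV_functions.

Ltac meas_step := first [exact: measurable_cst | exact: measurable_fst | exact: measurable_snd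
  | exact: measurable_id | apply: measurable_expo | apply: measurable_cosine
  | apply: measurable_rVN | apply: measurable_rVD | apply: measurable_rVZ | apply: measurable_dot
  | apply: measurable_funN | apply: measurable_funD | apply: measurable_funM].
Ltac meas := repeat meas_step.

Section rV_gaussian.
Context {R : realType}.
Notation leb := (lebesgue_rV R).
Notation mu := (@lebesgue_measure R).

Definition gauss n (a : R) (x : 'rV[R]_n) : R := expR (- (a * sqnorm x)).

Lemma gauss_ge0 n a (x : 'rV[R]_n) : 0 <= gauss a x. Proof. exact: expR_ge0. Qed.

Lemma gauss_prod n a (x : 'rV[R]_n) : gauss a x = \prod_j gauss1 a (x ord0 j).
Proof.
by rewrite /gauss sqnormE mulr_sumr -sumrN expR_sum.
Qed.

Lemma integrable_gauss n a : 0 < a -> (leb n).-integrable setT (EFin \o @gauss n a).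
Proof.
move=> a0; rewrite (_ : EFin \o _ = (fun x : 'rV[R]_n => (\prod_j gauss1 a (x ord0 j))%:E)).
  by apply: (@integrable_rV_prod _ _ (fun=> gauss1 a)) => j; exact: integrable_gauss1.
by apply/funext => x /=; rewrite gauss_prod.
Qed.

Lemma measurable_gauss n a : measurable_fun [set: 'rV[R]_n] (gauss a).
Proof.
apply: measurable_expo; under eq_fun do rewrite -mulNr.
by apply: measurable_funM => //; apply: measurable_dot.
Qed.

Lemma gauss_le1 n a (x : 'rV[R]_n) : 0 <= a -> gauss a x <= 1.
Proof. by move=> a0; rewrite -expR0 ler_expR oppr_le0 mulr_ge0// sqnorm_ge0. Qed.

(** Integrates one coordinate at a time, the remaining ones acting as a phase. *)
Lemma integral_cos_gauss n a (dl : R) (x : 'rV[R]_n) : 0 < a ->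
  \int[leb n]_e (cos (dot x e + dl) * gauss a e) =
  cos dl * (Num.sqrt (pi / a) ^+ n * expR (- (sqnorm x / (4 * a)))).
Proof.
move=> a0; elim: n dl x => [|n IH] dl x.
  rewrite Rintegral_rV0 /gauss /sqnorm /dot !big_ord0 add0r mulr0 oppr0 expR0.
  by rewrite mul0r oppr0 expR0 expr0 !mulr1.
rewrite Rintegral_rVS; last first.
  apply: (le_integrable _ _ _ (integrable_gauss n.+1 a0)) => //.
    apply/measurable_EFinP; apply: measurable_funM; last exact: measurable_gauss.
    by apply: measurable_cosine; apply: measurable_funD => //; exact: measurable_dot.
  move=> e _ /=; rewrite lee_fin normrM (ger0_norm (gauss_ge0 _ _)) ler_piMl ?gauss_ge0//.
  exact: cos_norm_le1.
pose x' := \row_j x ord0 (lift ord0 j).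
transitivity (\int[mu]_t ((cos (x ord0 ord0 * t + dl) * gauss1 a t) * (Num.sqrt (pi / a) ^+ n * expR (- (sqnorm x' / (4 * a)))))).
  apply: eq_Rintegral => t _.
  transitivity (\int[leb n]_e (gauss1 a t * (cos (dot x' e + (x ord0 ord0 * t + dl)) * gauss a e))).
    apply: eq_Rintegral => e _; rewrite dot_rV_cons /gauss sqnorm_rV_cons mulrDr opprD expRD.
    by rewrite mulrCA; congr (_ * (cos _ * _)); rewrite /x' addrCA addrA.
  rewrite RintegralZl//; first by rewrite IH mulrCA mulrA.
  apply: (le_integrable _ _ _ (integrable_gauss n a0)) => //.
    apply/measurable_EFinP; apply: measurable_funM; last exact: measurable_gauss.
    by apply: measurable_cosine; apply: measurable_funD => //; exact: measurable_dot.
  move=> e _ /=; rewrite lee_fin normrM (ger0_norm (gauss_ge0 _ _)) ler_piMl ?gauss_ge0//.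
  exact: cos_norm_le1.
rewrite RintegralZr//; last first.
  have [C [C0 CH]] := gauss1_bound a0.
  apply: (@integrable_oneDsqr_dom _ _ C).
    by apply: measurable_trig; [exact: continuous_cos|exact: measurable_gauss1].
  move=> t; apply: (@le_trans _ _ `|gauss1 a t|); first exact: norm_mul_le (cos_norm_le1 _).
  by rewrite ger0_norm ?gauss1_ge0//; apply: le_trans (CH t); rewrite ler_peMl ?gauss1_ge0// lerDl.
have -> : - (sqnorm x / (4 * a)) = - (x ord0 ord0 ^+ 2 / (4 * a)) + - (sqnorm x' / (4 * a)).
  by rewrite sqnorm_recl mulrDl opprD.
rewrite integral_cos_gauss1// [_ ^+ n.+1]exprS expRD; ring.
Qed.

Lemma Rintegral_gauss n a : 0 < a -> \int[leb n]_x gauss a x = Num.sqrt (pi / a) ^+ n.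
Proof.
move=> a0; have := integral_cos_gauss 0 (0 : 'rV[R]_n) a0.
rewrite cos0 mul1r.
have -> : sqnorm (0 : 'rV[R]_n) = 0 by rewrite sqnormE big1// => j _; rewrite mxE expr0n.
rewrite mul0r oppr0 expR0 mulr1 => <-; apply: eq_Rintegral => x _.
have -> : dot 0 x = 0 by rewrite /dot big1// => j _; rewrite mxE mul0r.
by rewrite addr0 cos0 mul1r.
Qed.

End rV_gaussian.

(** * Slowly growing and rapidly decreasing families; oscillatory integrals *)

Section rapid.
Context {R : realType} (n : nat).
Notation leb := (lebesgue_rV R).
Notation mu := (@lebesgue_measure R).
Local Notation V := 'rV[R]_n.
Local Notation e_ j := (delta_mx ord0 j : 'rV[R]_n).

Section families.
Variable Y : Type.
Implicit Types F G : Y -> V -> R.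

(** Families indexed by a parameter, with bounds uniform in it. *)
Definition slow F := exists N C, forall y v, `|F y v| <= C * (1 + sqnorm v) ^+ N.
Definition rapid F := forall N, exists C, forall y v, (1 + sqnorm v) ^+ N * `|F y v| <= C.

(** Control of [k] derivatives. The derivatives are given by witnesses, which
    keeps closure under products a structural induction. *)
Fixpoint slowC k F : Prop := [/\ slow F, forall y, continuous (F y) &
  if k is k'.+1 then exists dF : 'I_n -> Y -> V -> R,
    (forall j y v, is_derive v (e_ j) (F y) (dF j y v)) /\ forall j, slowC k' (dF j)
  else True].

Fixpoint rapidC k F : Prop := [/\ rapid F, forall y, continuous (F y) &
  if k is k'.+1 then exists dF : 'I_n -> Y -> V -> R,
    (forall j y v, is_derive v (e_ j) (F y) (dF j y v)) /\ forall j, rapidC k' (dF j)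
  else True].

Lemma sq1_ge1 (v : V) : 1 <= 1 + sqnorm v. Proof. by rewrite lerDl sqnorm_ge0. Qed.
Lemma sq1_gt0 (v : V) : 0 < 1 + sqnorm v. Proof. exact: lt_le_trans ltr01 (sq1_ge1 v). Qed.
Lemma sq1_ge0 (v : V) : 0 <= 1 + sqnorm v. Proof. exact/ltW/sq1_gt0. Qed.
Lemma sq1X_ge0 (v : V) N : 0 <= (1 + sqnorm v) ^+ N. Proof. exact/exprn_ge0/sq1_ge0. Qed.
Lemma sq1X_gt0 (v : V) N : 0 < (1 + sqnorm v) ^+ N. Proof. exact/exprn_gt0/sq1_gt0. Qed.
Hint Resolve sq1_ge1 sq1_gt0 sq1_ge0 sq1X_ge0 sq1X_gt0 : core.

Lemma rapid0 k F : rapidC k F -> rapid F. Proof. by case: k => [|k] []. Qed.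
Lemma rapid_cont k F : rapidC k F -> forall y, continuous (F y). Proof. by case: k => [|k] []. Qed.

Lemma slowCW k F : slowC k.+1 F -> slowC k F.
Proof.
elim: k F => [|k IH] F; first by move=> [].
move=> [sF cF [dF [DF SF]]]; split => //; exists dF; split => // j; exact: IH.
Qed.

Lemma rapidCW k F : rapidC k.+1 F -> rapidC k F.
Proof.
elim: k F => [|k IH] F; first by move=> [].
move=> [sF cF [dF [DF SF]]]; split => //; exists dF; split => // j; exact: IH.
Qed.

Lemma slow_add F G : slow F -> slow G -> slow (fun y v => F y v + G y v).
Proof.
move=> [N [C FC]] [M [D GD]]; exists (N + M)%N, (`|C| + `|D|) => y v.
apply: le_trans (ler_normD _ _) _; rewrite mulrDl; apply: lerD.
  apply: le_trans (FC y v) _; apply: (@le_trans _ _ (`|C| * (1 + sqnorm v) ^+ N)).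
    by rewrite ler_wpM2r// ler_norm.
  by rewrite ler_wpM2l// ler_weXn2l// leq_addr.
apply: le_trans (GD y v) _; apply: (@le_trans _ _ (`|D| * (1 + sqnorm v) ^+ M)).
  by rewrite ler_wpM2r// ler_norm.
by rewrite ler_wpM2l// ler_weXn2l// leq_addl.
Qed.

Lemma slow_mul F G : slow F -> slow G -> slow (fun y v => F y v * G y v).
Proof.
move=> [N [C FC]] [M [D GD]]; exists (N + M)%N, (C * D) => y v.
by rewrite normrM exprD mulrACA; apply: ler_pM.
Qed.

Lemma rapid_add F G : rapid F -> rapid G -> rapid (fun y v => F y v + G y v).
Proof.
move=> rF rG N; have [C FC] := rF N; have [D GD] := rG N; exists (C + D) => y v.
apply: (@le_trans _ _ ((1 + sqnorm v) ^+ N * (`|F y v| + `|G y v|))).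
  by rewrite ler_wpM2l// ler_normD.
by rewrite mulrDr; apply: lerD.
Qed.

Lemma rapid_mul F G : slow F -> rapid G -> rapid (fun y v => F y v * G y v).
Proof.
move=> [M [C FC]] rG N; have [D GD] := rG (M + N)%N; exists (`|C| * D) => y v.
rewrite normrM mulrCA; apply: (@le_trans _ _ ((`|C| * (1 + sqnorm v) ^+ M) * ((1 + sqnorm v) ^+ N * `|G y v|))).
  apply: ler_wpM2r; first by rewrite mulr_ge0.
  by apply: le_trans (FC y v) _; rewrite ler_wpM2r// ler_norm.
by rewrite -mulrA ler_wpM2l// mulrA -exprD.
Qed.

Lemma slowC_add k F G : slowC k F -> slowC k G -> slowC k (fun y v => F y v + G y v).
Proof.
elim: k F G => [|k IH] F G [sF cF HF] [sG cG HG]; split.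
- exact: slow_add.
- by move=> y; exact: continuous_add.
- by [].
- exact: slow_add.
- by move=> y; exact: continuous_add.
- move: HF HG => [dF [DF SF]] [dG [DG SG]]; exists (fun j y v => dF j y v + dG j y v).
  by split=> [j y v|j]; [exact: is_derive_add|apply: IH; [exact: SF|exact: SG]].
Qed.

Lemma rapidC_add k F G : rapidC k F -> rapidC k G -> rapidC k (fun y v => F y v + G y v).
Proof.
elim: k F G => [|k IH] F G [sF cF HF] [sG cG HG]; split.
- exact: rapid_add.
- by move=> y; exact: continuous_add.
- by [].
- exact: rapid_add.
- by move=> y; exact: continuous_add.
- move: HF HG => [dF [DF SF]] [dG [DG SG]]; exists (fun j y v => dF j y v + dG j y v).
  by split=> [j y v|j]; [exact: is_derive_add|apply: IH; [exact: SF|exact: SG]].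
Qed.

Lemma slowC_mul k F G : slowC k F -> slowC k G -> slowC k (fun y v => F y v * G y v).
Proof.
elim: k F G => [|k IH] F G HF HG; have [sF cF HF'] := HF; have [sG cG HG'] := HG; split.
- exact: slow_mul.
- by move=> y; exact: continuous_mul.
- by [].
- exact: slow_mul.
- by move=> y; exact: continuous_mul.
- move: HF' HG' => [dF [DF SF]] [dG [DG SG]].
  exists (fun j y v => F y v * dG j y v + G y v * dF j y v).
  split=> [j y v|j]; first exact: is_derive_mul.
  by apply: slowC_add; apply: IH; [exact: slowCW|exact: SG|exact: slowCW|exact: SF].
Qed.

Lemma rapidC_mul k F G : slowC k F -> rapidC k G -> rapidC k (fun y v => F y v * G y v).
Proof.
elim: k F G => [|k IH] F G HF HG; have [sF cF HF'] := HF; have [sG cG HG'] := HG; split.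
- exact: rapid_mul.
- by move=> y; exact: continuous_mul.
- by [].
- exact: rapid_mul.
- by move=> y; exact: continuous_mul.
- move: HF' HG' => [dF [DF SF]] [dG [DG SG]].
  exists (fun j y v => F y v * dG j y v + dF j y v * G y v).
  split=> [j y v|j].
    by have := is_derive_mul (DF j y v) (DG j y v); apply: is_derive_val; rewrite [G y v * _]mulrC.
  by apply: rapidC_add; apply: IH; [exact: slowCW|exact: SG|exact: SF|exact: rapidCW].
Qed.

Lemma slowC_bounded_const k (c : Y -> R) C : (forall y, `|c y| <= C) -> slowC k (fun y _ => c y).
Proof.
move=> cC; have s0 : slow (fun y (_ : V) => c y) by exists 0%N, C => y v; rewrite expr0 mulr1.
elim: k c C cC s0 => [|k IH] c C cC s0; split=> //; try by move=> y; exact: continuous_c.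
exists (fun _ _ _ => 0); split=> [j y v|j]; first exact: is_derive_c.
apply: (IH (fun=> 0) 0) => [y|]; first by rewrite normr0.
by exists 0%N, 0 => y v; rewrite normr0 mul0r.
Qed.

Lemma slowC_cst k (c : R) : slowC k (fun _ _ => c).
Proof. by apply: (@slowC_bounded_const _ (fun=> c) `|c|). Qed.

Lemma rapidC_scale k (c : R) F : rapidC k F -> rapidC k (fun y v => c * F y v).
Proof. by apply: rapidC_mul; exact: slowC_cst. Qed.

Lemma is_derive_coor (v : V) (j l : 'I_n) : is_derive v (e_ j) (fun v : V => v ord0 l) ((l == j)%:R).
Proof.
apply/is_deriveP.
have := is_derive_add (is_derive_c (0 : R) (1 : R) (v ord0 l)) (is_derive_mul (is_derive_id (0 : R) (1 : R)) (is_derive_c (0 : R) (1 : R) ((l == j)%:R : R))).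
rewrite /= mul0r !add0r mulr1; apply: is_derive_ext => t.
by rewrite !mxE eqxx.
Qed.

Lemma slowC_coor k (l : 'I_n) : slowC k (fun _ (v : V) => v ord0 l).
Proof.
have s0 : slow (fun (_ : Y) (v : V) => v ord0 l).
  by exists 1%N, 1 => y v; rewrite expr1 mul1r; exact: coor_le.
case: k => [|k]; split=> //; try by move=> y; exact: continuous_coor.
exists (fun j _ _ => (l == j)%:R); split=> [j y v|j]; first exact: is_derive_coor.
exact: slowC_cst.
Qed.

End families.

Lemma rapidC_pull (Y Z : Type) (s : Z -> Y) k (F : Y -> V -> R) :
  rapidC k F -> rapidC k (fun z => F (s z)).
Proof.
elim: k F => [|k IH] F [rF cF HF]; split => //; try by move=> N; have [C CH] := rF N; exists C.
move: HF => [dF [DF SF]]; exists (fun j z => dF j (s z)); split=> [j y v|j]; first exact: DF.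
by apply: IH; exact: SF.
Qed.

Section decay.
Variables (Y : Type) (k0 : R).
Hypothesis k0_neq0 : k0 != 0.
Implicit Types F : Y -> V -> R.

Lemma rapid_wt F : rapid F -> exists C, 0 <= C /\ forall y v, `|F y v| <= C * wt v.
Proof.
move=> rF; have [C CH] := rF n; exists `|C|; split=> // y v.
have := wt_ge v => w1.
apply: (@le_trans _ _ ((wt v * (1 + sqnorm v) ^+ n) * `|F y v|)); first by rewrite ler_peMl.
rewrite -mulrA mulrC; apply: ler_wpM2r; first exact/ltW/wt_gt0.
exact: le_trans (CH y v) (ler_norm _).
Qed.

(** The phase k0 (eta . v) + dl stands for both parts of the complex
    exponential. *)
Definition osc F (dl : R) (eta : V) y := \int[leb n]_v (cos (k0 * dot eta v + dl) * F y v).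

Lemma is_derive_phase (eta v : V) dl j :
  is_derive v (e_ j) (fun v : V => k0 * dot eta v + dl) (k0 * eta ord0 j).
Proof.
have D : is_derive v (e_ j) (fun v : V => dot eta v) (\sum_l eta ord0 l * ((l == j)%:R)).
  by apply: is_derive_bigsum => l _; apply: is_derive_scale; exact: is_derive_coor.
have := is_derive_add (is_derive_scale k0 D) (is_derive_c v (e_ j) dl).
apply: is_derive_val; rewrite addr0 (bigD1 j)//= eqxx mulr1 big1 ?addr0// => l lj.
by rewrite (negPf lj) mulr0.
Qed.

Lemma integrable_osc (G : V -> R) C (g : R -> R) (eta : V) dl : continuous g -> (forall t, `|g t| <= 1) ->
  continuous G -> (forall v, `|G v| <= C * wt v) ->
  (leb n).-integrable setT (EFin \o (fun v => g (k0 * dot eta v + dl) * G v)).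
Proof.
move=> cg g1 cG GC; apply: (@integrable_wt_dom _ _ _ C).
  apply: measurable_funM; last exact: continuous_measurable_rV.
  apply: continuous_measurable_rV; apply: continuous_chain => //.
  apply: continuous_add; last exact: continuous_c.
  apply: continuous_mul; first exact: continuous_c.
  by apply: continuous_dot => j; [exact: continuous_c|exact: continuous_coor].
by move=> v; apply: le_trans (GC v); exact: norm_mul_le.
Qed.

(** Stated for a pair g, dg so that it can be used with sine, then cosine. *)
Lemma osc_ibp (j : 'I_n) F (dF : Y -> V -> R) (dl : R) (eta : V) (g dg : R -> R) :
  (forall y v, is_derive v (e_ j) (F y) (dF y v)) ->
  rapid F -> rapid dF -> (forall y, continuous (F y)) -> (forall y, continuous (dF y)) ->
  continuous g -> continuous dg -> (forall t, `|g t| <= 1) -> (forall t, `|dg t| <= 1) ->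
  (forall t : R, is_derive t (1 : R) g (dg t)) -> forall y,
  k0 * eta ord0 j * (\int[leb n]_v (dg (k0 * dot eta v + dl) * F y v)) =
  - (\int[leb n]_v (g (k0 * dot eta v + dl) * dF y v)).
Proof.
move=> DF rF rdF cF cdF cg cdg g1 dg1 Dg y.
have [C [C0 CH]] := rapid_wt rF; have [D [D0 DH]] := rapid_wt rdF.
have i1 := integrable_osc eta dl cdg dg1 (cF y) (CH y).
have i2 := integrable_osc eta dl cg g1 (cdF y) (DH y).
have i3 := integrable_osc eta dl cg g1 (cF y) (CH y).
apply/eqP; rewrite -addr_eq0 -RintegralZl// -RintegralD//; last first.
  exact: (integrableZl measurableT (k0 * eta ord0 j) i1).
apply/eqP; apply: (@Rintegral_partial _ _ j (fun v => g (k0 * dot eta v + dl) * F y v) _ (C + (`|k0 * eta ord0 j| * C + D))).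
- by apply/measurable_EFinP; exact: (measurable_int _ i3).
- move=> v; have := is_derive_mul (is_derive_chain (Dg _) (is_derive_phase eta v dl j)) (DF y v).
  by apply: is_derive_val; ring.
- move=> v; apply: le_trans (norm_mul_le _ (g1 _)) _; apply: le_trans (CH y v) _.
  by rewrite ler_wpM2r ?(ltW (wt_gt0 v))// lerDl addr_ge0// mulr_ge0.
- move=> v; apply: le_trans (ler_normD _ _) _.
  apply: (@le_trans _ _ ((`|k0 * eta ord0 j| * C + D) * wt v)); last first.
    by rewrite ler_wpM2r ?(ltW (wt_gt0 v))// lerDr.
  rewrite mulrDl; apply: lerD; last exact: le_trans (norm_mul_le _ (g1 _)) (DH y v).
  by rewrite normrM -mulrA ler_wpM2l//; exact: le_trans (norm_mul_le _ (dg1 _)) (CH y v).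
Qed.

(** Two integrations by parts in v_j produce the factor - (k0 eta_j)^2, hence
    1 + eta_j^2 after adding the original integral. *)
Lemma osc_decay1 (j : 'I_n) k F : rapidC k.+2 F ->
  exists2 G, rapidC k G & forall dl (eta : V) y, oneDsqr (eta ord0 j) * osc F dl eta y = osc G dl eta y.
Proof.
move=> HF; have [rF cF [dF [DF SF]]] := HF.
have [rF1 cF1 [ddF [DDF SSF]]] := SF j.
exists (fun y v => F y v + (- k0 ^- 2) * ddF j y v).
  by apply: rapidC_add; [apply/rapidCW/rapidCW|apply: rapidC_scale; exact: SSF].
move=> dl eta y.
have [rF2 cF2] : rapid (ddF j) /\ forall y, continuous (ddF j y).
  by split; [exact: rapid0 (SSF j)|exact: rapid_cont (SSF j)].
have [C [C0 CH]] := rapid_wt rF; have [D [D0 DH]] := rapid_wt rF2; have [D' [D0' DH']] := rapid_wt rF1.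
have i1 := integrable_osc eta dl (@continuous_cos R) (@cos_norm_le1 R) (cF y) (CH y).
have i2 := integrable_osc eta dl (@continuous_cos R) (@cos_norm_le1 R) (cF2 y) (DH y).
have E1 := @osc_ibp j F (dF j) dl eta (@sin R) (@cos R) (DF j) rF rF1 cF cF1 (@continuous_sin R) (@continuous_cos R)
  (@sin_norm_le1 R) (@cos_norm_le1 R) (@is_derive_sin R) y.
have cms : continuous (fun t : R => - sin t) by apply: continuous_opp; exact: continuous_sin.
have ms1 (t : R) : `|- sin t| <= 1 by rewrite normrN sin_norm_le1.
have E2 := @osc_ibp j (dF j) (ddF j) dl eta (@cos R) (fun t => - sin t) (DDF j) rF1 rF2 cF1 cF2 (@continuous_cos R) cms
  (@cos_norm_le1 R) ms1 (@is_derive_cos R) y.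
have i3 := integrable_osc eta dl (@continuous_sin R) (@sin_norm_le1 R) (cF1 y) (DH' y).
move: E2; under eq_Rintegral do rewrite mulNr -mulN1r.
rewrite RintegralZl//= mulN1r => E2.
have -> : osc (fun y v => F y v + (- k0 ^- 2) * ddF j y v) dl eta y =
   osc F dl eta y + (- k0 ^- 2) * osc (ddF j) dl eta y.
  rewrite /osc -RintegralZl// -RintegralD//.
    by apply: eq_Rintegral => v _; rewrite mulrDr; congr (_ + _); rewrite mulrCA.
  exact: (integrableZl measurableT (- k0 ^- 2) i2).
rewrite /osc; move: E1 E2.
set a := \int[_]_v _; set b := \int[_]_v _; set c := \int[_]_v _ => E1 E2.
have E3 : c = k0 * eta ord0 j * b by apply/eqP; rewrite -eqr_opp -E2 mulrN.
have E4 : b = - (k0 * eta ord0 j * a) by rewrite E1 opprK.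
by rewrite E3 E4 /oneDsqr; field.
Qed.

Lemma osc_bound0 F : rapid F -> (forall y, continuous (F y)) ->
  exists2 C, 0 <= C & forall dl (eta : V) y, `|osc F dl eta y| <= C.
Proof.
move=> rF cF; have [C [C0 CH]] := rapid_wt rF.
exists (C * \int[leb n]_v wt v).
  by rewrite mulr_ge0//; apply: Rintegral_ge0 => v _; exact/ltW/wt_gt0.
move=> dl eta y.
have i1 := integrable_osc eta dl (@continuous_cos R) (@cos_norm_le1 R) (cF y) (CH y).
apply: le_trans (le_normr_Rintegral measurableT i1) _.
rewrite -RintegralZl//; last exact: integrable_wt.
apply: le_Rintegral => //; first exact: integrable_norm.
  exact: (integrableZl measurableT C (integrable_wt n)).
by move=> v _; apply: le_trans (norm_mul_le _ (cos_norm_le1 _)) (CH y v).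
Qed.

Lemma osc_decay_seq (js : seq 'I_n) F : rapidC (2 * size js) F ->
  exists2 C, 0 <= C & forall dl (eta : V) y,
    (\prod_(j <- js) oneDsqr (eta ord0 j)) * `|osc F dl eta y| <= C.
Proof.
elim: js F => [|j js IH] F HF.
  have [C C0 CH] := osc_bound0 (rapid0 HF) (rapid_cont HF).
  by exists C => // dl eta y; rewrite big_nil mul1r.
have E2 : (2 * size (j :: js) = (2 * size js).+2)%N by rewrite /= mulnS.
rewrite E2 in HF; have [G HG GE] := osc_decay1 j HF; have [C C0 CH] := IH G HG.
exists C => // dl eta y; apply: le_trans (CH dl eta y); rewrite -GE normrM big_cons.
by rewrite (ger0_norm (oneDsqr_ge0 _)) mulrCA mulrA.
Qed.

(** Integrating by parts twice in every coordinate makes an oscillatory integral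
    integrable in the dual variable, uniformly in the parameter. *)
Lemma osc_decay F : rapidC (2 * n) F ->
  exists2 C, 0 <= C & forall dl (eta : V) y, `|osc F dl eta y| <= C * wt eta.
Proof.
move=> HF; have [|C C0 CH] := @osc_decay_seq (enum 'I_n) F; first by rewrite size_enum_ord.
exists C => // dl eta y; have := CH dl eta y.
rewrite big_enum /= => H; rewrite /wt prodfV ler_pdivlMr; first by rewrite mulrC.
by apply: prodr_gt0 => j _; exact: oneDsqr_gt0.
Qed.

End decay.

End rapid.

(** * The Weyl quantization of the symbol as an average of Mehler kernels *)

Lemma Rintegral0_eq d (T : measurableType d) (R : realType) (m : {measure set T -> \bar R})
  (f : T -> R) : (forall x, f x = 0) -> \int[m]_x f x = 0.
Proof. by move=> f0; rewrite /Rintegral integral0_eq// => x _; rewrite f0. Qed.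

Section weyl_evaluation.
Context {R : realType} (d : nat).
Notation leb := (lebesgue_rV R).
Notation mu := (@lebesgue_measure R).
Local Notation V := 'rV[R]_d.
Local Notation e_ j := (delta_mx ord0 j : 'rV[R]_d).
Variable (h : R).
Hypothesis h0 : 0 < h.

(** Integrals over ]0, 1] are written as integrals over the line against this
    indicator, so that Fubini applies to total functions. *)
Definition I01 : R -> R := \1_(`]0, 1]%classic : set R).

Lemma I01P y : I01 y = if 0 < y <= 1 then 1 else 0.
Proof. by rewrite /I01 indicE mem_setE in_itv /=; case: ifP. Qed.

Lemma measurable_I01 : measurable_fun [set: R] I01.
Proof. exact: measurable_indic. Qed.

Lemma integrable_I01 : mu.-integrable setT (EFin \o I01).
Proof.
have : mu.-integrable setT (EFin \o \1_(`]0, 1]%classic : set R)) by exact: integrable_indic_itv.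
by [].
Qed.

Lemma Rintegral_I01 (f : R -> R) : \int[mu]_(y in `]0, 1]) f y = \int[mu]_y (I01 y * f y).
Proof.
rewrite Rintegral_mkcond; apply: eq_Rintegral => y _.
by rewrite patchE /I01 indicE; case: ifPn => _; rewrite ?mul1r ?mul0r.
Qed.

(** The density of the average, including the factor 2; the exponent d - 2 is an
    integer, and [rhoE] separates the part that belongs to the kernel. *)
Definition rho (y : R) : R := 2 * (y + 1) ^ (d%:Z - 2).

Lemma rhoE y : 0 <= y -> rho y = 2 / (1 + y) ^+ 2 * (1 + y) ^+ d.
Proof.
move=> y0; have y1 : 1 + y != 0 by rewrite gt_eqF// ltr_pwDl.
rewrite /rho addrC expfzDr// -exprnP mulrCA mulrC.
by have -> : (1 + y) ^ (- 2) = ((1 + y) ^+ 2)^-1 by [].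
Qed.

Lemma rho_bound y : 0 <= y <= 1 -> `|rho y| <= 2 * 2 ^+ d.
Proof.
move=> /andP[y0 y1]; rewrite rhoE//.
have p1 : 0 < 1 + y by rewrite ltr_pwDl.
rewrite ger0_norm; last by rewrite mulr_ge0 ?divr_ge0 ?exprn_ge0// ltW.
apply: ler_pM.
- by rewrite divr_ge0 ?exprn_ge0// ltW.
- by rewrite exprn_ge0// ltW.
- by rewrite ler_pdivrMr ?exprn_gt0// ler_peMr// exprn_ege1// lerDl.
- by rewrite lerXn2r ?nnegrE ?(ltW p1)//; lra.
Qed.

(** The symbol, as a real function. *)
Definition msym (z : V * V) : R :=
  2 * \int[mu]_(y in `[0, 1]) ((y + 1) ^ (d%:Z - 2) * expR (- (y / h) * (sqnorm z.1 / 2 + 2 * sqnorm z.2))).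

Definition rho01 (y : R) : R := I01 y * (2 / (1 + y) ^+ 2 * (1 + y) ^+ d).

Lemma measurable_rho01 : measurable_fun [set: R] rho01.
Proof.
rewrite /rho01.
rewrite (_ : (fun _ => _) = fun y => I01 y * (2 / (1 + `|y|) ^+ 2 * (1 + y) ^+ d)); last first.
  apply/funext => y; rewrite I01P; case: ifPn => [/andP[y0 _]|_]; last by rewrite !mul0r.
  by rewrite ger0_norm// ltW.
apply: measurable_funM; first exact: measurable_I01.
apply: continuous_measurable_fun; apply: continuous_mul; last first.
  by apply: continuous_pow; apply: continuous_add; [exact: continuous_c|move=> y; exact: cvg_id].
apply: continuous_mul; first exact: continuous_c.
apply: continuous_inv.
  by move=> y; rewrite expf_neq0// gt_eqF// ltr_pwDl.
apply: continuous_pow; apply: continuous_add; first exact: continuous_c.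
by move=> y; exact: norm_continuous.
Qed.

Lemma rho01_bound y : `|rho01 y| <= 2 * 2 ^+ d * I01 y.
Proof.
rewrite /rho01 I01P; case: ifPn => [/andP[y0 y1]|_]; last by rewrite mul0r normr0 mulr0.
by rewrite mul1r mulr1 -rhoE; [apply: rho_bound; rewrite (ltW y0)|exact: ltW].
Qed.

Lemma rho01_out y : ~~ (0 < y <= 1) -> rho01 y = 0.
Proof. by rewrite /rho01 I01P => /negbTE ->; rewrite mul0r. Qed.

Lemma rho01_dom y q : 0 <= q -> `|rho01 y * expR (- (y / h) * q)| <= 2 * 2 ^+ d * I01 y.
Proof.
move=> q0; case: (boolP (0 < y <= 1)) => [/andP[y0 y1]|/rho01_out ->].
  apply: le_trans (rho01_bound y); rewrite normrM ler_piMr// ger0_norm ?expR_ge0//.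
  by rewrite -expR0 ler_expR mulNr oppr_le0 mulr_ge0// divr_ge0// ltW.
by rewrite mul0r normr0 mulr_ge0// I01P.
Qed.

Lemma integrable_rho01_exp q : 0 <= q ->
  mu.-integrable setT (EFin \o (fun y => rho01 y * expR (- (y / h) * q))).
Proof.
move=> q0; apply: (le_integrable _ _ _ (integrableZl measurableT (2 * 2 ^+ d) integrable_I01)) => //.
  apply/measurable_EFinP; apply: measurable_funM; first exact: measurable_rho01.
  apply: (@continuous_measurable_fun R (fun y => expR (- (y / h) * q))); apply: continuous_exp.
  apply: continuous_mul; last exact: continuous_c.
  by apply: continuous_opp; apply: continuous_mul; [move=> y; exact: cvg_id|exact: continuous_c].
by move=> y _ /=; rewrite lee_fin; apply: le_trans (rho01_dom y q0) (ler_norm _).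
Qed.

Lemma msymE z : msym z = \int[mu]_y (rho01 y * expR (- (y / h) * (sqnorm z.1 / 2 + 2 * sqnorm z.2))).
Proof.
rewrite /msym; set q := sqnorm z.1 / 2 + _.
have q0 : 0 <= q by rewrite addr_ge0// ?divr_ge0 ?mulr_ge0 ?sqnorm_ge0.
pose f (y : R) : R := (y + 1) ^ (d%:Z - 2) * expR (- (y / h) * q).
have fE y : I01 y * f y = 2^-1 * (rho01 y * expR (- (y / h) * q)).
  rewrite /rho01 I01P; case: ifPn => [/andP[y0 y1]|_]; last by rewrite !mul0r mulr0.
  by rewrite !mul1r -rhoE ?(ltW y0)// /rho /f -!mulrA mulKf.
have i0 := integrable_rho01_exp q0.
have i1 : mu.-integrable setT (EFin \o (fun y => I01 y * f y)).
  have := integrableZl measurableT 2^-1 i0.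
  by apply: eq_integrable => // y _ /=; rewrite fE.
have i2 : mu.-integrable (`]0, 1]%classic : set R) (EFin \o f).
  apply/integrable_mkcond; first exact: measurable_itv.
  move: i1; apply: eq_integrable => // y _ /=.
  by rewrite patchE /I01 indicE; case: ifPn => _; rewrite ?mul1r ?mul0r.
rewrite -(Rintegral_itv_obnd_cbnd i2) Rintegral_I01.
under eq_Rintegral do rewrite -/(f _) fE.
by rewrite RintegralZl// mulrA divff// mul1r.
Qed.


(** Each derivative of the Gaussian is a polynomial, with coefficients bounded in
    the parameter, times the same Gaussian. *)
Lemma slowC_gauss (Y : Type) (c : Y -> R) C (p : V) k : (forall y, 0 <= c y <= C) ->
  slowC k (fun y v => expR (- (c y * sqnorm (p + v)))).
Proof.
move=> cC.
have cB y : `|- 2 * c y| <= 2 * C.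
  by have /andP[c0 c1] := cC y; rewrite normrM normrN !ger0_norm// ler_wpM2l.
have s0 : slow (fun y (v : V) => expR (- (c y * sqnorm (p + v)))).
  exists 0%N, 1 => y v; rewrite expr0 mulr1 ger0_norm ?expR_ge0// -expR0 ler_expR oppr_le0.
  by have /andP[c0 _] := cC y; rewrite mulr_ge0// sqnorm_ge0.
have cc y : continuous (fun v : V => expR (- (c y * sqnorm (p + v)))).
  apply: continuous_exp; apply: continuous_opp; apply: continuous_mul; first exact: continuous_c.
  apply: continuous_dot => j; under eq_fun do rewrite mxE;
    by apply: continuous_add; [exact: continuous_c|exact: continuous_coor].
elim: k => [|k IH]; split => //.
exists (fun j y (v : V) => ((- 2 * c y) * (p ord0 j + v ord0 j)) * expR (- (c y * sqnorm (p + v)))).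
split=> [j y v|j]; last first.
  apply: slowC_mul => //; apply: slowC_mul; first exact: slowC_bounded_const cB.
  by apply: slowC_add; [exact: slowC_cst|exact: slowC_coor].
have D : is_derive v (e_ j) (fun v : V => sqnorm (p + v)) (2 * (p ord0 j + v ord0 j)).
  have : is_derive v (e_ j) (fun v : V => \sum_l (p ord0 l + v ord0 l) ^+ 2)
     (\sum_l (2 * (p ord0 l + v ord0 l) * (0 + (l == j)%:R))).
    apply: is_derive_bigsum => l _.
    have := is_derive_pow 2 (is_derive_add (is_derive_c v (e_ j) (p ord0 l)) (is_derive_coor v j l)).
    by apply: is_derive_val; rewrite expr1.
  rewrite (bigD1 j)//= eqxx add0r mulr1 big1 ?addr0 => [|l lj]; last by rewrite (negPf lj) addr0 mulr0.
  by apply: is_derive_ext => u; rewrite sqnormE; apply: eq_bigr => l _; rewrite mxE.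
have := is_derive_exp (is_derive_opp (is_derive_scale (c y) D)).
by apply: is_derive_val; ring.
Qed.

Ltac meas_rho := repeat first [exact: (measurableT_comp measurable_rho01) | meas_step].

Section evaluation.
Variables (w : V -> R) (v : V) (dl : R).
Hypothesis rw : rapidC (2 * d) (fun _ : unit => w).

(** The v'-integral of Op_h(e^(-(y/h) q)) w, without the factor
    e^(-2 (y/h) |eta|^2) that does not depend on v'. *)
Definition wosc (y : R) (eta : V) : R :=
  \int[leb d]_v' (cos (h^-1 * dot (v - v') eta + dl) * (expR (- (y / (8 * h) * sqnorm (v + v'))) * w v')).

Let cw : continuous w. Proof. by have /(_ tt) := rapid_cont rw. Qed.

Let mw : measurable_fun setT w. Proof. exact: continuous_measurable_rV. Qed.

Let w_dom : exists C, 0 <= C /\ forall v', `|w v'| <= C * wt v'.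
Proof. by have [C [C0 CH]] := rapid_wt (rapid0 rw); exists C; split=> // v'; exact: (CH tt). Qed.

Let iw : (leb d).-integrable setT (EFin \o w).
Proof. by have [C [C0 CH]] := w_dom; exact: (integrable_wt_dom mw CH). Qed.

Let iaw : (leb d).-integrable setT (EFin \o (fun v' => `|w v'|)).
Proof. exact: integrable_norm. Qed.

Lemma phaseE (v' eta : V) : h^-1 * dot (v - v') eta + dl =
  (- h^-1) * dot eta v' + (h^-1 * dot v eta + dl).
Proof. by rewrite dotDl dotNl (dotC v'); ring. Qed.

(** The Gaussian factor is a slow family for y in [0, 1], including y = 0 where
    it is constant, so the decay in eta comes from w alone. *)
Lemma wosc_decay : exists2 C, 0 <= C & forall y eta, 0 <= y <= 1 -> `|wosc y eta| <= C * wt eta.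
Proof.
pose Y := {y : R | 0 <= y <= 1}.
pose F (y : Y) v' := expR (- (val y / (8 * h) * sqnorm (v + v'))) * w v'.
have rF : rapidC (2 * d) F.
  apply: rapidC_mul; last exact: (@rapidC_pull R d unit Y (fun=> tt) _ _ rw).
  apply: (@slowC_gauss _ (fun y : Y => val y / (8 * h)) (1 / (8 * h))) => -[y /= /andP[y0 y1]].
  have h8 : 0 < 8 * h by rewrite mulr_gt0.
  by rewrite divr_ge0 ?(ltW h8)//= ler_pM2r// invr_gt0.
have k0 : - h^-1 != 0 :> R by rewrite oppr_eq0 invr_eq0 gt_eqF.
have [C C0 CH] := osc_decay k0 rF; exists C => // y eta y01.
apply: le_trans (CH (h^-1 * dot v eta + dl) eta (exist _ y y01)).
by rewrite /wosc /osc; under eq_Rintegral do rewrite phaseE.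
Qed.

Lemma exponentE y (v' eta : V) : - (y / h) * (sqnorm (2^-1 *: (v + v')) / 2 + 2 * sqnorm eta) =
  - (y / (8 * h) * sqnorm (v + v')) - 2 * y / h * sqnorm eta.
Proof.
have -> : sqnorm (2^-1 *: (v + v')) = 4^-1 * sqnorm (v + v').
  by rewrite /sqnorm dotZl dotZr mulrA -invfM -natrM.
by field; rewrite gt_eqF.
Qed.

Lemma integrable_wosc y eta : 0 <= y -> (leb d).-integrable setT (EFin \o
  (fun v' => cos (h^-1 * dot (v - v') eta + dl) * (expR (- (y / (8 * h) * sqnorm (v + v'))) * w v'))).
Proof.
move=> y0; apply: (le_integrable _ _ _ iaw) => //.
  apply/measurable_EFinP; apply: continuous_measurable_rV; apply: continuous_mul.
    apply: continuous_chain; first exact: continuous_cos.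
    apply: continuous_add; last exact: continuous_c.
    apply: continuous_mul; first exact: continuous_c.
    apply: continuous_dot => j; last exact: continuous_c.
    under eq_fun do rewrite !mxE; apply: continuous_add; first exact: continuous_c.
    by apply: continuous_opp; exact: continuous_coor.
  apply: continuous_mul; last exact: cw.
  apply: continuous_exp; apply: continuous_opp.
  apply: continuous_mul; first exact: continuous_c.
  apply: continuous_dot => j; under eq_fun do rewrite mxE;
    by apply: continuous_add; [exact: continuous_c|exact: continuous_coor].
move=> v' _ /=; rewrite lee_fin normr_id; apply: le_trans (norm_mul_le _ (cos_norm_le1 _)) _.
rewrite normrM ler_piMl// ger0_norm ?expR_ge0// -expR0 ler_expR oppr_le0 mulr_ge0 ?sqnorm_ge0//.
by rewrite divr_ge0// mulr_ge0// ltW.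
Qed.

(** Fubini in (v', y) for fixed eta, dominated by |w|. *)
Lemma weyl_inner (eta : V) :
  \int[leb d]_v' (cos (h^-1 * dot (v - v') eta + dl) * msym (2^-1 *: (v + v'), eta) * w v') =
  \int[mu]_y (rho01 y * (gauss (2 * y / h) eta * wosc y eta)).
Proof.
pose F (v' : V) (y : R) := (cos (h^-1 * dot (v - v') eta + dl) * w v') *
   (rho01 y * expR (- (y / h) * (sqnorm (2^-1 *: (v + v')) / 2 + 2 * sqnorm eta))).
have q0 v' : 0 <= sqnorm (2^-1 *: (v + v')) / 2 + 2 * sqnorm eta.
  by rewrite addr_ge0// ?divr_ge0 ?mulr_ge0 ?sqnorm_ge0.
transitivity (\int[leb d]_v' \int[mu]_y F v' y).
  apply: eq_Rintegral => v' _; rewrite /F RintegralZl//; last exact: integrable_rho01_exp.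
  have <- := msymE (2^-1 *: (v + v'), eta); by rewrite mulrAC.
rewrite (@RFubini_swap _ _ _ _ (measurableTypeR R) (leb d) mu F); last first.
  apply: (@integrable_prod_dom R _ _ _ (measurableTypeR R) (leb d) mu (fun z => F z.1 z.2) (fun v' => `|w v'|) (fun y => 2 * 2 ^+ d * I01 y)) => //.
  - by rewrite /F; meas_rho; exact: (measurableT_comp mw).
  - exact: (integrableZl measurableT (2 * 2 ^+ d) integrable_I01).
  - move=> v' y; rewrite /F normrM; apply: ler_pM => //; first exact: norm_mul_le (cos_norm_le1 _).
    exact: rho01_dom.
apply: eq_Rintegral => y _.
have [y01|y01] := boolP (0 < y <= 1); last first.
  rewrite rho01_out// mul0r Rintegral0_eq//.
  by move=> v'; rewrite /F rho01_out// mul0r mulr0.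
have y0 : 0 <= y by have /andP[/ltW] := y01.
rewrite /wosc mulrA -RintegralZl//; last exact: integrable_wosc.
apply: eq_Rintegral => v' _; rewrite /F exponentE expRD /gauss.
by ring.
Qed.

Lemma measurable_wosc : measurable_fun [set: V * measurableTypeR R] (fun z => wosc z.2 z.1).
Proof.
apply: (@measurable_fun_Rintegral R _ _ (V * measurableTypeR R)%type V (leb d)
  (fun z => cos (h^-1 * dot (v - z.2) z.1.1 + dl) * (expR (- (z.1.2 / (8 * h) * sqnorm (v + z.2))) * w z.2))).
have m1 : measurable_fun [set: (V * measurableTypeR R) * V] (fun z => z.1.1).
  exact: (measurableT_comp measurable_fst measurable_fst).
have m2 : measurable_fun [set: (V * measurableTypeR R) * V] (fun z => z.1.2).
  exact: (measurableT_comp measurable_snd measurable_fst).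
by meas_rho; first [exact: m1|exact: m2|exact: (measurableT_comp mw)].
Qed.

(** Fubini in (eta, y): the Gaussian in eta degenerates as y tends to 0, and it is
    [wosc_decay] that provides a dominating function uniform in y. *)
Lemma weyl_swap :
  \int[leb d]_eta \int[mu]_y (rho01 y * (gauss (2 * y / h) eta * wosc y eta)) =
  \int[mu]_y (rho01 y * \int[leb d]_eta (gauss (2 * y / h) eta * wosc y eta)).
Proof.
have [C C0 CH] := wosc_decay.
pose F (eta : V) (y : R) := rho01 y * (gauss (2 * y / h) eta * wosc y eta).
rewrite (@RFubini_swap _ _ _ _ (measurableTypeR R) (leb d) mu F); last first.
  apply: (@integrable_prod_dom R _ _ _ (measurableTypeR R) (leb d) mu (fun z => F z.1 z.2) (fun eta => C * wt eta) (fun y => 2 * 2 ^+ d * I01 y)) => //.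
  - by rewrite /F /gauss; meas_rho; exact: measurable_wosc.
  - exact: (integrableZl measurableT C (integrable_wt d)).
  - exact: (integrableZl measurableT (2 * 2 ^+ d) integrable_I01).
  - move=> eta y; rewrite /F normrM mulrC.
    have [y01|y01] := boolP (0 < y <= 1); last first.
      by rewrite rho01_out// normr0 mulr0 I01P (negbTE y01) !mulr0.
    have y01' : 0 <= y <= 1 by have /andP[/ltW -> ->] := y01.
    apply: ler_pM => //; last exact: rho01_bound.
    rewrite normrM; apply: le_trans (CH y eta y01').
    rewrite ler_piMl// ger0_norm ?gauss_ge0// gauss_le1//.
    by rewrite divr_ge0 ?(ltW h0)// mulr_ge0//; have /andP[] := y01'.
apply: eq_Rintegral => y _; rewrite /F.
have [y01|y01] := boolP (0 < y <= 1); last first.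
  rewrite rho01_out// mul0r Rintegral0_eq//.
  by move=> v'; rewrite mul0r.
have y01' : 0 <= y <= 1 by have /andP[/ltW -> ->] := y01.
rewrite RintegralZl//; apply: (@integrable_wt_dom _ _ _ C).
  apply: measurable_funM; first exact: measurable_gauss.
  exact: (measurableT_comp measurable_wosc (pair2_measurable y)).
move=> eta; rewrite normrM; apply: le_trans (CH y eta y01').
rewrite ler_piMl// ger0_norm ?gauss_ge0// gauss_le1//.
by rewrite divr_ge0 ?(ltW h0)// mulr_ge0//; have /andP[] := y01'.
Qed.

(** The exponential of Mehler's kernel at time y, without its constant. *)
Definition mehler (y : R) (v v' : V) : R :=
  expR (- (sqnorm (v - v') / (8 * y * h)) - y / (8 * h) * sqnorm (v + v')).

(** For fixed y > 0 the Gaussian in eta is integrable, so the eta-integral can be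
    done first; it is a Fourier transform at (v - v')/h. *)
Lemma weyl_gauss y : 0 < y ->
  \int[leb d]_eta (gauss (2 * y / h) eta * wosc y eta) =
  cos dl * (Num.sqrt (pi * h / (2 * y)) ^+ d * \int[leb d]_v' (mehler y v v' * w v')).
Proof.
move=> y0; have a0 : 0 < 2 * y / h by rewrite divr_gt0// mulr_gt0.
pose G v' := expR (- (y / (8 * h) * sqnorm (v + v'))) * w v'.
pose F (eta v' : V) := gauss (2 * y / h) eta * (cos (h^-1 * dot (v - v') eta + dl) * G v').
have Gw v' : `|G v'| <= `|w v'|.
  rewrite normrM ler_piMl// ger0_norm ?expR_ge0// -expR0 ler_expR oppr_le0 mulr_ge0 ?sqnorm_ge0//.
  by rewrite divr_ge0 ?(ltW y0)// mulr_ge0// ltW.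
have mG : measurable_fun setT G by rewrite /G; meas_rho; exact: mw.
have iG : (leb d).-integrable setT (EFin \o G).
  apply: (le_integrable _ _ _ iaw) => //; first exact/measurable_EFinP.
  by move=> v' _ /=; rewrite lee_fin normr_id.
transitivity (\int[leb d]_eta \int[leb d]_v' F eta v').
  by apply: eq_Rintegral => eta _; rewrite /F RintegralZl//; exact: integrable_wosc (ltW y0).
rewrite (@RFubini_swap _ _ _ _ _ (leb d) (leb d) F); last first.
  apply: (@integrable_prod_dom R _ _ _ _ (leb d) (leb d) (fun z => F z.1 z.2) (gauss (2 * y / h)) (fun v' => `|w v'|)) => //.
  - by rewrite /F /gauss; meas_rho; first [exact: (measurableT_comp mG)|exact: (measurableT_comp mw)].
  - exact: integrable_gauss.
  - move=> eta v'; rewrite normrM (ger0_norm (gauss_ge0 _ _)) ler_wpM2l ?gauss_ge0//.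
    exact: le_trans (norm_mul_le _ (cos_norm_le1 _)) (Gw v').
have E v' : \int[leb d]_eta F eta v' = (cos dl * Num.sqrt (pi * h / (2 * y)) ^+ d) * (mehler y v v' * w v').
  transitivity (\int[leb d]_eta (G v' * (cos (dot (h^-1 *: (v - v')) eta + dl) * gauss (2 * y / h) eta))).
    by apply: eq_Rintegral => eta _; rewrite /F dotZl; ring.
  rewrite RintegralZl//; last first.
    apply: (le_integrable _ _ _ (integrable_gauss d a0)) => //.
      by apply/measurable_EFinP; apply: measurable_funM; [meas_rho|exact: measurable_gauss].
    move=> e _ /=; rewrite lee_fin normrM (ger0_norm (gauss_ge0 _ _)) ler_piMl ?gauss_ge0//.
    exact: cos_norm_le1.
  rewrite integral_cos_gauss//.
  have -> : pi / (2 * y / h) = pi * h / (2 * y) by rewrite invf_div mulrA.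
  have -> : sqnorm (h^-1 *: (v - v')) / (4 * (2 * y / h)) = sqnorm (v - v') / (8 * y * h).
    rewrite [sqnorm (_ *: _)]/sqnorm dotZl dotZr -/(sqnorm _); field.
    by rewrite !gt_eqF.
  by rewrite /mehler expRD /G; ring.
under eq_Rintegral do rewrite E.
rewrite RintegralZl//; first by rewrite mulrA.
apply: (le_integrable _ _ _ iaw) => //.
  apply/measurable_EFinP; rewrite /mehler; meas_rho; exact: mw.
move=> v' _ /=; rewrite lee_fin normr_id normrM ler_piMl// ger0_norm ?expR_ge0//.
rewrite -expR0 ler_expR subr_le0; apply: (@le_trans _ _ 0).
  by rewrite oppr_le0 divr_ge0 ?sqnorm_ge0// !mulr_ge0// ltW.
by rewrite mulr_ge0 ?sqnorm_ge0// divr_ge0 ?(ltW y0)// mulr_ge0// ltW.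
Qed.

Lemma weyl_eval :
  \int[leb d]_eta \int[leb d]_v'
    (cos (h^-1 * dot (v - v') eta + dl) * msym (2^-1 *: (v + v'), eta) * w v') =
  \int[mu]_y (rho01 y * (cos dl * (Num.sqrt (pi * h / (2 * y)) ^+ d * \int[leb d]_v' (mehler y v v' * w v')))).
Proof.
under eq_Rintegral do rewrite weyl_inner.
rewrite weyl_swap; apply: eq_Rintegral => y _.
have [y01|y01] := boolP (0 < y <= 1); last by rewrite rho01_out// !mul0r.
by rewrite weyl_gauss//; have /andP[] := y01.
Qed.

End evaluation.

End weyl_evaluation.

(** * The Mehler operators as Gaussian averages *)

Section mehler_average.
Context {R : realType} (d : nat).
Notation leb := (lebesgue_rV R).
Notation mu := (@lebesgue_measure R).
Local Notation V := 'rV[R]_d.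
Local Notation e_ j := (delta_mx ord0 j : 'rV[R]_d).
Variable (h : R).
Hypothesis h0 : 0 < h.

(** For y > 0 the Mehler kernel at v is a Gaussian in v' with mean
    [mehler_s y *: v] and standard deviation [mehler_sg y], of total mass
    [mehler_c y ^+ d * expR (- (mehler_q y * sqnorm v))]. These parameters extend
    continuously to all real y, the square root of a negative number being 0. *)
Definition mehler_s (y : R) : R := (1 - y ^+ 2) / (1 + y ^+ 2).
Definition mehler_sg (y : R) : R := Num.sqrt (4 * h * y / (1 + y ^+ 2)).
Definition mehler_c (y : R) : R := (1 + y) / Num.sqrt (1 + y ^+ 2).
Definition mehler_q (y : R) : R := y / (2 * h * (1 + y ^+ 2)).
Definition stdgauss (z : V) : R := gauss 2^-1 z.
Definition stdgauss_cst : R := (Num.sqrt (2 * pi) ^+ d)^-1.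

Lemma y2_gt0 (y : R) : 0 < 1 + y ^+ 2.
Proof. by rewrite ltr_pwDl// sqr_ge0. Qed.

Lemma y2_neq0 (y : R) : 1 + y ^+ 2 != 0.
Proof. by rewrite gt_eqF// y2_gt0. Qed.

Lemma sy2_gt0 (y : R) : 0 < Num.sqrt (1 + y ^+ 2).
Proof. by rewrite sqrtr_gt0 y2_gt0. Qed.

Lemma continuous_rid : continuous (fun y : R => y).
Proof. by move=> y; exact: cvg_id. Qed.

Lemma continuous_y2 : continuous (fun y : R => 1 + y ^+ 2).
Proof. by apply: continuous_add; [exact: continuous_c|exact: exprn_continuous]. Qed.

Lemma continuous_mehler_s : continuous mehler_s.
Proof.
apply: continuous_mul; last by apply: continuous_inv; [exact: y2_neq0|exact: continuous_y2].
by apply: continuous_add; [exact: continuous_c|apply: continuous_opp; exact: exprn_continuous].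
Qed.

Lemma continuous_mehler_sg : continuous mehler_sg.
Proof.
apply: (@continuous_chain _ _ Num.sqrt); first exact: sqrt_continuous.
apply: continuous_mul; last by apply: continuous_inv; [exact: y2_neq0|exact: continuous_y2].
by apply: continuous_mul; [exact: continuous_c|exact: continuous_rid].
Qed.

Lemma continuous_mehler_c : continuous mehler_c.
Proof.
apply: continuous_mul.
  by apply: continuous_add; [exact: continuous_c|exact: continuous_rid].
apply: continuous_inv; first by move=> y; rewrite gt_eqF// sy2_gt0.
by apply: (@continuous_chain _ _ Num.sqrt); [exact: sqrt_continuous|exact: continuous_y2].
Qed.

Lemma continuous_mehler_q : continuous mehler_q.
Proof.
apply: continuous_mul; first exact: continuous_rid.
apply: continuous_inv.
  by move=> y; rewrite !mulf_neq0 ?y2_neq0 ?gt_eqF.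
by apply: continuous_mul; [exact: continuous_c|exact: continuous_y2].
Qed.

Lemma integrable_stdgauss : (leb d).-integrable setT (EFin \o stdgauss).
Proof. by apply: integrable_gauss; rewrite invr_gt0. Qed.

Lemma Rintegral_stdgauss : \int[leb d]_z stdgauss z = Num.sqrt (2 * pi) ^+ d.
Proof. by rewrite Rintegral_gauss ?invr_gt0// invrK mulrC. Qed.

Lemma stdgauss_cst_gt0 : 0 < stdgauss_cst.
Proof. by rewrite invr_gt0 exprn_gt0// sqrtr_gt0 mulr_gt0// pi_gt0. Qed.

Lemma stdgauss_cst_stdgauss : stdgauss_cst * \int[leb d]_z stdgauss z = 1.
Proof. by rewrite Rintegral_stdgauss mulVf// -invr_eq0 gt_eqF// stdgauss_cst_gt0. Qed.

Definition gauss_avg (y : R) (w : V -> R) (v : V) : R :=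
  stdgauss_cst * \int[leb d]_z (w (mehler_s y *: v + mehler_sg y *: z) * stdgauss z).

(** T_y in the form that stays regular at y = 0. *)
Definition mehler_op (y : R) (w : V -> R) (v : V) : R :=
  mehler_c y ^+ d * expR (- (mehler_q y * sqnorm v)) * gauss_avg y w v.

(** The class on which Gaussian averages are defined and continuous in y. *)
Definition bdd_cont (w : V -> R) := continuous w /\ exists C, forall v, `|w v| <= C.

Lemma rapid_bdd_cont k w : rapidC k (fun _ : unit => w) -> bdd_cont w.
Proof.
move=> rw; split; first by have /(_ tt) := rapid_cont rw.
have [C CH] := rapid0 rw 0%N; exists C => v; have := CH tt v.
by rewrite expr0 mul1r.
Qed.

Section bdd_cont_functions.
Variables (w : V -> R).
Hypothesis nw : bdd_cont w.

Let cw : continuous w. Proof. by case: nw. Qed.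

Let mw : measurable_fun setT w. Proof. exact: continuous_measurable_rV. Qed.

Lemma integrable_avg (a : V) (s : R) :
  (leb d).-integrable setT (EFin \o (fun z => w (a + s *: z) * stdgauss z)).
Proof.
have [_ [C CH]] := nw.
apply: (le_integrable _ _ _ (integrableZl measurableT C integrable_stdgauss)) => //.
  apply/measurable_EFinP; apply: measurable_funM; last exact: measurable_gauss.
  exact: (measurableT_comp mw (measurable_affine a s)).
move=> z _ /=; rewrite lee_fin normrM [X in _ <= X]normrM; apply: ler_wpM2r => //.
exact: le_trans (CH _) (ler_norm _).
Qed.

Lemma integrable_avg_gen (f : V -> R) C (a : V) (s : R) : continuous f -> (forall v, `|f v| <= C) ->
  (leb d).-integrable setT (EFin \o (fun z => f (a + s *: z) * stdgauss z)).
Proof.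
move=> cf CH; apply: (le_integrable _ _ _ (integrableZl measurableT C integrable_stdgauss)) => //.
  apply/measurable_EFinP; apply: measurable_funM; last exact: measurable_gauss.
  exact: (measurableT_comp (continuous_measurable_rV cf) (measurable_affine a s)).
move=> z _ /=; rewrite lee_fin normrM [X in _ <= X]normrM; apply: ler_wpM2r => //.
exact: le_trans (CH _) (ler_norm _).
Qed.

Lemma gauss_avg_bound C y v : (forall v, `|w v| <= C) -> `|gauss_avg y w v| <= C.
Proof.
move=> CH; rewrite /gauss_avg normrM (ger0_norm (ltW stdgauss_cst_gt0)).
have C0 : 0 <= C by exact: le_trans (CH 0).
apply: (@le_trans _ _ (stdgauss_cst * (C * \int[leb d]_z stdgauss z))); last first.
  by rewrite mulrCA stdgauss_cst_stdgauss mulr1.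
apply: ler_wpM2l; first exact/ltW/stdgauss_cst_gt0.
apply: le_trans (le_normr_Rintegral measurableT (integrable_avg _ _)) _.
rewrite -RintegralZl//; last exact: integrable_stdgauss.
apply: le_Rintegral => //.
- by apply: integrable_norm; exact: integrable_avg.
- exact: (integrableZl measurableT C integrable_stdgauss).
- by move=> z _; rewrite normrM (ger0_norm (gauss_ge0 _ _)) ler_wpM2r// gauss_ge0.
Qed.

(** Dominated convergence; the Gaussian weight is the same for all y. *)
Lemma continuous_gauss_avg v : continuous (fun y => gauss_avg y w v).
Proof.
have [_ [C CH]] := nw.
move=> y; apply: cvgM; first exact: cvg_cst.
pose f (y : R) (z : V) := w (mehler_s y *: v + mehler_sg y *: z) * stdgauss z.
have IF x : `]y - 1, y + 1[%classic x -> (leb d).-integrable setT (EFin \o f x).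
  by move=> _; exact: integrable_avg.
have CF : {ae leb d, forall z, setT z -> {in `]y - 1, y + 1[%classic, continuous (f ^~ z)}}.
  apply: aeW => z _ x _; apply: cvgM; last exact: cvg_cst.
  apply: continuous_comp; last exact: cw.
  by apply: cvgD; apply: cvgZr_tmp; [exact: continuous_mehler_s|exact: continuous_mehler_sg].
have UB x : `]y - 1, y + 1[%classic x -> {ae leb d, forall z, setT z -> `|f x z| <= C * stdgauss z}.
  move=> _; apply: aeW => z _.
  by rewrite normrM (ger0_norm (gauss_ge0 _ _)) ler_wpM2r// gauss_ge0.
have := continuity_under_integral measurableT IF CF (integrableZl measurableT C integrable_stdgauss) UB.
by apply; rewrite inE /= in_itv/= ltrBlDr !ltrDl ltr01.
Qed.

Lemma continuous_mehler_op v : continuous (fun y => mehler_op y w v).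
Proof.
apply: continuous_mul; last exact: continuous_gauss_avg.
apply: continuous_mul; first by apply: continuous_pow; exact: continuous_mehler_c.
apply: continuous_exp; apply: continuous_opp; apply: continuous_mul; last exact: continuous_c.
exact: continuous_mehler_q.
Qed.

Lemma is_derive_gauss_avg (j : 'I_d) (dw : V -> R) y v : bdd_cont dw ->
  (forall v, is_derive v (e_ j) w (dw v)) ->
  is_derive v (e_ j) (gauss_avg y w) (mehler_s y * gauss_avg y dw v).
Proof.
move=> [cdw [C CH]] Dw; rewrite /gauss_avg mulrCA; apply: is_derive_scale; apply/is_deriveP.
have -> : mehler_s y * \int[leb d]_z (dw (mehler_s y *: v + mehler_sg y *: z) * stdgauss z) =
    \int[leb d]_z (mehler_s y * (dw (mehler_s y *: (v + 0 *: e_ j) + mehler_sg y *: z) * stdgauss z)).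
  rewrite RintegralZl//; last exact: (integrable_avg_gen _ _ cdw CH).
  by congr (_ * _); apply: eq_Rintegral => z _; rewrite scale0r addr0.
apply: (@is_derive_Rintegral R _ V (leb d) setT
  (fun t z => w (mehler_s y *: (v + t *: e_ j) + mehler_sg y *: z) * stdgauss z)
  (fun t z => mehler_s y * (dw (mehler_s y *: (v + t *: e_ j) + mehler_sg y *: z) * stdgauss z)) 0 1 (fun z => `|mehler_s y| * (C * stdgauss z))) => //.
- by move=> t _; exact: integrable_avg.
- move=> t z _ _.
  pose p := mehler_s y *: v + mehler_sg y *: z.
  have E u : mehler_s y *: (v + u *: e_ j) + mehler_sg y *: z = p + (mehler_s y * u) *: e_ j.
    by rewrite /p scalerDr scalerA -!addrA; congr (_ + _); rewrite addrC.
  have D1 := is_derive_line (Dw (p + (mehler_s y * t) *: e_ j)).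
  have D2 := is_derive_scale (mehler_s y) (is_derive_id t (1 : R)).
  have := is_derive_mul (is_derive_chain D1 D2) (is_derive_c t (1 : R) (stdgauss z)).
  rewrite /= !mulr1 mulr0 add0r E => D3.
  apply: (@is_derive_ext _ _ (fun u => w (p + (mehler_s y * u) *: e_ j) * stdgauss z)).
    by move=> u; rewrite E.
  by apply: is_derive_val D3; ring.
- exact: (integrableZl measurableT `|mehler_s y| (integrableZl measurableT C integrable_stdgauss)).
- move=> t z _ _; rewrite normrM ler_wpM2l// normrM (ger0_norm (gauss_ge0 _ _)).
  by rewrite ler_wpM2r// gauss_ge0.
Qed.

Lemma is_derive_sqnorm (v : V) j : is_derive v (e_ j) (fun v : V => sqnorm v) (2 * v ord0 j).
Proof.
have : is_derive v (e_ j) (fun v : V => \sum_l v ord0 l ^+ 2) (\sum_l (2 * v ord0 l * (l == j)%:R)).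
  apply: is_derive_bigsum => l _.
  by have := is_derive_pow 2 (is_derive_coor v j l); apply: is_derive_val; rewrite expr1.
rewrite (bigD1 j)//= eqxx mulr1 big1 ?addr0 => [|l lj]; last by rewrite (negPf lj) mulr0.
by apply: is_derive_ext => u; rewrite sqnormE.
Qed.

(** The derivative in v_j: one term from the Gaussian prefactor, one from the
    argument s v + sigma z, where it falls on w. *)
Definition d_mehler_op (j : 'I_d) y (dw : V -> R) (v : V) := - (2 * mehler_q y * v ord0 j) * mehler_op y w v + mehler_s y * mehler_op y dw v.

Lemma is_derive_mehler_op (j : 'I_d) (dw : V -> R) y v : bdd_cont dw ->
  (forall v, is_derive v (e_ j) w (dw v)) ->
  is_derive v (e_ j) (mehler_op y w) (d_mehler_op j y dw v).
Proof.
move=> ndw Dw.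
have D1 := is_derive_exp (is_derive_opp (is_derive_scale (mehler_q y) (is_derive_sqnorm v j))).
have := is_derive_mul (is_derive_scale (mehler_c y ^+ d) D1) (is_derive_gauss_avg y v ndw Dw).
by apply: is_derive_val; rewrite /d_mehler_op /mehler_op; ring.
Qed.

End bdd_cont_functions.

(** The substitution v' = s v + sigma z contributes a factor sigma per coordinate,
    which turns the constant of the kernel into that of the Gaussian average. *)
Lemma mehler_c_kernel y : 0 < y ->
  (1 + y) / (2 * pi * h) * Num.sqrt (pi * h / (2 * y)) * mehler_sg y = mehler_c y / Num.sqrt (2 * pi).
Proof.
move=> y0; have p0 : 0 < (pi : R) by exact: pi_gt0.
have s0 : 0 < Num.sqrt (2 * pi) :> R by rewrite sqrtr_gt0 mulr_gt0.
have -> : (1 + y) / (2 * pi * h) * Num.sqrt (pi * h / (2 * y)) * mehler_sg y =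
    (1 + y) / (2 * pi * h) * (Num.sqrt (2 * pi) * h / Num.sqrt (1 + y ^+ 2)).
  rewrite -mulrA; congr (_ * _); rewrite /mehler_sg -sqrtrM; last first.
    by rewrite divr_ge0 ?mulr_ge0 ?(ltW p0) ?(ltW h0)// ltW.
  have -> : pi * h / (2 * y) * (4 * h * y / (1 + y ^+ 2)) = (2 * pi) * (h ^+ 2 / (1 + y ^+ 2)).
    by field; rewrite y2_neq0 gt_eqF.
  rewrite [LHS]sqrtrM ?mulr_ge0 ?(ltW p0)// [Num.sqrt (_ / _)]sqrtrM ?sqr_ge0// sqrtr_sqr (ger0_norm (ltW h0)).
  by rewrite sqrtrV ?(ltW (y2_gt0 y))// mulrA.
have E : Num.sqrt (2 * pi) * Num.sqrt (2 * pi) = 2 * pi :> R.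
  by rewrite -expr2 sqr_sqrtr// mulr_ge0// ltW.
move: E s0; set S := Num.sqrt (2 * pi) => E s0; rewrite -E /mehler_c; field.
by rewrite !gt_eqF ?sy2_gt0.
Qed.

Definition mehler_cst y : R := (1 + y) / (2 * pi * h) * Num.sqrt (pi * h / (2 * y)).
Definition mehler_ker y (v v' : V) : R := mehler_cst y ^+ d * mehler h y v v'.

(** Completing the square: s and sigma are chosen so that the terms in v . z
    cancel and the coefficient of |z|^2 is 1/2. *)
Lemma mehler_affine y v z : 0 < y ->
  mehler h y v (mehler_s y *: v + mehler_sg y *: z) = expR (- (mehler_q y * sqnorm v)) * stdgauss z.
Proof.
move=> y0; rewrite /mehler /stdgauss /gauss -expRD; congr expR.
have sg2 : mehler_sg y ^+ 2 = 4 * h * y / (1 + y ^+ 2).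
  by rewrite sqr_sqrtr// divr_ge0 ?(ltW (y2_gt0 y))// !mulr_ge0// ltW.
set a := sqnorm v; pose b := dot v z; set c := sqnorm z.
have E1 : sqnorm (v - (mehler_s y *: v + mehler_sg y *: z)) = (1 - mehler_s y) ^+ 2 * a - 2 * (1 - mehler_s y) * mehler_sg y * b + mehler_sg y ^+ 2 * c.
  rewrite /sqnorm !(dotDl, dotDr, dotNl, dotNr, dotZl, dotZr) (dotC z v) -/b -/(sqnorm v) -/(sqnorm z) -/a -/c.
  ring.
have E2 : sqnorm (v + (mehler_s y *: v + mehler_sg y *: z)) = (1 + mehler_s y) ^+ 2 * a + 2 * (1 + mehler_s y) * mehler_sg y * b + mehler_sg y ^+ 2 * c.
  rewrite /sqnorm !(dotDl, dotDr, dotNl, dotNr, dotZl, dotZr) (dotC z v) -/b -/(sqnorm v) -/(sqnorm z) -/a -/c.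
  ring.
rewrite E1 E2 sg2 /mehler_s /mehler_q; field.
by rewrite y2_neq0 !gt_eqF.
Qed.

Section kernel_form.
Variables (w : V -> R).
Hypothesis nw : bdd_cont w.
Hypothesis iw : (leb d).-integrable setT (EFin \o w).

Lemma measurable_mehler y (v : V) : measurable_fun setT (mehler h y v).
Proof. by rewrite /mehler; meas. Qed.

Lemma mehler_ge0 y (v v' : V) : 0 <= mehler h y v v'. Proof. exact: expR_ge0. Qed.

Lemma mehler_le1 y (v v' : V) : 0 < y -> mehler h y v v' <= 1.
Proof.
move=> y0; rewrite -expR0 ler_expR subr_le0; apply: (@le_trans _ _ 0).
  by rewrite oppr_le0 divr_ge0 ?sqnorm_ge0// !mulr_ge0// ltW.
by rewrite mulr_ge0 ?sqnorm_ge0// divr_ge0 ?(ltW y0)// mulr_ge0// ltW.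
Qed.

Lemma integrable_mehler y v : 0 < y -> (leb d).-integrable setT (EFin \o (fun v' => mehler h y v v' * w v')).
Proof.
move=> y0; apply: (le_integrable _ _ _ iw) => //.
  apply/measurable_EFinP; apply: measurable_funM; first exact: measurable_mehler.
  by apply/measurable_EFinP; exact: (measurable_int _ iw).
move=> v' _ /=; rewrite lee_fin normrM ler_piMl// ger0_norm ?mehler_ge0//.
exact: mehler_le1.
Qed.

(** The change of variables v' = s v + sigma z. *)
Lemma mehler_op_kernel y v : 0 < y ->
  mehler_op y w v = \int[leb d]_v' (mehler_ker y v v' * w v').
Proof.
move=> y0; have s0 : 0 < mehler_sg y.
  by rewrite sqrtr_gt0 divr_gt0 ?y2_gt0// !mulr_gt0.
transitivity (mehler_cst y ^+ d * \int[leb d]_v' (mehler h y v v' * w v')); last first.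
  rewrite -RintegralZl//; last exact: integrable_mehler.
  by apply: eq_Rintegral => v' _; rewrite mulrA.
rewrite (Rintegral_affine (mehler_s y *: v) s0 (integrable_mehler v y0)).
under eq_Rintegral do rewrite mehler_affine// -mulrA [stdgauss _ * _]mulrC.
rewrite RintegralZl//; last exact: integrable_avg.
rewrite mulrA -exprMn /mehler_cst mehler_c_kernel// /mehler_op /gauss_avg /stdgauss_cst [(mehler_c y / _) ^+ d]expr_div_n.
by ring.
Qed.

End kernel_form.

End mehler_average.

(** * The generator identity for the Mehler kernel *)

Lemma Rintegral_sum d (T : measurableType d) (R : realType) (m : {measure set T -> \bar R})
    (I : Type) (s : seq I) (g : I -> T -> R) : (forall i, m.-integrable setT (EFin \o g i)) ->
  m.-integrable setT (EFin \o (fun v => \sum_(i <- s) g i v)) /\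
  \int[m]_v (\sum_(i <- s) g i v) = \sum_(i <- s) \int[m]_v g i v.
Proof.
move=> ig; elim: s => [|i s [IH1 IH2]].
  split; last by rewrite big_nil Rintegral0_eq// => v; rewrite big_nil.
  have := integrable0 m setT; apply: eq_integrable => // v _ /=.
  by rewrite big_nil.
split.
  have := integrableD measurableT (ig i) IH1; apply: eq_integrable => // v _ /=.
  by rewrite big_cons.
rewrite big_cons -IH2 -RintegralD//.
by apply: eq_Rintegral => v _; rewrite big_cons.
Qed.

Section generator_identity.
Context {R : realType} (d : nat).
Notation leb := (lebesgue_rV R).
Notation mu := (@lebesgue_measure R).
Local Notation V := 'rV[R]_d.
Local Notation e_ j := (delta_mx ord0 j : 'rV[R]_d).
Variable (h : R).
Hypothesis h0 : 0 < h.

(* A single function is a family over [unit]. *)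
Local Notation rC g := (rapidC 0 (fun _ : unit => g)).
Local Notation sC g := (slowC 0 (fun _ : unit => g)).

Lemma rC_cont (g : V -> R) : rC g -> continuous g.
Proof. by move=> rg; have /(_ tt) := rapid_cont rg. Qed.

Lemma rC_meas (g : V -> R) : rC g -> measurable_fun setT g.
Proof. by move=> rg; apply: continuous_measurable_rV; exact: rC_cont. Qed.

Lemma rC_wt (g : V -> R) : rC g -> exists2 C, 0 <= C & forall v, `|g v| <= C * wt v.
Proof. by move=> rg; have [C [C0 CH]] := rapid_wt (rapid0 rg); exists C => // v; exact: (CH tt). Qed.

Lemma rC_integrable (g : V -> R) : rC g -> (leb d).-integrable setT (EFin \o g).
Proof.
move=> rg; have [C _ CH] := rC_wt rg; apply: integrable_wt_dom CH.
exact: rC_meas.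
Qed.

Lemma rC_mul (A g : V -> R) : sC A -> rC g -> rC (fun v => A v * g v).
Proof. exact: rapidC_mul. Qed.

Lemma rC_add (f g : V -> R) : rC f -> rC g -> rC (fun v => f v + g v).
Proof. exact: rapidC_add. Qed.

Lemma rC_scale c (g : V -> R) : rC g -> rC (fun v => c * g v).
Proof. exact: rapidC_scale. Qed.

Lemma rC_sum (I : Type) (s : seq I) (g : I -> V -> R) : (forall i, rC (g i)) ->
  rC (fun v => \sum_(i <- s) g i v).
Proof.
move=> rg; elim: s => [|i s IH].
  rewrite (_ : (fun _ => _) = fun=> fun v : V => 0); last by apply/funext => t; apply/funext => v; rewrite big_nil.
  split=> //; last by move=> ?; exact: continuous_c.
  by move=> N; exists 0 => y v; rewrite normr0 mulr0.
rewrite (_ : (fun _ => _) = fun=> (fun v => g i v + \sum_(j <- s) g j v)); first exact: rC_add.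
by apply/funext => t; apply/funext => v; rewrite big_cons.
Qed.

(** The product of a slow and a rapid function is rapid, so its derivative has
    integral 0. *)
Lemma ibp (j : 'I_d) (A dA g dg : V -> R) :
  (forall v, is_derive v (e_ j) A (dA v)) -> (forall v, is_derive v (e_ j) g (dg v)) ->
  sC A -> sC dA -> rC g -> rC dg ->
  \int[leb d]_v (A v * dg v) = - \int[leb d]_v (dA v * g v).
Proof.
move=> DA Dg sA sdA rg rdg; apply/eqP; rewrite -addr_eq0.
have r1 := rC_mul sA rdg; have r2 := rC_mul sdA rg; have r3 := rC_mul sA rg.
rewrite -RintegralD//; try exact: rC_integrable.
have [C C0 CH] := rC_wt (rC_add r1 r2); have [D D0 DH] := rC_wt r3.
apply/eqP; apply: (@Rintegral_partial _ _ j (fun v => A v * g v) _ (C + D)).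
- exact: rC_meas.
- by move=> v; have := is_derive_mul (DA v) (Dg v); apply: is_derive_val; rewrite [g v * _]mulrC.
- by move=> v; apply: le_trans (DH v) _; rewrite ler_wpM2r ?(ltW (wt_gt0 _))// lerDr.
- by move=> v; apply: le_trans (CH v) _; rewrite ler_wpM2r ?(ltW (wt_gt0 _))// lerDl.
Qed.

Section fixed.
Variables (y : R) (v : V).
Hypothesis y0 : 0 < y.

(** The logarithmic derivative of the kernel in v'_j. *)
Definition dlog_mehler (j : 'I_d) (v' : V) : R :=
  (v ord0 j - v' ord0 j) / (4 * y * h) - y * (v ord0 j + v' ord0 j) / (4 * h).

Lemma is_derive_coor_diag (v' : V) j : is_derive v' (e_ j) (fun u : V => u ord0 j) 1.
Proof. by have := is_derive_coor v' j j; rewrite eqxx. Qed.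

Lemma sqnormB (a b : V) : sqnorm (a - b) = \sum_l (a ord0 l - b ord0 l) ^+ 2.
Proof. by rewrite sqnormE; apply: eq_bigr => l _; rewrite !mxE. Qed.

Lemma sqnormD (a b : V) : sqnorm (a + b) = \sum_l (a ord0 l + b ord0 l) ^+ 2.
Proof. by rewrite sqnormE; apply: eq_bigr => l _; rewrite !mxE. Qed.

Lemma is_derive_sq_shift (s : R) (a v' : V) (j : 'I_d) :
  is_derive v' (e_ j) (fun v' : V => \sum_l (a ord0 l + s * v' ord0 l) ^+ 2) (2 * s * (a ord0 j + s * v' ord0 j)).
Proof.
have : is_derive v' (e_ j) (fun v' : V => \sum_l (a ord0 l + s * v' ord0 l) ^+ 2)
   (\sum_l (2 * (a ord0 l + s * v' ord0 l) * (0 + s * (l == j)%:R))).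
  apply: is_derive_bigsum => l _.
  have := is_derive_pow 2 (is_derive_add (is_derive_c v' (e_ j) (a ord0 l)) (is_derive_scale s (is_derive_coor v' j l))).
  by apply: is_derive_val; rewrite expr1.
apply: is_derive_val; rewrite (bigD1 j)//= eqxx mulr1 add0r big1 ?addr0; first by ring.
by move=> l lj; rewrite (negPf lj) mulr0 addr0 mulr0.
Qed.

Lemma is_derive_mehler j v' : is_derive v' (e_ j) (mehler h y v) (mehler h y v v' * dlog_mehler j v').
Proof.
have D1 : is_derive v' (e_ j) (fun v' => sqnorm (v - v')) (- 2 * (v ord0 j - v' ord0 j)).
  have D := is_derive_sq_shift (-1) v v' j.
  apply: (@is_derive_ext _ _ (fun v' : V => \sum_l (v ord0 l + -1 * v' ord0 l) ^+ 2)).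
    by move=> u; rewrite sqnormB; apply: eq_bigr => l _; rewrite mulN1r.
  by apply: is_derive_val D; ring.
have D2 : is_derive v' (e_ j) (fun v' => sqnorm (v + v')) (2 * (v ord0 j + v' ord0 j)).
  have D := is_derive_sq_shift 1 v v' j.
  apply: (@is_derive_ext _ _ (fun v' : V => \sum_l (v ord0 l + 1 * v' ord0 l) ^+ 2)).
    by move=> u; rewrite sqnormD; apply: eq_bigr => l _; rewrite mul1r.
  by apply: is_derive_val D; ring.
have := is_derive_exp (is_derive_sub (is_derive_opp (is_derive_mul D1 (is_derive_c v' (e_ j) (8 * y * h)^-1))) (is_derive_scale (y / (8 * h)) D2)).
apply: is_derive_val; rewrite /mehler /dlog_mehler; congr (_ * _); field.
by rewrite !gt_eqF.
Qed.

Lemma sC_mehler : sC (mehler h y v).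
Proof.
split=> //; first by exists 0%N, 1 => ? v'; rewrite expr0 mulr1 ger0_norm ?mehler_ge0// mehler_le1.
move=> _; apply: continuous_exp; apply: continuous_add; apply: continuous_opp.
  apply: continuous_mul; last exact: continuous_c.
  by apply: continuous_dot => j; under eq_fun do rewrite !mxE;
    (apply: continuous_add; first exact: continuous_c); apply: continuous_opp; exact: continuous_coor.
apply: continuous_mul; first exact: continuous_c.
by apply: continuous_dot => j; under eq_fun do rewrite !mxE;
  (apply: continuous_add; first exact: continuous_c); exact: continuous_coor.
Qed.

Lemma sC_c (c : R) : sC (fun _ : V => c). Proof. exact: slowC_cst. Qed.
Lemma sC_coor j : sC (fun v' : V => v' ord0 j). Proof. exact: slowC_coor. Qed.
Lemma sC_add (A B : V -> R) : sC A -> sC B -> sC (fun v => A v + B v).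
Proof. exact: slowC_add. Qed.
Lemma sC_mul (A B : V -> R) : sC A -> sC B -> sC (fun v => A v * B v).
Proof. exact: slowC_mul. Qed.
Lemma sC_opp (A : V -> R) : sC A -> sC (fun v => - A v).
Proof.
move=> sA; rewrite (_ : (fun v => - A v) = (fun v => -1 * A v)).
  by apply: sC_mul => //; exact: sC_c.
by apply/funext => u; rewrite mulN1r.
Qed.

Lemma sC_dlog_mehler j : sC (dlog_mehler j).
Proof.
apply: sC_add; last apply: sC_opp; apply: sC_mul; try exact: sC_c.
  by apply: sC_add; [exact: sC_c|apply: sC_opp; exact: sC_coor].
by apply: sC_mul; [exact: sC_c|apply: sC_add; [exact: sC_c|exact: sC_coor]].
Qed.

Definition ddlog_mehler : R := - ((4 * y * h)^-1 + y / (4 * h)).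

Lemma is_derive_dlog_mehler j v' : is_derive v' (e_ j) (dlog_mehler j) ddlog_mehler.
Proof.
have D1 := is_derive_mul (is_derive_sub (is_derive_c v' (e_ j) (v ord0 j)) (is_derive_coor_diag v' j)) (is_derive_c v' (e_ j) (4 * y * h)^-1).
have D2 := is_derive_mul (is_derive_scale y (is_derive_add (is_derive_c v' (e_ j) (v ord0 j)) (is_derive_coor_diag v' j))) (is_derive_c v' (e_ j) (4 * h)^-1).
have := is_derive_sub D1 D2; apply: is_derive_val; rewrite /ddlog_mehler; ring.
Qed.

Section first_order.
Variables (j : 'I_d) (f df ddf : V -> R).
Hypotheses (rf : rC f) (rdf : rC df) (rddf : rC ddf).
Hypotheses (Df : forall v, is_derive v (e_ j) f (df v)) (Ddf : forall v, is_derive v (e_ j) df (ddf v)).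

(** b_j f and its derivative along v_j, for f with derivatives df and ddf. *)
Definition b_fun (v' : V) : R := h * df v' + v' ord0 j / 2 * f v'.
Definition db_fun (v' : V) : R := h * ddf v' + (2^-1 * f v' + v' ord0 j / 2 * df v').

(** The affine factor that b_j^*, acting in v, brings down from the kernel. The
    v-derivative of T_y is known in the form [d_mehler_op], where it has been
    moved to the variable v', whence the coefficients [mehler_q], [mehler_s]. *)
Definition adj_factor (v' : V) : R := (2 * h * mehler_q h y + 2^-1) * v ord0 j + h * mehler_s y * dlog_mehler j v'.

Let sv2 : sC (fun v' : V => v' ord0 j / 2).
Proof. by apply: sC_mul; [exact: sC_coor|exact: sC_c]. Qed.

Lemma rC_b_fun : rC b_fun.
Proof. by apply: rC_add; [exact: rC_scale|exact: rC_mul]. Qed.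

Lemma rC_db_fun : rC db_fun.
Proof. by apply: rC_add; [exact: rC_scale|apply: rC_add; [exact: rC_scale|exact: rC_mul]]. Qed.

Lemma is_derive_b_fun v' : is_derive v' (e_ j) b_fun (db_fun v').
Proof.
have D := is_derive_mul (is_derive_mul (is_derive_coor_diag v' j) (is_derive_c v' (e_ j) (2^-1 : R))) (Df v').
have := is_derive_add (is_derive_scale h (Ddf v')) D.
by apply: is_derive_val; rewrite /db_fun; ring.
Qed.

Let rC_bdd_cont (g : V -> R) : rC g -> bdd_cont g. Proof. exact: rapid_bdd_cont. Qed.

Lemma mehler_op_mehler (g : V -> R) : rC g -> mehler_op h y g v = mehler_cst h y ^+ d * \int[leb d]_v' (mehler h y v v' * g v').
Proof.
move=> rg; rewrite (mehler_op_kernel h0 (rC_bdd_cont rg) (rC_integrable rg))//.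
rewrite -RintegralZl//; last exact: rC_integrable (rC_mul sC_mehler rg).
by apply: eq_Rintegral => v' _; rewrite mulrA.
Qed.

(** The value at v of b_j^* T_y b_j f. *)
Definition b_adj_mehler : R := - h * d_mehler_op h b_fun j y db_fun v + v ord0 j / 2 * mehler_op h y b_fun v.

(** Two integrations by parts in v'_j: the first removes the derivative of b_j f
    coming from [d_mehler_op], the second the one inside b_j f. The constant term
    comes from the derivative of [adj_factor]. *)
Lemma b_adj_mehler_kernel : b_adj_mehler = mehler_cst h y ^+ d * \int[leb d]_v' (mehler h y v v' *
  (adj_factor v' * (v' ord0 j / 2 - h * dlog_mehler j v') + h / 4 * (1 - y ^+ 2) / y) * f v').
Proof.
have rfb := rC_b_fun; have rdfb := rC_db_fun; have sM := sC_mehler.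
have sl := sC_dlog_mehler j.
have sMl : sC (fun v' => mehler h y v v' * dlog_mehler j v') by exact: sC_mul.
have sP : sC adj_factor.
  by apply: sC_add; [exact: sC_c|apply: sC_mul; [exact: sC_c|exact: sl]].
have sMP : sC (fun v' => mehler h y v v' * adj_factor v') by exact: sC_mul.
pose dMP v' := mehler h y v v' * dlog_mehler j v' * adj_factor v' + mehler h y v v' * (h * mehler_s y * ddlog_mehler).
have sdMP : sC dMP by apply: sC_add; apply: sC_mul => //; exact: sC_c.
have DMP v' : is_derive v' (e_ j) (fun v' => mehler h y v v' * adj_factor v') (dMP v').
  have DP := is_derive_add (is_derive_c v' (e_ j) ((2 * h * mehler_q h y + 2^-1) * v ord0 j)) (is_derive_scale (h * mehler_s y) (is_derive_dlog_mehler j v')).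
  have := is_derive_mul (is_derive_mehler j v') DP.
  by apply: is_derive_val; rewrite /dMP /adj_factor; ring.
(* I1 treats the derivative of b_j f, I2 the derivative of f inside b_j f. *)
have I1 := ibp (is_derive_mehler j) is_derive_b_fun sM sMl rfb rdfb.
have I2 := ibp DMP Df sMP sdMP rf rdf.
have -> : b_adj_mehler = mehler_cst h y ^+ d * \int[leb d]_v' (mehler h y v v' * adj_factor v' * b_fun v').
  rewrite /b_adj_mehler /d_mehler_op !mehler_op_mehler// I1.
  have -> : \int[leb d]_v' (mehler h y v v' * adj_factor v' * b_fun v') =
     ((2 * h * mehler_q h y + 2^-1) * v ord0 j) * \int[leb d]_v' (mehler h y v v' * b_fun v')
     + (h * mehler_s y) * \int[leb d]_v' (mehler h y v v' * dlog_mehler j v' * b_fun v').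
    rewrite -!RintegralZl//; try exact: rC_integrable (rC_mul _ rfb).
    rewrite -RintegralD//; try exact: rC_integrable (rC_scale _ (rC_mul _ rfb)).
    by apply: eq_Rintegral => v' _; rewrite /adj_factor; ring.
  by ring.
congr (_ * _).
transitivity (h * \int[leb d]_v' (mehler h y v v' * adj_factor v' * df v') + \int[leb d]_v' (mehler h y v v' * adj_factor v' * (v' ord0 j / 2) * f v')).
  rewrite -RintegralZl//; last exact: rC_integrable (rC_mul _ rdf).
  rewrite -RintegralD//; first by apply: eq_Rintegral => v' _; rewrite /b_fun; ring.
    exact: rC_integrable (rC_scale _ (rC_mul sMP rdf)).
  exact: rC_integrable (rC_mul (sC_mul sMP sv2) rf).
rewrite I2 mulrN -mulNr -RintegralZl//; last exact: rC_integrable (rC_mul sdMP rf).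
rewrite -RintegralD//; last 2 first.
- exact: rC_integrable (rC_scale _ (rC_mul sdMP rf)).
- exact: rC_integrable (rC_mul (sC_mul sMP sv2) rf).
apply: eq_Rintegral => v' _; rewrite mulrA -mulrDl; congr (_ * _).
rewrite /dMP; have -> : h * mehler_s y * ddlog_mehler = - ((1 - y ^+ 2) / y / 4).
  by rewrite /ddlog_mehler /mehler_s; field; rewrite y2_neq0 !gt_eqF.
by ring.
Qed.

(** With [b_factorE], the product of the two factors becomes a difference of
    squares. *)
Lemma adj_factorE v' : adj_factor v' = (1 + y) / 4 * ((v ord0 j + v' ord0 j) + (v ord0 j - v' ord0 j) / y).
Proof.
rewrite /adj_factor /dlog_mehler /mehler_q /mehler_s; field.
by rewrite y2_neq0 !gt_eqF.
Qed.

Lemma b_factorE (v' : V) : v' ord0 j / 2 - h * dlog_mehler j v' = (1 + y) / 4 * ((v ord0 j + v' ord0 j) - (v ord0 j - v' ord0 j) / y).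
Proof. by rewrite /dlog_mehler; field; rewrite !gt_eqF. Qed.

End first_order.

(** The logarithmic derivative in y of the full kernel. *)
Definition dy_log_ker (v' : V) : R := d%:R * ((1 + y)^-1 - (2 * y)^-1)
  + sqnorm (v - v') / (8 * y ^+ 2 * h) - sqnorm (v + v') / (8 * h).

Lemma sC_sqnorm (s : R) : sC (fun v' : V => sqnorm (v + s *: v')).
Proof.
suff H : forall r : seq 'I_d, sC (fun v' : V => \sum_(l <- r) (v ord0 l + s * v' ord0 l) * (v ord0 l + s * v' ord0 l)).
  have := H (index_enum 'I_d); congr (slowC 0 _); apply/funext => _; apply/funext => v'.
  by apply: eq_bigr => l _; rewrite !mxE.
elim=> [|l r IH].
  rewrite (_ : (fun _ => _) = fun=> 0); first exact: sC_c.
  by apply/funext => v'; rewrite big_nil.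
rewrite (_ : (fun _ => _) = fun v' : V => (v ord0 l + s * v' ord0 l) * (v ord0 l + s * v' ord0 l) + \sum_(l <- r) (v ord0 l + s * v' ord0 l) * (v ord0 l + s * v' ord0 l)).
  have sl : sC (fun v' : V => v ord0 l + s * v' ord0 l).
    by apply: sC_add; [exact: sC_c|apply: sC_mul; [exact: sC_c|exact: sC_coor]].
  by apply: sC_add => //; exact: sC_mul.
by apply/funext => v'; rewrite big_cons.
Qed.

Lemma sC_sqnormB : sC (fun v' : V => sqnorm (v - v')).
Proof.
have := sC_sqnorm (-1); congr (slowC 0 _); apply/funext => _; apply/funext => v'.
by rewrite scaleN1r.
Qed.

Lemma sC_sqnormD : sC (fun v' : V => sqnorm (v + v')).
Proof.
have := sC_sqnorm 1; congr (slowC 0 _); apply/funext => _; apply/funext => v'.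
by rewrite scale1r.
Qed.

Lemma sC_dy_log_ker : sC dy_log_ker.
Proof.
apply: sC_add; last apply: sC_opp; last by apply: sC_mul; [exact: sC_sqnormD|exact: sC_c].
by apply: sC_add; [exact: sC_c|apply: sC_mul; [exact: sC_sqnormB|exact: sC_c]].
Qed.

(** Summing over j the differences of squares from [adj_factorE] and [b_factorE]
    gives |v+v'|^2 - |v-v'|^2/y^2 up to constants, which is the quadratic part of
    [dy_log_ker]. *)
Lemma generator_kernel (f : V -> R) (df ddf : 'I_d -> V -> R) :
  rC f -> (forall j, rC (df j)) -> (forall j, rC (ddf j)) ->
  (forall j v, is_derive v (e_ j) f (df j v)) ->
  (forall j v, is_derive v (e_ j) (df j) (ddf j v)) ->
  2 / (1 + y) ^+ 2 * (\sum_j b_adj_mehler j f (df j) (ddf j)) =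
  - h * (mehler_cst h y ^+ d * \int[leb d]_v' (mehler h y v v' * dy_log_ker v' * f v')).
Proof.
move=> rf rdf rddf Df Ddf.
have E j : b_adj_mehler j f (df j) (ddf j) = mehler_cst h y ^+ d * \int[leb d]_v' (mehler h y v v' *
    (adj_factor j v' * (v' ord0 j / 2 - h * dlog_mehler j v') + h / 4 * (1 - y ^+ 2) / y) * f v').
  exact: b_adj_mehler_kernel.
under eq_bigr do rewrite E.
have sP j : sC (adj_factor j).
  by apply: sC_add; [exact: sC_c|apply: sC_mul; [exact: sC_c|exact: sC_dlog_mehler]].
have sA j : sC (fun v' => mehler h y v v' *
    (adj_factor j v' * (v' ord0 j / 2 - h * dlog_mehler j v') + h / 4 * (1 - y ^+ 2) / y)).
  apply: sC_mul; first exact: sC_mehler.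
  apply: sC_add; last exact: sC_c.
  apply: sC_mul => //; apply: sC_add; first by apply: sC_mul; [exact: sC_coor|exact: sC_c].
  by apply: sC_opp; apply: sC_mul; [exact: sC_c|exact: sC_dlog_mehler].
rewrite -mulr_sumr -(Rintegral_sum _ (fun j => rC_integrable (rC_mul (sA j) rf))).2.
rewrite mulrCA [RHS]mulrCA; congr (_ * _).
rewrite -!RintegralZl//; last 2 first.
- by apply: rC_integrable; apply: rC_mul => //; apply: sC_mul; [exact: sC_mehler|exact: sC_dy_log_ker].
- by apply: rC_integrable; apply: rC_sum => j; exact: rC_mul.
apply: eq_Rintegral => v' _; rewrite -mulr_suml -mulr_sumr.
have -> : \sum_j (adj_factor j v' * (v' ord0 j / 2 - h * dlog_mehler j v') + h / 4 * (1 - y ^+ 2) / y) =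
    (1 + y) ^+ 2 / 16 * (sqnorm (v + v') - sqnorm (v - v') / y ^+ 2) + d%:R * (h / 4 * (1 - y ^+ 2) / y).
  rewrite big_split /= sumr_const card_ord; congr (_ + _); last by rewrite mulr_natl.
  rewrite sqnormB sqnormD mulr_suml -sumrB mulr_sumr; apply: eq_bigr => j _.
  by rewrite adj_factorE b_factorE; field; rewrite gt_eqF.
rewrite /dy_log_ker; field.
by rewrite !gt_eqF ?addr_gt0.
Qed.

End fixed.

Lemma is_derive_mehler_cst (z : R) : 0 < z ->
  is_derive z (1 : R) (mehler_cst h) (mehler_cst h z * ((1 + z)^-1 - (2 * z)^-1)).
Proof.
move=> z0; have p0 : 0 < pi * h by rewrite mulr_gt0// pi_gt0.
have D1 := is_derive_mul (is_derive_add (is_derive_c z (1 : R) 1) (is_derive_id z (1 : R))) (is_derive_c z (1 : R) (2 * pi * h)^-1).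
have z20 : 2 * z != 0 by rewrite gt_eqF// mulr_gt0.
have D2 := is_derive_scale (pi * h) (is_derive_inv z20 (is_derive_scale 2 (is_derive_id z (1 : R)))).
have S0 : 0 < pi * h / (2 * z) by rewrite divr_gt0// mulr_gt0.
have D3 := @is_derive_chain R R Num.sqrt (fun z => pi * h / (2 * z)) z 1 _ _ (is_derive1_sqrt S0) D2.
have := is_derive_mul D1 D3; apply: is_derive_val.
rewrite /mehler_cst /=; set S := Num.sqrt _.
have S2 : S * S = pi * h / (2 * z) by rewrite -expr2 sqr_sqrtr// ltW.
have S00 : 0 < S by rewrite sqrtr_gt0.
have -> : (2 * S)^-1 * (pi * h * (- (2 * z) ^- 2 * (2 * 1))) = - (S / (2 * z)).
  have -> : pi * h * (- (2 * z) ^- 2 * (2 * 1)) = - (S * S / z).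
    by rewrite S2; field; rewrite gt_eqF.
  by field; rewrite !gt_eqF.
have pn : (pi : R) != 0 by rewrite gt_eqF// pi_gt0.
have hn : h != 0 by rewrite gt_eqF.
have zn : z != 0 by rewrite gt_eqF.
have z1n : 1 + z != 0 by rewrite gt_eqF// addr_gt0.
clear D1 D2 D3; clearbody S; move: pn; generalize (pi : R) => p pn.
by field; rewrite ?pn ?hn ?zn ?z1n.
Qed.

(** Differentiation of the kernel form under the integral, for z in
    ]y/2, 2y[ where the kernel and its y-derivative have uniform bounds. *)
Lemma is_derive_mehler_op_y (f : V -> R) (v : V) (y : R) : 0 < y -> rC f ->
  is_derive y (1 : R) (fun y => mehler_op h y f v)
    (mehler_cst h y ^+ d * \int[leb d]_v' (mehler h y v v' * dy_log_ker y v v' * f v')).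
Proof.
move=> y0 rf; have e0 : 0 < y / 2 by rewrite divr_gt0.
have yz z : `|z - y| < y / 2 -> 0 < z /\ (y / 2 < z < 2 * y).
  by rewrite ltr_distl => /andP[z1 z2]; split; [|apply/andP; split]; lra.
apply: (@near_eq_is_derive R R R (fun z => \int[leb d]_v' (mehler_ker h z v v' * f v'))).
  have : \forall z \near y, ball y (y / 2) z by exact: nbhsx_ballx.
  apply: filterS => z; rewrite /ball /= distrC => /yz[z0 _].
  by rewrite (mehler_op_kernel h0 (rapid_bdd_cont rf) (rC_integrable rf)).
pose dk z v' := mehler_cst h z ^+ d * (mehler h z v v' * dy_log_ker z v v' * f v').
have -> : mehler_cst h y ^+ d * \int[leb d]_v' (mehler h y v v' * dy_log_ker y v v' * f v') = \int[leb d]_v' dk y v'.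
  rewrite /dk RintegralZl//; apply: rC_integrable; apply: rC_mul => //.
  by apply: sC_mul; [exact: sC_mehler|exact: sC_dy_log_ker].
(* Bounds for the constant and for its logarithmic derivative, valid for z
   between y/2 and 2y. *)
pose BM := (1 + 2 * y) / (2 * pi * h) * Num.sqrt (pi * h / y).
pose pol v' := BM ^+ d * (d%:R * (1 + y^-1) + sqnorm (v - v') / (2 * y ^+ 2 * h) + sqnorm (v + v') / (8 * h)).
have p0 : 0 < (pi : R) by exact: pi_gt0.
have BM0 : 0 <= BM.
  by rewrite mulr_ge0 ?sqrtr_ge0// divr_ge0 ?addr_ge0 ?mulr_ge0 ?(ltW p0) ?(ltW h0) ?(ltW y0).
have pol0 v' : 0 <= pol v'.
  rewrite mulr_ge0 ?exprn_ge0// !addr_ge0 ?mulr_ge0 ?addr_ge0 ?invr_ge0 ?sqnorm_ge0// ?mulr_ge0 ?(ltW h0) ?(ltW y0) ?sqr_ge0//.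
have BkM z : 0 < z -> y / 2 < z < 2 * y -> 0 <= mehler_cst h z <= BM.
  move=> z0 /andP[z1 z2]; apply/andP; split.
    by rewrite mulr_ge0 ?sqrtr_ge0// divr_ge0 ?addr_ge0 ?mulr_ge0 ?(ltW p0) ?(ltW h0) ?(ltW z0).
  apply: ler_pM; rewrite ?sqrtr_ge0//.
  - by rewrite divr_ge0 ?addr_ge0 ?mulr_ge0 ?(ltW p0) ?(ltW h0) ?(ltW z0).
  - by rewrite ler_pM2r ?lerD2l ?(ltW z2)// invr_gt0 !mulr_gt0.
  - rewrite ler_sqrt ?divr_ge0 ?mulr_ge0 ?(ltW p0) ?(ltW h0) ?(ltW y0)//.
    rewrite ler_pM2l ?mulr_gt0// lef_pV2 ?posrE ?mulr_gt0//; lra.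
apply: (@is_derive_Rintegral R _ V (leb d) setT (fun z v' => mehler_ker h z v v' * f v') dk y (y / 2) (fun v' => `|pol v' * f v'|)) => //.
- move=> z /yz[z0 _]; apply: rC_integrable; apply: rC_mul => //.
  by apply: sC_mul; [exact: sC_c|exact: sC_mehler].
- move=> z v' _ /yz[z0 _].
  have DB := is_derive_pow d (is_derive_mehler_cst z0).
  have z80 : 8 * z * h != 0 by rewrite gt_eqF// !mulr_gt0.
  have Da : is_derive z (1 : R) (fun z : R => sqnorm (v - v') / (8 * z * h)) (- (sqnorm (v - v') / (8 * z ^+ 2 * h))).
    have := is_derive_scale (sqnorm (v - v')) (@is_derive_inv R R (fun z => 8 * z * h) z 1 _ z80 (is_derive_mul (is_derive_scale 8 (is_derive_id z (1 : R))) (is_derive_c z (1 : R) h))).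
    by apply: is_derive_val; field; rewrite !gt_eqF.
  have Db := is_derive_mul (is_derive_mul (is_derive_id z (1 : R)) (is_derive_c z (1 : R) (8 * h)^-1)) (is_derive_c z (1 : R) (sqnorm (v + v'))).
  have DM := is_derive_exp (is_derive_sub (is_derive_opp Da) Db).
  have := is_derive_mul (is_derive_mul DB DM) (is_derive_c z (1 : R) (f v')).
  apply: is_derive_val; rewrite /dk /mehler /dy_log_ker.
  have -> : forall c, d%:R * mehler_cst h z ^+ d.-1 * (mehler_cst h z * c) = mehler_cst h z ^+ d * (d%:R * c).
    by move=> c; case: (d) => [|k]; rewrite ?mul0r ?mulr0//= exprS; ring.
  by field; rewrite !gt_eqF ?addr_gt0.
- apply: integrable_norm; apply: rC_integrable; apply: rC_mul => //.
  apply: sC_mul; first exact: sC_c; apply: sC_add; first apply: sC_add; first exact: sC_c.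
    by apply: sC_mul; [exact: sC_sqnormB|exact: sC_c].
  by apply: sC_mul; [exact: sC_sqnormD|exact: sC_c].
- move=> z v' _ /yz[z0 z12]; have /andP[B0 B1] := BkM z z0 z12; have /andP[z1 z2] := z12.
  rewrite /dk mulrA !normrM; apply: ler_wpM2r => //.
  rewrite (ger0_norm (exprn_ge0 _ BM0)) (ger0_norm (exprn_ge0 _ B0)).
  apply: ler_pM.
  - exact: exprn_ge0.
  - by rewrite mulr_ge0.
  - by rewrite lerXn2r// nnegrE.
  rewrite (ger0_norm (mehler_ge0 _ _ _ _)).
  apply: (@le_trans _ _ `|dy_log_ker z v v'|); first by rewrite ler_piMl// mehler_le1.
  apply: le_trans _ (ler_norm _).
  apply: le_trans (ler_normB _ _) _; apply: lerD; last first.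
    by rewrite ger0_norm// divr_ge0 ?sqnorm_ge0// mulr_ge0// ltW.
  apply: le_trans (ler_normD _ _) _; apply: lerD.
    rewrite normrM ger0_norm// ler_wpM2l//; apply: le_trans (ler_normB _ _) _; apply: lerD.
      by rewrite ger0_norm ?invr_ge0 ?addr_ge0 ?(ltW z0)// invf_le1 ?lerDl ?addr_gt0// ltW.
    rewrite ger0_norm ?invr_ge0 ?mulr_ge0 ?(ltW z0)// lef_pV2 ?posrE ?mulr_gt0//; lra.
  rewrite ger0_norm; last by rewrite divr_ge0 ?sqnorm_ge0// !mulr_ge0 ?sqr_ge0// ltW.
  rewrite ler_wpM2l ?sqnorm_ge0// lef_pV2 ?posrE ?mulr_gt0 ?exprn_gt0// ler_pM2r//.
  nra.
Qed.

End generator_identity.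

(** * The factorization on a fibre *)

Section core.
Context {R : realType} (d : nat).
Notation leb := (lebesgue_rV R).
Notation mu := (@lebesgue_measure R).
Local Notation V := 'rV[R]_d.
Local Notation e_ j := (delta_mx ord0 j : 'rV[R]_d).
Variable (h : R).
Hypothesis h0 : 0 < h.

Local Notation rC g := (rapidC 0 (fun _ : unit => g)).

(** The weight 2/(1+y)^2 of T_y; the absolute value makes it continuous on the
    whole line. *)
Definition rho2 (y : R) : R := 2 / (1 + `|y|) ^+ 2.

(** The quantization of the symbol, acting on real functions. *)
Definition avg_op (w : V -> R) (v : V) : R := \int[mu]_y (I01 y * (rho2 y * mehler_op h y w v)).

Lemma continuous_rho2 : continuous rho2.
Proof.
apply: continuous_mul; first exact: continuous_c.
apply: continuous_inv; first by move=> y; rewrite expf_neq0// gt_eqF// ltr_pwDl.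
apply: continuous_pow; apply: continuous_add; first exact: continuous_c.
by move=> y; exact: norm_continuous.
Qed.

Lemma rho2_bound y : `|rho2 y| <= 2.
Proof.
rewrite /rho2 ger0_norm ?divr_ge0 ?exprn_ge0 ?addr_ge0//.
by rewrite ler_pdivrMr ?exprn_gt0 ?ltr_pwDl// ler_peMr// exprn_ege1// lerDl.
Qed.

Lemma integrable_I01_dom (f : R -> R) C : continuous f ->
  (forall y, 0 < y <= 1 -> `|f y| <= C) -> mu.-integrable setT (EFin \o (fun y => I01 y * f y)).
Proof.
move=> cf fC; apply: (le_integrable _ _ _ (integrableZl measurableT C integrable_I01)) => //.
  apply/measurable_EFinP; apply: measurable_funM; first exact: measurable_I01.
  exact: continuous_measurable_fun.
move=> y _ /=; rewrite lee_fin; apply: le_trans _ (ler_norm _).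
rewrite I01P; case: ifPn => [y01|_]; last by rewrite mul0r normr0 mulr0.
by rewrite mul1r mulr1; exact: fC.
Qed.

Lemma bounded_01 (f : R -> R) : continuous f -> exists2 C, 0 <= C & forall y, 0 < y <= 1 -> `|f y| <= C.
Proof.
move=> cf.
have [c c01 cP] := @EVT_max R (fun y => `|f y|) 0 1 ler01
  (continuous_subspaceT (continuous_chain (@norm_continuous _ R) cf)).
exists `|f c| => // y /andP[y0 y1]; apply: cP; by rewrite in_itv/= ltW.
Qed.

Lemma integrable_I01_cont (f : R -> R) : continuous f ->
  mu.-integrable setT (EFin \o (fun y => I01 y * f y)).
Proof. by move=> cf; have [C _ CH] := bounded_01 cf; exact: integrable_I01_dom cf CH. Qed.

(** [weyl_eval] in terms of the operators T_y: the factor (1+y)^d and the constant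
    of the Weyl quantization form the constant of the kernel. *)
Lemma weyl_avg_op (w : V -> R) v dl : rapidC (2 * d) (fun _ : unit => w) ->
  (((2 * pi * h) ^+ d)^-1) * (\int[leb d]_eta \int[leb d]_v'
    (cos (h^-1 * dot (v - v') eta + dl) * msym h (2^-1 *: (v + v'), eta) * w v')) =
  cos dl * avg_op w v.
Proof.
move=> rw; rewrite (weyl_eval h0 v dl rw).
have nw := rapid_bdd_cont rw; have iw : (leb d).-integrable setT (EFin \o w).
  have rw0 : rC w by split => //; [exact: rapid0 rw|exact: rapid_cont rw].
  exact: rC_integrable.
have p0 : 0 < 2 * pi * h by rewrite !mulr_gt0// pi_gt0.
have pd0 : (2 * pi * h) ^+ d != 0 by rewrite expf_neq0// gt_eqF.
have iE : mu.-integrable setT (EFin \o (fun y => I01 y * (rho2 y * mehler_op h y w v))).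
  by apply: integrable_I01_cont; apply: continuous_mul; [exact: continuous_rho2|exact: continuous_mehler_op].
transitivity ((((2 * pi * h) ^+ d)^-1) * \int[mu]_y (((2 * pi * h) ^+ d * cos dl) * (I01 y * (rho2 y * mehler_op h y w v)))).
  congr (_ * _); apply: eq_Rintegral => y _.
  rewrite /rho01 I01P; case: ifPn => [/andP[y0 y1]|_]; last by rewrite !mul0r !mulr0.
  have rw0 : rC w by split => //; [exact: rapid0 rw|exact: rapid_cont rw].
  rewrite (mehler_op_mehler h0 v y0 rw0) /mehler_cst /rho2 (ger0_norm (ltW y0)) [(_ / _ * _) ^+ d]exprMn [(_ / _) ^+ d]expr_div_n.
  have y1n : (1 + y) ^+ 2 != 0 by rewrite expf_neq0// gt_eqF// addr_gt0.
  move: pd0; set P := (2 * pi * h) ^+ d; set A := (1 + y) ^+ d; set Q := (1 + y) ^+ 2 in y1n *.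
  set S := _ ^+ d; set I := \int[_]_v' _ => pd0; clearbody P A Q S I.
  by field; rewrite pd0.
by rewrite RintegralZl// mulrA mulKf.
Qed.

Lemma mehler_op_bound (w : V -> R) C : bdd_cont w -> (forall v, `|w v| <= C) ->
  exists2 D, 0 <= D & forall y v, 0 < y <= 1 -> `|mehler_op h y w v| <= D.
Proof.
move=> nw wC; have [K K0 KH] := bounded_01 (continuous_pow (n:=d) (@continuous_mehler_c R)).
have C0 : 0 <= C by exact: le_trans (wC 0).
exists (K * C); first exact: mulr_ge0.
move=> y v /[dup] /andP[y0 y1] y01; rewrite /mehler_op -mulrA normrM; apply: ler_pM => //; first exact: KH.
rewrite normrM (ger0_norm (expR_ge0 _)); apply: le_trans (gauss_avg_bound h nw y v wC).
rewrite ler_piMl// -expR0 ler_expR oppr_le0 mulr_ge0 ?sqnorm_ge0//.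
by rewrite divr_ge0 ?(ltW y0)// !mulr_ge0 ?(ltW h0)// ltW// y2_gt0.
Qed.

Lemma continuous_d_mehler_op (j : 'I_d) (w dw : V -> R) v : bdd_cont w -> bdd_cont dw -> continuous (fun y => d_mehler_op h w j y dw v).
Proof.
move=> nw ndw; apply: continuous_add; apply: continuous_mul; try exact: continuous_mehler_op.
  apply: continuous_opp; apply: continuous_mul; last exact: continuous_c.
  by apply: continuous_mul; [exact: continuous_c|exact: continuous_mehler_q].
exact: continuous_mehler_s.
Qed.

Lemma is_derive_I01 (A dA : R -> R -> R) a B : (forall t, continuous (A t)) ->
  (forall t y, is_derive t (1 : R) (fun t => A t y) (dA t y)) ->
  (forall t y, `|t - a| < 1 -> 0 < y <= 1 -> `|dA t y| <= B) ->
  is_derive a (1 : R) (fun t => \int[mu]_y (I01 y * A t y)) (\int[mu]_y (I01 y * dA a y)).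
Proof.
move=> cA DA BA.
apply: (@is_derive_Rintegral R _ (measurableTypeR R) mu setT
  (fun t y => I01 y * A t y) (fun t y => I01 y * dA t y) a 1 (fun y => B * I01 y)).
- exact: measurableT.
- exact: ltr01.
- by move=> t _; exact: integrable_I01_cont.
- exact: (integrableZl measurableT B integrable_I01).
- move=> t y _ ta; rewrite I01P; case: ifPn => [y01|_]; last by rewrite mul0r normr0 mulr0.
  by rewrite mul1r mulr1; exact: BA.
Qed.

Lemma is_derive_avg_op (j : 'I_d) (w dw : V -> R) v : bdd_cont w -> bdd_cont dw ->
  (forall v, is_derive v (e_ j) w (dw v)) ->
  is_derive v (e_ j) (avg_op w) (\int[mu]_y (I01 y * (rho2 y * d_mehler_op h w j y dw v))).
Proof.
move=> nw ndw Dw; apply/is_deriveP.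
have [_ [C wC]] := nw; have [_ [C' dwC]] := ndw.
have [D D0 DH] := mehler_op_bound nw wC; have [D' D0' DH'] := mehler_op_bound ndw dwC.
have [Q Q0 QH] := bounded_01 (continuous_mehler_q h0); have [S S0 SH] := bounded_01 (@continuous_mehler_s R).
pose B := 2 * (2 * Q * (`|v ord0 j| + 1) * D + S * D').
have -> : \int[mu]_y (I01 y * (rho2 y * d_mehler_op h w j y dw v)) = \int[mu]_y (I01 y * (rho2 y * d_mehler_op h w j y dw (v + 0 *: e_ j))).
  by rewrite scale0r addr0.
apply: (@is_derive_I01 (fun t y => rho2 y * mehler_op h y w (v + t *: e_ j))
  (fun t y => rho2 y * d_mehler_op h w j y dw (v + t *: e_ j)) 0 B).
- by move=> t; apply: continuous_mul; [exact: continuous_rho2|exact: continuous_mehler_op].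
- move=> t y; apply: is_derive_scale.
  by apply: is_derive_line; apply: is_derive_mehler_op.
- move=> t y; rewrite subr0 => t1 y01.
  rewrite normrM /B; rewrite /d_mehler_op; apply: ler_pM; [exact: normr_ge0|exact: normr_ge0|exact: rho2_bound|].
  apply: le_trans (ler_normD _ _) _; apply: lerD; last first.
    by rewrite normrM; apply: ler_pM; [exact: normr_ge0|exact: normr_ge0|exact: SH|exact: DH'].
  rewrite normrM normrN; apply: ler_pM; [exact: normr_ge0|exact: normr_ge0| |exact: DH].
  rewrite normrM; apply: ler_pM; [exact: normr_ge0|exact: normr_ge0| |].
    by rewrite normrM (ger0_norm (ler0n _ 2)) ler_wpM2l//; exact: QH.
  by rewrite !mxE !eqxx mulr1; apply: le_trans (ler_normD _ _) _; rewrite lerD2l ltW.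
Qed.

Lemma mehler_op_at0 (w : V -> R) v : mehler_op h 0 w v = w v.
Proof.
rewrite /mehler_op /gauss_avg /mehler_c /mehler_q /mehler_s /mehler_sg expr0n/= !mulr0 !mul0r !addr0 subr0 sqrtr1 oppr0 expR0.
rewrite !divr1 expr1n !mul1r sqrtr0.
under eq_Rintegral do rewrite scale1r scale0r addr0.
rewrite RintegralZl; [|exact: measurableT|exact: integrable_stdgauss].
rewrite mulrCA.
by rewrite [X in _ * X = _](stdgauss_cst_stdgauss d) mulr1.
Qed.

(** At y = 1 the exponents -|v-v'|^2/8h - |v+v'|^2/8h add up to
    -|v|^2/4h - |v'|^2/4h: the kernel splits and T_1 is the projection. *)
Lemma mehler_op_at1 (w : V -> R) v : bdd_cont w -> (leb d).-integrable setT (EFin \o w) ->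
  mehler_op h 1 w v = mu_h h v * \int[leb d]_v' (w v' * mu_h h v').
Proof.
move=> nw iw; rewrite (mehler_op_kernel h0 nw iw v ltr01).
have a0 : 0 < 2 * pi * h by rewrite !mulr_gt0// pi_gt0.
have s0 : 0 < Num.sqrt (2 * pi * h) by rewrite sqrtr_gt0.
have BkE : mehler_cst h 1 = (Num.sqrt (2 * pi * h))^-1.
  rewrite /mehler_cst; have p0 : 0 < (pi : R) by exact: pi_gt0.
  have -> : pi * h / (2 * 1) = (2 * pi * h) * (2^-1) ^+ 2.
    by rewrite mulr1; move: (pi : R) => p; field.
  rewrite sqrtrM ?(ltW a0)// sqrtr_sqr ger0_norm//.
  have S2 : Num.sqrt (2 * pi * h) * Num.sqrt (2 * pi * h) = 2 * pi * h.
    by rewrite -expr2 sqr_sqrtr// ltW.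
  move: s0 S2; set S := Num.sqrt _ => s0 S2; rewrite -S2; clearbody S.
  by field; rewrite gt_eqF.
have muE (u : V) : mu_h h u = (2 * pi * h) `^ (- (d%:R / 4)) * expR (- (sqnorm u / (4 * h))) by [].
have cE2 : (2 * pi * h) `^ (- (d%:R / 4)) * (2 * pi * h) `^ (- (d%:R / 4)) = mehler_cst h 1 ^+ d.
  rewrite -powRD; last by rewrite (gt_eqF a0) implybT.
  have -> : - (d%:R / 4) + - (d%:R / 4) = 2^-1 * - d%:R :> R by field.
  by rewrite powRrM powR12_sqrt ?(ltW a0)// powRN powR_mulrn ?sqrtr_ge0// BkE exprVn.
have i2 : (leb d).-integrable setT (EFin \o (fun v' => w v' * mu_h h v')).
  have := integrable_mehler h0 iw (0 : V) ltr01.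
  move=> /(integrableZl measurableT ((2 * pi * h) `^ (- (d%:R / 4)))).
  apply: eq_integrable => // v' _ /=; congr EFin; 
  rewrite muE [RHS]mulrCA [X in _ = _ * X]mulrC; congr (_ * (_ * _)).
  rewrite /mehler; congr expR.
  rewrite (_ : sqnorm (0 - v') = sqnorm v'); last by rewrite sub0r /sqnorm dotNl dotNr opprK.
  by rewrite add0r; field; rewrite gt_eqF.
rewrite -RintegralZl//; apply: eq_Rintegral => v' _.
rewrite /mehler_ker !muE -cE2.
have -> : mehler h 1 v v' = expR (- (sqnorm v / (4 * h))) * expR (- (sqnorm v' / (4 * h))).
  rewrite /mehler -expRD; congr expR.
  rewrite /sqnorm !(dotDl, dotDr, dotNl, dotNr) (dotC v' v).
  by field; rewrite gt_eqF.
by ring.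
Qed.

(** The sum over j is an integral over y of the generator identity, that is, of the
    derivative of - h T_y f; the values at 1 and 0 are the projection and f. *)
Lemma core_identity (f : V -> R) (df ddf : 'I_d -> V -> R) v :
  rC f -> (forall j, rC (df j)) -> (forall j, rC (ddf j)) ->
  (forall j v, is_derive v (e_ j) f (df j v)) ->
  (forall j v, is_derive v (e_ j) (df j) (ddf j v)) ->
  \sum_j (- h * (\int[mu]_y (I01 y * (rho2 y * d_mehler_op h (b_fun h j f (df j)) j y (db_fun h j f (df j) (ddf j)) v)))
     + v ord0 j / 2 * avg_op (b_fun h j f (df j)) v) =
  h * (f v - mu_h h v * \int[leb d]_v' (f v' * mu_h h v')).
Proof.
move=> rf rdf rddf Df Ddf.
pose g j := b_fun h j f (df j); pose dg j := db_fun h j f (df j) (ddf j).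
have ng j : bdd_cont (g j) by apply: rapid_bdd_cont; exact: rC_b_fun.
have ndg j : bdd_cont (dg j) by apply: rapid_bdd_cont; exact: rC_db_fun.
have nf : bdd_cont f by exact: rapid_bdd_cont rf.
pose S y := rho2 y * \sum_j b_adj_mehler h y v j f (df j) (ddf j).
have cX j : continuous (fun y => b_adj_mehler h y v j f (df j) (ddf j)).
  apply: continuous_add; apply: continuous_mul; try exact: continuous_c.
    by apply: continuous_d_mehler_op; [exact: (ng j)|exact: (ndg j)].
  by apply: (continuous_mehler_op h0); exact: (ng j).
have cS : continuous S by apply: continuous_mul; [exact: continuous_rho2|exact: continuous_sum].
have iS : mu.-integrable setT (EFin \o (fun y => I01 y * S y)) by exact: integrable_I01_cont.
have iZ k (u : R -> R) : continuous u -> mu.-integrable setT (EFin \o (fun y => k * (I01 y * u y))).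
  by move=> cu; exact: (integrableZl measurableT k (integrable_I01_cont cu)).
transitivity (\int[mu]_y (I01 y * S y)).
  have iX j : mu.-integrable setT (EFin \o (fun y => I01 y * (rho2 y * b_adj_mehler h y v j f (df j) (ddf j)))).
    by apply: integrable_I01_cont; apply: continuous_mul; [exact: continuous_rho2|].
  have -> : \int[mu]_y (I01 y * S y) = \int[mu]_y \sum_j (I01 y * (rho2 y * b_adj_mehler h y v j f (df j) (ddf j))).
    by apply: eq_Rintegral => y _; rewrite /S !mulr_sumr.
  rewrite (Rintegral_sum _ iX).2; apply: eq_bigr => j _.
  rewrite /avg_op -!RintegralZl//; last 2 first.
  - by apply: integrable_I01_cont; apply: continuous_mul; [exact: continuous_rho2|apply: continuous_d_mehler_op; [exact: (ng j)|exact: (ndg j)]].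
  - by apply: integrable_I01_cont; apply: continuous_mul; [exact: continuous_rho2|apply: (continuous_mehler_op h0); exact: (ng j)].
  rewrite -RintegralD//; last 2 first.
  - apply: iZ; apply: continuous_mul; first exact: continuous_rho2.
    by apply: continuous_d_mehler_op; [exact: (ng j)|exact: (ndg j)].
  - apply: iZ; apply: continuous_mul; first exact: continuous_rho2.
    by apply: (continuous_mehler_op h0); exact: (ng j).
  by apply: eq_Rintegral => y _; rewrite /b_adj_mehler; ring.
rewrite -Rintegral_I01 Rintegral_itv_obnd_cbnd; last first.
  apply/integrable_mkcond; first exact: measurable_itv.
  move: iS; apply: eq_integrable => // y _ /=.
  by rewrite patchE /I01 indicE; case: ifPn => _; rewrite ?mul1r ?mul0r.
(* The generator identity says that S is the y-derivative of F. *)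
pose F (y : R) : R := - h * mehler_op h y f v.
have DF (y : R) : 0 < y -> is_derive y (1 : R) F (S y).
  move=> y0; have := is_derive_scale (- h) (is_derive_mehler_op_y h0 v y0 rf).
  apply: is_derive_val; rewrite /S /rho2 (ger0_norm (ltW y0)).
  by rewrite -(generator_kernel h0 v y0 rf rdf rddf Df Ddf).
have cF : continuous F by apply: continuous_mul; [exact: continuous_c|exact: continuous_mehler_op].
suff -> : \int[mu]_(x in `[0, 1]) S x = F 1 - F 0.
  by rewrite /F mehler_op_at0 mehler_op_at1//; [ring|exact: rC_integrable].
rewrite /Rintegral (@continuous_FTC2 R S F 0 1 ltr01)//.
- exact: continuous_subspaceT.
- split.
  + by move=> y /[!in_itv]/= /andP[y0 _]; have [] := DF y y0.
  + by apply: cvg_at_right_filter; exact: cF.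
  + by apply: cvg_at_left_filter; exact: cF.
- by move=> y /[!in_itv]/= /andP[y0 _]; rewrite derive1E; have [] := DF y y0.
Qed.

End core.

(** * Symmetry of mixed derivatives and slices of Schwartz functions *)

Section clairaut.
Context {R : realType} {W : normedModType R}.

Lemma mvt_from0 (g dg : R -> R) (e : R) : 0 < e ->
  (forall t, is_derive t (1 : R) g (dg t)) ->
  exists2 c, 0 < c < e & g e - g 0 = dg c * e.
Proof.
move=> e0 Dg.
have cg : continuous g.
  by move=> t; apply: differentiable_continuous; apply/derivable1_diffP; have [] := Dg t.
have [c ce E] := @MVT R g dg 0 e e0 (fun t _ => Dg t) (continuous_subspaceT cg).
by exists c; [move: ce; rewrite in_itv|rewrite E subr0].
Qed.

(** The mean value theorem in the direction a, then in the direction b. *)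
Lemma second_difference (F Fa Fba : W -> R) (a b z : W) (e : R) : 0 < e ->
  (forall z, is_derive z a F (Fa z)) -> (forall z, is_derive z b Fa (Fba z)) ->
  exists c t, [/\ 0 < c < e, 0 < t < e &
    F (z + e *: a + e *: b) - F (z + e *: a) - (F (z + e *: b) - F z) =
    Fba (z + c *: a + t *: b) * e * e].
Proof.
move=> e0 Da Db.
pose g s := F (z + e *: b + s *: a) - F (z + s *: a).
pose dg s := Fa (z + e *: b + s *: a) - Fa (z + s *: a).
have Dg s : is_derive s (1 : R) g (dg s).
  by apply: is_derive_sub; apply: is_derive_line; exact: Da.
have [c ce E1] := mvt_from0 e0 Dg.
have Dk t : is_derive t (1 : R) (fun t => Fa (z + c *: a + t *: b)) (Fba (z + c *: a + t *: b)).
  by apply: is_derive_line; exact: Db.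
have [t te E2] := mvt_from0 e0 Dk.
exists c, t; split => //; rewrite -E2 scale0r addr0.
move: E1; rewrite /g /dg scale0r !addr0 => E1.
by rewrite [z + e *: a + _]addrAC E1 [z + c *: a + _]addrAC.
Qed.

(** Both mixed derivatives are limits of the same second difference quotient. *)
Lemma clairaut (F Fa Fb Fab Fba : W -> R) (a b : W) :
  (forall z, is_derive z a F (Fa z)) -> (forall z, is_derive z b F (Fb z)) ->
  (forall z, is_derive z b Fa (Fba z)) -> (forall z, is_derive z a Fb (Fab z)) ->
  continuous Fab -> continuous Fba -> Fab =1 Fba.
Proof.
move=> Da Db Dba Dab cab cba z.
apply/eqP; rewrite -subr_eq0 -normr_eq0 eq_le normr_ge0 andbT.
apply/ler_addgt0Pr => eps eps0; rewrite add0r.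
have e2 : 0 < eps / 2 by rewrite divr_gt0.
have /nbhs_ballP[d1 /= d10 H1] : \forall y \near z, `|Fab z - Fab y| < eps / 2.
  by have /cvgrPdist_lt := cab z; exact.
have /nbhs_ballP[d2 /= d20 H2] : \forall y \near z, `|Fba z - Fba y| < eps / 2.
  by have /cvgrPdist_lt := cba z; exact.
have ab0 : 0 < `|a| + `|b| + 1 by rewrite ltr_wpDl// addr_ge0.
(* All intermediate points of both second differences lie within e (|a| + |b|)
   of z, hence in both balls. *)
pose e := Num.min d1 d2 / (`|a| + `|b| + 1).
have m0 : 0 < Num.min d1 d2 by rewrite lt_min d10.
have e0 : 0 < e by rewrite divr_gt0.
have near_z s t : 0 < s < e -> 0 < t < e -> `|z - (z + s *: a + t *: b)| < Num.min d1 d2.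
  move=> /andP[s0 se] /andP[t0 te]; rewrite -addrA opprD addNKr normrN.
  apply: le_lt_trans (ler_normD _ _) _; rewrite !normrZ (gtr0_norm s0) (gtr0_norm t0).
  rewrite -[ltRHS](@divfK _ (`|a| + `|b| + 1)) ?gt_eqF// -/e.
  have := ler_wpM2r (normr_ge0 a) (ltW se); have := ler_wpM2r (normr_ge0 b) (ltW te).
  by move: e0; rewrite mulrDr mulr1 mulrDr; lra.
have [c [t [ce te E1]]] := second_difference z e0 Da Dba.
have [c' [t' [ce' te' E2]]] := second_difference z e0 Db Dab.
have E : Fba (z + c *: a + t *: b) = Fab (z + c' *: b + t' *: a).
  apply: (@mulIf _ e); first by rewrite gt_eqF.
  apply: (@mulIf _ e); first by rewrite gt_eqF.
  rewrite -E1 -E2 [z + e *: b + _]addrAC; ring.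
have n1 : `|Fab z - Fab (z + c' *: b + t' *: a)| < eps / 2.
  by apply: H1; rewrite -ball_normE /ball_ /= [z + c' *: b + _]addrAC; apply: lt_le_trans (near_z _ _ te' ce') _; rewrite ge_min lexx.
have n2 : `|Fba z - Fba (z + c *: a + t *: b)| < eps / 2.
  by apply: H2; rewrite -ball_normE /ball_ /=; apply: lt_le_trans (near_z _ _ ce te) _; rewrite ge_min lexx orbT.
rewrite E in n2; set m := Fab (z + _ + _) in n1 n2.
have -> : Fab z - Fba z = (Fab z - m) - (Fba z - m) by ring.
by apply: le_trans (ler_normB _ _) _; rewrite [leRHS]splitr; apply: lerD; exact: ltW.
Qed.

End clairaut.

Section partials.
Context {R : realType} {d : nat}.
Local Notation V := 'rV[R]_d.
Notation Re := complex.Re.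
Notation Im := complex.Im.
Implicit Types (f : V * V -> R[i]) (s t : seq ('I_d + 'I_d)).

Lemma smooth_Re f s i z : smooth f ->
  is_derive z (dir R i) (fun y => Re (partials s f y)) (Re (partials (i :: s) f z)).
Proof.
by move=> /(_ s)[_ _ /(_ i z)[D _]]; apply: DeriveDef.
Qed.

Lemma smooth_Im f s i z : smooth f ->
  is_derive z (dir R i) (fun y => Im (partials s f y)) (Im (partials (i :: s) f z)).
Proof.
by move=> /(_ s)[_ _ /(_ i z)[_ D]]; apply: DeriveDef.
Qed.

Lemma complex_ext (a b : R[i]) : Re a = Re b -> Im a = Im b -> a = b.
Proof. by case: a b => ? ? [? ?] /= -> ->. Qed.

Lemma partials_swap f i j s : smooth f ->
  partials [:: i, j & s] f = partials [:: j, i & s] f.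
Proof.
move=> sf; apply/funext => z.
have cRe s' : continuous (fun y => Re (partials s' f y)) by have [] := sf s'.
have cIm s' : continuous (fun y => Im (partials s' f y)) by have [] := sf s'.
suff [E1 E2] : Re (partials [:: i, j & s] f z) = Re (partials [:: j, i & s] f z) /\
    Im (partials [:: i, j & s] f z) = Im (partials [:: j, i & s] f z).
  exact: complex_ext.
split; apply/esym.
- exact: (@clairaut R _ (fun y => Re (partials s f y)) (fun y => Re (partials (j :: s) f y))
    (fun y => Re (partials (i :: s) f y)) (fun y => Re (partials [:: j, i & s] f y))
    (fun y => Re (partials [:: i, j & s] f y)) (dir R j) (dir R i)
    (fun z => smooth_Re s j z sf) (fun z => smooth_Re s i z sf)
    (fun z => smooth_Re (j :: s) i z sf) (fun z => smooth_Re (i :: s) j z sf)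
    (cRe [:: j, i & s]) (cRe [:: i, j & s]) z).
- exact: (@clairaut R _ (fun y => Im (partials s f y)) (fun y => Im (partials (j :: s) f y))
    (fun y => Im (partials (i :: s) f y)) (fun y => Im (partials [:: j, i & s] f y))
    (fun y => Im (partials [:: i, j & s] f y)) (dir R j) (dir R i)
    (fun z => smooth_Im s j z sf) (fun z => smooth_Im s i z sf)
    (fun z => smooth_Im (j :: s) i z sf) (fun z => smooth_Im (i :: s) j z sf)
    (cIm [:: j, i & s]) (cIm [:: i, j & s]) z).
Qed.

(** Bring the first direction of one list to the front of the other by adjacent
    exchanges. *)
Lemma partials_perm f s t : smooth f -> perm_eq s t -> partials s f = partials t f.
Proof.
move=> sf; have rem_front i u : i \in u -> partials u f = partials (i :: rem i u) f.
  elim: u => // j u IH; rewrite inE /=; case: eqVneq => [-> //|ij] /= iu.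
  rewrite (IH iu).
  exact: (partials_swap j i (rem i u) sf).
elim: s t => [|i s IH] t st; first by move: st; rewrite perm_sym => /perm_nilP ->.
have it : i \in t by rewrite -(perm_mem st) mem_head.
rewrite (rem_front _ _ it) /=; congr partial; apply: IH.
by rewrite -(perm_cons i) (perm_trans st)// perm_to_rem.
Qed.

(** The multi-index counts the occurrences of each direction. *)
Lemma partials_mpartial f s : smooth f ->
  exists alpha : multi_index d, partials s f = mpartial alpha f.
Proof.
move=> sf; exists [ffun i => count_mem i s]; apply: partials_perm => //.
apply/allP => i _; apply/eqP; rewrite count_flatten -map_comp sumnE big_map.
rewrite (bigD1_seq i) ?mem_enum ?enum_uniq//= count_nseq /= eqxx mul1n ffunE.
by rewrite big1 ?addn0// => k ki; rewrite count_nseq /= (negbTE ki).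
Qed.

(** Modelled on the real, or the imaginary, parts of all iterated derivatives of a
    Schwartz function, so that the two can be treated by the same lemmas. *)
Definition schwartz_family (G : seq ('I_d + 'I_d) -> V * V -> R) :=
  [/\ forall s, continuous (G s),
      forall s i z, is_derive z (dir R i) (G s) (G (i :: s) z) &
      forall s N, exists C, forall z, jap z ^+ N * `|G s z| <= C].

Lemma normc_ge_Re (x : R[i]) : `|Re x| <= normc x.
Proof. by case: x => a b /=; rewrite -sqrtr_sqr ler_wsqrtr// lerDl sqr_ge0. Qed.

Lemma normc_ge_Im (x : R[i]) : `|Im x| <= normc x.
Proof. by case: x => a b /=; rewrite -sqrtr_sqr ler_wsqrtr// lerDr sqr_ge0. Qed.

Lemma schwartz_bound f s N : schwartz f -> exists C, forall z,
  jap z ^+ N * normc (partials s f z) <= C.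
Proof.
by move=> [sf bf]; have [alpha ->] := partials_mpartial s sf; exact: bf.
Qed.

Lemma schwartz_Re f : schwartz f -> schwartz_family (fun s z => Re (partials s f z)).
Proof.
move=> sf; split; first by move=> s; have [] := sf.1 s.
  by move=> s i z; apply: smooth_Re; case: sf.
move=> s N; have [C CH] := schwartz_bound s N sf; exists C => z.
apply: le_trans (CH z); apply: ler_wpM2l; last exact: normc_ge_Re.
by rewrite exprn_ge0// sqrtr_ge0.
Qed.

Lemma schwartz_Im f : schwartz f -> schwartz_family (fun s z => Im (partials s f z)).
Proof.
move=> sf; split; first by move=> s; have [] := sf.1 s.
  by move=> s i z; apply: smooth_Im; case: sf.
move=> s N; have [C CH] := schwartz_bound s N sf; exists C => z.
apply: le_trans (CH z); apply: ler_wpM2l; last exact: normc_ge_Im.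
by rewrite exprn_ge0// sqrtr_ge0.
Qed.

Lemma jap_sqr (z : V * V) : jap z ^+ 2 = 1 + sqnorm z.1 + sqnorm z.2.
Proof. by rewrite sqr_sqrtr// !addr_ge0 ?sqnorm_ge0. Qed.

Lemma jap2_ge1 (z : V * V) : 1 + sqnorm z.1 <= jap z ^+ 2.
Proof. by rewrite jap_sqr lerDl sqnorm_ge0. Qed.

Lemma jap2_ge2 (z : V * V) : 1 + sqnorm z.2 <= jap z ^+ 2.
Proof. by rewrite jap_sqr -addrA lerD2l lerDr sqnorm_ge0. Qed.

Lemma dir_line (x v : V) j (t : R) :
  (x, v) + t *: dir R (inr j : 'I_d + 'I_d) = (x, v + t *: delta_mx ord0 j).
Proof. by rewrite (_ : (x, v) + _ = (x + t *: 0, v + t *: delta_mx ord0 j))// scaler0 addr0. Qed.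

Lemma is_derive_slice (g : V * V -> R) (x v : V) j dg :
  is_derive (x, v) (dir R (inr j : 'I_d + 'I_d)) g dg ->
  is_derive v (delta_mx ord0 j : V) (fun v => g (x, v)) dg.
Proof.
move=> /is_deriveP D; apply/is_deriveP; apply: is_derive_ext D => t.
by rewrite dir_line.
Qed.

Lemma continuous_slice (g : V * V -> R) (x : V) : continuous g -> continuous (fun v => g (x, v)).
Proof.
move=> cg v; apply: (@continuous_comp _ _ _ (fun v => (x, v)) g); last exact: cg.
by apply: (@cvg_pair _ _ _ (nbhs v) (nbhs x) (nbhs v)) => //=; exact: cvg_cst.
Qed.

(** The directions of the fibre are among those of the whole space, and the weight
    of the whole space dominates that of the fibre. *)
Lemma rapid_slice G k s x : schwartz_family G -> rapidC k (fun _ : unit => fun v => G s (x, v)).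
Proof.
move=> [cG DG bG].
have rG s' : rapid (fun _ : unit => fun v => G s' (x, v)).
  move=> N; have [C CH] := bG s' (2 * N)%N; exists C => _ v.
  apply: le_trans (CH (x, v)); apply: ler_wpM2r => //; rewrite exprM.
  by apply: lerXn2r; rewrite ?nnegrE ?addr_ge0 ?sqnorm_ge0 ?sqr_ge0// (jap2_ge2 (x, v)).
elim: k s => [|k IH] s; split; try exact: rG; try (by move=> _; exact: continuous_slice).
  by [].
exists (fun j _ v => G (inr j :: s) (x, v)); split; last by move=> j; exact: IH.
by move=> j _ v; apply: is_derive_slice; exact: DG.
Qed.

(** The power jap^(4d) dominates (1+|x|^2)^d (1+|v|^2)^d. *)
Lemma schwartz_family_wt G s : schwartz_family G ->
  exists2 C, 0 <= C & forall x v, `|G s (x, v)| <= (C * wt x) * wt v.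
Proof.
move=> [_ _ bG]; have [C CH] := bG s (4 * d)%N.
have C0 : 0 <= C by apply: le_trans (CH 0); rewrite mulr_ge0// exprn_ge0// sqrtr_ge0.
exists C => // x v; rewrite -mulrA mulrC.
have w0 : 0 <= wt x * wt v by rewrite mulr_ge0// ltW// wt_gt0.
apply: le_trans (ler_wpM2l w0 (CH (x, v))); rewrite mulrA; apply: ler_peMl => //.
rewrite (_ : (4 * d)%N = 2 * d + 2 * d)%N; last by rewrite -mulnDl.
rewrite exprD !exprM mulrACA; apply: mulr_ege1.
  apply: le_trans (wt_ge x) _; apply: ler_wpM2l; first exact/ltW/wt_gt0.
  by apply: lerXn2r; rewrite ?nnegrE ?addr_ge0 ?sqnorm_ge0 ?sqr_ge0// (jap2_ge1 (x, v)).
apply: le_trans (wt_ge v) _; apply: ler_wpM2l; first exact/ltW/wt_gt0.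
by apply: lerXn2r; rewrite ?nnegrE ?addr_ge0 ?sqnorm_ge0 ?sqr_ge0// (jap2_ge2 (x, v)).
Qed.

End partials.

(** * The triple composition on Schwartz functions *)

Section weyl_assembly.
Local Open Scope complex_scope.
Local Open Scope ring_scope.
Context {R : realType} (d : nat).
Notation leb := (lebesgue_rV R).
Notation mu := (@lebesgue_measure R).
Notation Re := complex.Re.
Notation Im := complex.Im.
Local Notation V := 'rV[R]_d.
Local Notation e_ j := (delta_mx ord0 j : 'rV[R]_d).
Variable (h : R).
Hypothesis h0 : 0 < h.

Lemma ReZ (c : R) (a : R[i]) : Re (c%:C * a) = c * Re a.
Proof. by case: a => a b /=; rewrite mul0r subr0. Qed.

Lemma ImZ (c : R) (a : R[i]) : Im (c%:C * a) = c * Im a.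
Proof. by case: a => a b /=; rewrite mul0r addr0. Qed.

Lemma ReD (a b : R[i]) : Re (a + b) = Re a + Re b.
Proof. by case: a => ? ?; case: b => ? ?. Qed.

Lemma ImD (a b : R[i]) : Im (a + b) = Im a + Im b.
Proof. by case: a => ? ?; case: b => ? ?. Qed.

Lemma ReN (a : R[i]) : Re (- a) = - Re a. Proof. by case: a. Qed.
Lemma ImN (a : R[i]) : Im (- a) = - Im a. Proof. by case: a. Qed.

Lemma Re_sum (I : Type) (s : seq I) (P : pred I) (F : I -> R[i]) :
  Re (\sum_(i <- s | P i) F i) = \sum_(i <- s | P i) Re (F i).
Proof. by apply: (big_morph (@complex.Re R)) => // a b; exact: ReD. Qed.

Lemma Im_sum (I : Type) (s : seq I) (P : pred I) (F : I -> R[i]) :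
  Im (\sum_(i <- s | P i) F i) = \sum_(i <- s | P i) Im (F i).
Proof. by apply: (big_morph (@complex.Im R)) => // a b; exact: ImD. Qed.

Lemma Rintegral_I01_le (F : R -> R) K : measurable_fun [set: R] F ->
  (forall y, `|F y| <= K * I01 y) -> `|\int[mu]_y F y| <= K.
Proof.
move=> mF FK; have iK := integrableZl measurableT K (@integrable_I01 R).
have iF : mu.-integrable setT (EFin \o F).
  apply: (le_integrable _ _ _ iK) => //; first exact/measurable_EFinP.
  by move=> y _ /=; rewrite lee_fin; exact: le_trans (FK y) (ler_norm _).
apply: le_trans (le_normr_Rintegral measurableT iF) _.
have iF' : mu.-integrable setT (EFin \o (fun y => `|F y|)) by exact: integrable_norm.
have iK' : mu.-integrable setT (EFin \o (fun y => K * I01 y)) by [].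
apply: le_trans (le_Rintegral measurableT iF' iK' (fun y _ => FK y)) _.
rewrite RintegralZl//; last exact: integrable_I01.
rewrite (_ : \int[mu]_y I01 y = 1) ?mulr1//.
under eq_Rintegral do rewrite -[I01 _]mulr1.
rewrite -(@Rintegral_I01 R (fun=> 1)) Rintegral_cst; last exact: measurable_itv.
by rewrite /= lebesgue_measure_itv/= lte_fin ltr01 oppr0 adde0 mul1r.
Qed.

Lemma measurable_msym : measurable_fun [set: V * V] (msym h).
Proof.
rewrite (_ : msym h = fun z => \int[mu]_y (rho01 d y * expR (- (y / h) * (sqnorm z.1 / 2 + 2 * sqnorm z.2)))); last first.
  by apply/funext => z; exact: msymE.
apply: (@measurable_fun_Rintegral R _ _ (V * V)%type (measurableTypeR R) mu
  (fun z => rho01 d z.2 * expR (- (z.2 / h) * (sqnorm z.1.1 / 2 + 2 * sqnorm z.1.2)))).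
have m1 : measurable_fun [set: (V * V) * measurableTypeR R] (fun z => z.1.1).
  exact: (measurableT_comp measurable_fst measurable_fst).
have m2 : measurable_fun [set: (V * V) * measurableTypeR R] (fun z => z.1.2).
  exact: (measurableT_comp measurable_snd measurable_fst).
by do ?[first [exact: (measurableT_comp (measurable_rho01 d))|exact: m1|exact: m2|meas_step]].
Qed.

Lemma msym_bound (z : V * V) : `|msym h z| <= 2 * 2 ^+ d.
Proof.
rewrite msymE//; have q0 : 0 <= sqnorm z.1 / 2 + 2 * sqnorm z.2.
  by rewrite addr_ge0// ?divr_ge0 ?mulr_ge0 ?sqnorm_ge0.
apply: Rintegral_I01_le; last by move=> y; exact: rho01_dom.
by apply/measurable_EFinP; exact: measurable_int (integrable_rho01_exp d h0 q0).
Qed.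

Section splitting.
Variables (w : V -> R) (v : V) (dl : R).
Hypothesis rw : rapidC (2 * d) (fun _ : unit => w).

(** The integrand of the Weyl quantization with e^(i t) replaced by
    cos(t + dl). *)
Definition weyl_integrand (eta v' : V) : R :=
  cos (h^-1 * dot (v - v') eta + dl) * msym h (2^-1 *: (v + v'), eta) * w v'.

Lemma integrable_weyl_integrand eta : (leb d).-integrable setT (EFin \o weyl_integrand eta).
Proof.
have cw : continuous w by have /(_ tt) := rapid_cont rw.
have mw := continuous_measurable_rV cw.
have [C [C0 CH]] := rapid_wt (rapid0 rw).
apply: (@integrable_wt_dom _ _ _ (2 * 2 ^+ d * C)).
  apply: measurable_funM; last exact: mw.
  apply: measurable_funM; first by meas.
  apply: (measurableT_comp measurable_msym); apply: measurable_fun_pair => /=; by meas.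
move=> v'; rewrite /weyl_integrand normrM -[X in _ <= X]mulrA; apply: ler_pM => //; last exact: (CH tt v').
by apply: le_trans (norm_mul_le _ (cos_norm_le1 _)) (msym_bound _).
Qed.

(** The same bound as in [weyl_swap], integrated over y. *)
Lemma integrable_weyl_inner : (leb d).-integrable setT (EFin \o (fun eta => \int[leb d]_v' weyl_integrand eta v')).
Proof.
have [C C0 CH] := wosc_decay h0 v dl rw.
have mo := measurable_wosc h v dl rw.
have mF : measurable_fun [set: V * measurableTypeR R]
   (fun z => rho01 d z.2 * (gauss (2 * z.2 / h) z.1 * wosc h w v dl z.2 z.1)).
  by rewrite /gauss; do ?[first [exact: mo|exact: (measurableT_comp (measurable_rho01 d))|meas_step]].
apply: (@integrable_wt_dom _ _ _ (2 * 2 ^+ d * C)).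
  rewrite (_ : (fun _ => _) = fun eta => \int[mu]_y (rho01 d y * (gauss (2 * y / h) eta * wosc h w v dl y eta))).
    exact: (@measurable_fun_Rintegral R _ _ V (measurableTypeR R) mu _ mF).
  by apply/funext => eta; exact: weyl_inner.
move=> eta; rewrite /weyl_integrand weyl_inner//; apply: Rintegral_I01_le.
  exact: (measurableT_comp mF (pair1_measurable eta)).
move=> y; have [y01|y01] := boolP (0 < y <= 1); last first.
  by rewrite rho01_out// mul0r normr0 I01P (negbTE y01) !mulr0.
have y01' : 0 <= y <= 1 by have /andP[/ltW -> ->] := y01.
have -> : 2 * 2 ^+ d * C * wt eta * I01 y = (2 * 2 ^+ d * I01 y) * (C * wt eta) by ring.
rewrite normrM; apply: ler_pM => //; first exact: rho01_bound.
rewrite normrM; apply: le_trans (CH y eta y01').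
rewrite ler_piMl// ger0_norm ?gauss_ge0// gauss_le1//.
by rewrite divr_ge0 ?(ltW h0)// mulr_ge0//; have /andP[] := y01'.
Qed.

End splitting.

(** cos(t - pi/2) = sin t, and [weyl_avg_op] carries the factor cos dl, which is 0
    for dl = - pi/2: the mixed terms vanish and the operator is real. *)
Lemma weyl_complex (w : V -> R[i]) v :
  rapidC (2 * d) (fun _ : unit => fun v => Re (w v)) ->
  rapidC (2 * d) (fun _ : unit => fun v => Im (w v)) ->
  weyl h (m_symbol h) w v = avg_op h (fun v => Re (w v)) v +i* avg_op h (fun v => Im (w v)) v.
Proof.
move=> rr ri; pose ph := - (pi / 2) : R.
have iRe eta : \int[leb d]_v' Re (expi (h^-1 * dot (v - v') eta) * m_symbol h (2^-1 *: (v + v'), eta) * w v')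
  = \int[leb d]_v' weyl_integrand (fun v => Re (w v)) v 0 eta v' - \int[leb d]_v' weyl_integrand (fun v => Im (w v)) v ph eta v'.
  rewrite -RintegralB//; try exact: integrable_weyl_integrand.
  apply: eq_Rintegral => v' _; rewrite /weyl_integrand addr0 cosBpihalf /m_symbol -/(msym h _) /expi.
  by case: (w v') => a b /=; ring.
have iIm eta : \int[leb d]_v' Im (expi (h^-1 * dot (v - v') eta) * m_symbol h (2^-1 *: (v + v'), eta) * w v')
  = \int[leb d]_v' weyl_integrand (fun v => Im (w v)) v 0 eta v' + \int[leb d]_v' weyl_integrand (fun v => Re (w v)) v ph eta v'.
  rewrite -RintegralD//; try exact: integrable_weyl_integrand.
  apply: eq_Rintegral => v' _; rewrite /weyl_integrand addr0 cosBpihalf /m_symbol -/(msym h _) /expi.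
  by case: (w v') => a b /=; ring.
have c0 : cos ph = 0 by rewrite /ph cosN cos_pihalf.
rewrite /weyl /cintegral /=.
under eq_Rintegral do rewrite iRe.
under [X in _ +i* X]eq_Rintegral do rewrite iIm.
rewrite RintegralB//; try exact: integrable_weyl_inner.
rewrite RintegralD//; try exact: integrable_weyl_inner.
have E (u : V -> R) dl : rapidC (2 * d) (fun _ : unit => u) ->
   (((2 * pi * h) ^+ d)^-1) * (\int[leb d]_eta \int[leb d]_v' weyl_integrand u v dl eta v') = cos dl * avg_op h u v.
  by move=> ru; exact: (weyl_avg_op h0 v dl ru).
apply: complex_ext => /=; rewrite !mul0r ?subr0 ?addr0.
  by rewrite mulrBr !E// cos0 c0 mul0r subr0 mul1r.
by rewrite mulrDr !E// cos0 c0 mul0r addr0 mul1r.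
Qed.

Lemma weyl_zero (u : V -> R[i]) v : weyl h (fun=> 0) u v = 0.
Proof.
have z eta : cintegral (leb d) (fun v' => expi (h^-1 * dot (v - v') eta) * 0 * u v') = 0.
  by apply: complex_ext; rewrite /= Rintegral0_eq// => v'; rewrite mulr0 mul0r.
rewrite /weyl; under [X in cintegral _ X]eq_fun do rewrite z.
by rewrite (_ : cintegral _ _ = 0) ?mulr0//; apply: complex_ext; rewrite /= Rintegral0_eq.
Qed.

Lemma weyl_mx_m_Id (W : V * V -> 'cV[R[i]]_d) z i :
  weyl_mx h (m_Id h) W z i ord0 = weyl h (m_symbol h) (fun v' => W (z.1, v') i ord0) z.2.
Proof.
rewrite mxE (bigD1 i)//= big1 ?addr0 => [|j ji].
  rewrite (_ : (fun y => m_Id h y i i) = m_symbol h)//.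
  by apply/funext => y; rewrite /m_Id mxE eqxx mulr1n.
rewrite (_ : (fun y => _) = fun=> 0) ?weyl_zero//.
by apply/funext => y; rewrite /m_Id mxE eq_sym (negbTE ji) mulr0n.
Qed.

Section slices.
Variable G : seq ('I_d + 'I_d) -> V * V -> R.
Hypothesis sG : schwartz_family G.

(** Real or imaginary part of the j-th component of b_h u on the fibre over x. *)
Definition b_slice (j : 'I_d) (x : V) : V -> R :=
  b_fun h j (fun v => G [::] (x, v)) (fun v => G [:: inr j] (x, v)).

Definition db_avg (j : 'I_d) (x v : V) : R := \int[mu]_y (I01 y * (rho2 y * d_mehler_op h (b_slice j x) j y
  (db_fun h j (fun v => G [::] (x, v)) (fun v => G [:: inr j] (x, v))
     (fun v => G [:: inr j; inr j] (x, v))) v)).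

Lemma rapid_b_slice k j x : rapidC k (fun _ : unit => b_slice j x).
Proof.
apply: rapidC_add; first exact/rapidC_scale/rapid_slice.
apply: rapidC_mul; last exact: rapid_slice.
by apply: slowC_mul; [exact: slowC_coor|exact: slowC_cst].
Qed.

Let Dslice s j x v : is_derive v (e_ j) (fun v => G s (x, v)) (G (inr j :: s) (x, v)).
Proof. by case: sG => _ D _; apply: is_derive_slice; exact: D. Qed.

Lemma is_derive_avg_op_slice j x v :
  is_derive (x, v) (dir R (inr j : 'I_d + 'I_d)) (fun y => avg_op h (b_slice j y.1) y.2) (db_avg j x v).
Proof.
apply/is_deriveP.
have Dw : is_derive v (e_ j) (avg_op h (b_slice j x)) (db_avg j x v).
  apply: is_derive_avg_op => //.
  - exact: rapid_bdd_cont (rapid_b_slice 0 j x).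
  - by apply: (@rapid_bdd_cont _ _ 0); apply: rC_db_fun; exact: rapid_slice.
  - by move=> u; apply: is_derive_b_fun.
move: Dw => /is_deriveP; apply: is_derive_ext => t.
by rewrite dir_line.
Qed.

Lemma core_slice x v :
  - h * (\sum_j db_avg j x v) + 2^-1 * (\sum_j v ord0 j * avg_op h (b_slice j x) v) =
  h * (G [::] (x, v) - mu_h h v * \int[leb d]_v' (G [::] (x, v') * mu_h h v')).
Proof.
rewrite -(core_identity h0 v (rapid_slice 0 [::] x sG) (fun j => rapid_slice 0 [:: inr j] x sG)
   (fun j => rapid_slice 0 [:: inr j; inr j] x sG) (Dslice [::] ^~ x) (fun j => Dslice [:: inr j] j x)).
rewrite big_split/= !mulr_sumr; congr (_ + _); apply: eq_bigr => j _.
by rewrite mulrA [2^-1 * _]mulrC.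
Qed.

End slices.

(** Real and imaginary parts of the composition are each given by
    [core_slice]. *)
Lemma b_weyl_b (u : V * V -> R[i]) x v : schwartz u ->
  (b_adj h \o weyl_mx h (m_Id h) \o b_op h) u (x, v) =
  h%:C * (u (x, v) - (mu_h h v)%:C * cintegral (leb d) (fun v' => u (x, v') * (mu_h h v')%:C)).
Proof.
move=> su; pose GR s z := Re (partials s u z); pose GI s z := Im (partials s u z).
have sR : schwartz_family GR by exact: schwartz_Re.
have sI : schwartz_family GI by exact: schwartz_Im.
have bE j z : weyl_mx h (m_Id h) (b_op h u) z j ord0 =
    avg_op h (b_slice GR j z.1) z.2 +i* avg_op h (b_slice GI j z.1) z.2.
  rewrite weyl_mx_m_Id.
  have ER : (fun v' => Re (b_op h u (z.1, v') j ord0)) = b_slice GR j z.1.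
    by apply/funext => v'; rewrite mxE ReD !ReZ.
  have EI : (fun v' => Im (b_op h u (z.1, v') j ord0)) = b_slice GI j z.1.
    by apply/funext => v'; rewrite mxE ImD !ImZ.
  by rewrite weyl_complex ?ER ?EI//; exact: rapid_b_slice.
have pE j : partial (inr j) (fun y => weyl_mx h (m_Id h) (b_op h u) y j ord0) (x, v) =
    db_avg GR j x v +i* db_avg GI j x v.
  rewrite /partial; under eq_fun do rewrite bE.
  under [fun y => Im _]eq_fun do rewrite bE.
  by congr (_ +i* _); [case: (is_derive_avg_op_slice sR j x v)|case: (is_derive_avg_op_slice sI j x v)].
rewrite /= /b_adj; under eq_bigr do rewrite pE.
under [X in _ + _ * X]eq_bigr do rewrite bE.
have E1 := core_slice sR x v; have E2 := core_slice sI x v.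
apply: complex_ext.
- rewrite ReD mulNr ReN !ReZ !Re_sum ReD ReN ReZ /= -mulNr.
  have -> : \int[leb d]_v' Re (u (x, v') * (mu_h h v')%:C) = \int[leb d]_v' (GR [::] (x, v') * mu_h h v').
    by apply: eq_Rintegral => v' _; rewrite mulrC ReZ mulrC.
  by rewrite -E1; congr (_ + _ * _); apply: eq_bigr => j _; rewrite mul0r subr0.
- rewrite ImD mulNr ImN !ImZ !Im_sum ImD ImN ImZ /= -mulNr.
  have -> : \int[leb d]_v' Im (u (x, v') * (mu_h h v')%:C) = \int[leb d]_v' (GI [::] (x, v') * mu_h h v').
    by apply: eq_Rintegral => v' _; rewrite mulrC ImZ mulrC.
  by rewrite -E2; congr (_ + _ * _); apply: eq_bigr => j _; rewrite mul0r addr0.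
Qed.

End weyl_assembly.

(** * Square integrable functions and orthogonal projections *)

Section L2_theory.
Local Open Scope complex_scope.
Local Open Scope ring_scope.
Notation Re := complex.Re.
Notation Im := complex.Im.
Context {R : realType} {disp : measure_display} {T : measurableType disp}.
Variable mu : {measure set T -> \bar R}.
Implicit Types (f g k : T -> R[i]) (a b : T -> R).

Definition rL2 a := measurable_fun [set: T] a /\ mu.-integrable setT (EFin \o (fun t => a t ^+ 2)).

Lemma rL2_mul a b : rL2 a -> rL2 b -> mu.-integrable setT (EFin \o (fun t => a t * b t)).
Proof.
move=> [ma ia] [mb ib]; apply: (le_integrable _ _ _ (integrableD measurableT ia ib)) => //.
  by apply/measurable_EFinP; exact: measurable_funM.
move=> t _ /=; rewrite lee_fin; apply: le_trans _ (ler_norm _); rewrite ler_norml; apply/andP; split.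
  by have := sqr_ge0 (a t + b t); have := sqr_ge0 (a t); have := sqr_ge0 (b t); nra.
by have := sqr_ge0 (a t - b t); have := sqr_ge0 (a t); have := sqr_ge0 (b t); nra.
Qed.

Lemma rL2_add a b : rL2 a -> rL2 b -> rL2 (fun t => a t + b t).
Proof.
move=> la lb; have [ma ia] := la; have [mb ib] := lb; split; first exact: measurable_funD.
have := integrableD measurableT (integrableD measurableT ia ib)
  (integrableZl measurableT 2 (rL2_mul la lb)).
by apply: eq_integrable => // t _ /=; congr EFin; ring.
Qed.

Lemma rL2_scale c a : rL2 a -> rL2 (fun t => c * a t).
Proof.
move=> [ma ia]; split; first exact: measurable_funM.
have := integrableZl measurableT (c ^+ 2) ia.
by apply: eq_integrable => // t _ /=; congr EFin; ring.
Qed.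

Lemma rL2_opp a : rL2 a -> rL2 (fun t => - a t).
Proof. by move=> /(rL2_scale (-1)); under eq_fun do rewrite mulN1r. Qed.

Lemma normc_sqr (x : R[i]) : normc x ^+ 2 = Re x ^+ 2 + Im x ^+ 2.
Proof. by case: x => x y /=; rewrite sqr_sqrtr// addr_ge0 ?sqr_ge0. Qed.

Lemma L2P f : L2 mu f <-> rL2 (fun t => Re (f t)) /\ rL2 (fun t => Im (f t)).
Proof.
split=> [[mr mi foo]|[[mr ir] [mi ii]]].
  have mn : measurable_fun setT (fun t => normc (f t) ^+ 2).
    under eq_fun do rewrite normc_sqr.
    by apply: measurable_funD; exact: measurable_funX.
  have ifn : mu.-integrable setT (EFin \o (fun t => normc (f t) ^+ 2)).
    apply/integrableP; split; first exact/measurable_EFinP.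
    by under eq_integral do rewrite /= ger0_norm ?sqr_ge0//.
  split; split=> //; apply: (le_integrable _ _ _ ifn) => //=.
  - by apply/measurable_EFinP; exact: measurable_funX.
  - by move=> t _; rewrite lee_fin !ger0_norm ?sqr_ge0// normc_sqr lerDl sqr_ge0.
  - by apply/measurable_EFinP; exact: measurable_funX.
  - by move=> t _; rewrite lee_fin !ger0_norm ?sqr_ge0// normc_sqr lerDr sqr_ge0.
split=> //; have /integrableP[_] := integrableD measurableT ir ii.
apply: le_lt_trans; rewrite le_eqVlt; apply/orP; left; apply/eqP; apply: eq_integral => t _ /=.
by rewrite normc_sqr ger0_norm// addr_ge0 ?sqr_ge0.
Qed.

Definition rinner a b : R := \int[mu]_t (a t * b t).

Lemma rinnerC a b : rinner a b = rinner b a.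
Proof. by apply: eq_Rintegral => t _; rewrite mulrC. Qed.

Lemma rinner_subl a b c : rL2 a -> rL2 b -> rL2 c -> rinner (fun t => a t - b t) c = rinner a c - rinner b c.
Proof.
move=> la lb lc; rewrite /rinner -RintegralB//; try exact: rL2_mul.
by apply: eq_Rintegral => t _; rewrite mulrBl.
Qed.

Lemma rinner_scalel x a c : rL2 a -> rL2 c -> rinner (fun t => x * a t) c = x * rinner a c.
Proof.
move=> la lc; rewrite /rinner -RintegralZl//; last exact: rL2_mul.
by apply: eq_Rintegral => t _; rewrite mulrA.
Qed.

Lemma inner_rinner f g : L2 mu f -> L2 mu g -> inner mu f g =
  (rinner (fun t => Re (f t)) (fun t => Re (g t)) + rinner (fun t => Im (f t)) (fun t => Im (g t))) +i*
  (rinner (fun t => Im (f t)) (fun t => Re (g t)) - rinner (fun t => Re (f t)) (fun t => Im (g t))).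
Proof.
move=> /L2P[fr fi] /L2P[gr gi]; rewrite /inner /cintegral; congr (_ +i* _).
  rewrite /rinner -RintegralD//; try exact: rL2_mul.
  by apply: eq_Rintegral => t _; case: (f t) => a b; case: (g t) => c e /=; ring.
rewrite /rinner -RintegralB//; try exact: rL2_mul.
by apply: eq_Rintegral => t _; case: (f t) => a b; case: (g t) => c e /=; ring.
Qed.

Lemma L2_sub f g : L2 mu f -> L2 mu g -> L2 mu (fun t => f t - g t).
Proof.
move=> /L2P[fr fi] /L2P[gr gi]; apply/L2P; split.
  by under eq_fun do rewrite ReD ReN; apply: rL2_add => //; exact: rL2_opp.
by under eq_fun do rewrite ImD ImN; apply: rL2_add => //; exact: rL2_opp.
Qed.

Lemma L2_scale (c : R) f : L2 mu f -> L2 mu (fun t => c%:C * f t).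
Proof.
move=> /L2P[fr fi]; apply/L2P; split.
  by under eq_fun do rewrite ReZ; exact: rL2_scale.
by under eq_fun do rewrite ImZ; exact: rL2_scale.
Qed.

Lemma inner_subl f g k : L2 mu f -> L2 mu g -> L2 mu k ->
  inner mu (fun t => f t - g t) k = inner mu f k - inner mu g k.
Proof.
move=> lf lg lk; rewrite !inner_rinner//; last exact: L2_sub.
move: lf lg lk => /L2P[fr fi] /L2P[gr gi] /L2P[kr ki].
have -> : (fun t => Re (f t - g t)) = (fun t => Re (f t) - Re (g t)).
  by apply/funext => t; rewrite ReD ReN.
have -> : (fun t => Im (f t - g t)) = (fun t => Im (f t) - Im (g t)).
  by apply/funext => t; rewrite ImD ImN.
by rewrite !rinner_subl//; apply: complex_ext => /=; ring.
Qed.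

Lemma inner_scalel (c : R) f k : L2 mu f -> L2 mu k ->
  inner mu (fun t => c%:C * f t) k = c%:C * inner mu f k.
Proof.
move=> lf lk; rewrite !inner_rinner//; last exact: L2_scale.
move: lf lk => /L2P[fr fi] /L2P[kr ki].
have -> : (fun t => Re (c%:C * f t)) = (fun t => c * Re (f t)).
  by apply/funext => t; rewrite ReZ.
have -> : (fun t => Im (c%:C * f t)) = (fun t => c * Im (f t)).
  by apply/funext => t; rewrite ImZ.
by rewrite !rinner_scalel//; apply: complex_ext => /=; ring.
Qed.

Lemma inner_conj f g : L2 mu f -> L2 mu g -> inner mu g f = (inner mu f g)^*.
Proof.
move=> lf lg; rewrite !inner_rinner//; apply: complex_ext => /=.
  by congr (_ + _); exact: rinnerC.
by rewrite opprB; congr (_ - _); exact: rinnerC.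
Qed.

(** The integral of a nonnegative function vanishes only if the function does so
    almost everywhere. *)
Lemma inner_self0 f : L2 mu f -> inner mu f f = 0 -> {ae mu, forall t, f t = 0}.
Proof.
move=> lf; rewrite inner_rinner// => -[E _].
move: lf => /L2P[[mr ir] [mi ii]].
have iS := integrableD measurableT ir ii.
have E' : (\int[mu]_t ((Re (f t)) ^+ 2 + (Im (f t)) ^+ 2)%:E = 0)%E.
  have <- : (\int[mu]_t ((Re (f t)) ^+ 2 + (Im (f t)) ^+ 2))%:E = 0%E.
    by rewrite RintegralD//; congr EFin.
  by rewrite /Rintegral fineK//; exact: (integrable_fin_num measurableT iS).
have mS : measurable_fun setT (fun t => ((Re (f t)) ^+ 2 + (Im (f t)) ^+ 2)%:E).
  exact: measurable_int iS.
have := (@ae_eq_integral_abs _ _ _ mu _ measurableT _ mS).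
move=> [H _]; have {}H : ae_eq mu setT (fun t => ((Re (f t)) ^+ 2 + (Im (f t)) ^+ 2)%:E) (cst 0%E).
  apply: H; rewrite -E'; apply: eq_integral => t _ /=.
  by rewrite ger0_norm// addr_ge0 ?sqr_ge0.
apply: filterS H => t /(_ I) /= -[] /eqP; rewrite paddr_eq0 ?sqr_ge0//.
by rewrite !sqrf_eq0 => /andP[/eqP r0 /eqP i0]; exact: complex_ext.
Qed.

Section orthogonal.
Variable E : set (T -> R[i]).
Hypothesis E_L2 : forall w, E w -> L2 mu w.
Hypothesis E_sub : forall v w, E v -> E w -> E (fun t => v t - w t).

(** The difference of two projections belongs to the subspace and is orthogonal to
    it. *)
Lemma orth_proj_unique u p q : L2 mu u -> is_orth_proj mu E u p -> is_orth_proj mu E u q ->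
  {ae mu, forall t, p t = q t}.
Proof.
move=> lu [Ep Op] [Eq Oq].
have lp := E_L2 Ep; have lq := E_L2 Eq; have Epq := E_sub Ep Eq; have lpq := E_L2 Epq.
have H : inner mu (fun t => p t - q t) (fun t => p t - q t) = 0.
  have := Op _ Epq; have := Oq _ Epq; rewrite !inner_subl// => /eqP; rewrite subr_eq0 => /eqP <- /eqP; rewrite subr_eq0 => /eqP <-.
  by rewrite subrr.
by apply: filterS (inner_self0 lpq H) => t /eqP; rewrite subr_eq0 => /eqP.
Qed.

(** Both sides equal the inner product of the two projections. *)
Lemma orth_proj_adj u p f q : L2 mu u -> L2 mu f ->
  is_orth_proj mu E u p -> is_orth_proj mu E f q -> inner mu p f = inner mu u q.
Proof.
move=> lu lf [Ep Op] [Eq Oq].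
have lp := E_L2 Ep; have lq := E_L2 Eq.
have := Op _ Eq; rewrite inner_subl// => /eqP; rewrite subr_eq0 => /eqP ->.
have := Oq _ Ep; rewrite inner_subl// => /eqP; rewrite subr_eq0 => /eqP H.
by rewrite (inner_conj lf lp) (inner_conj lq lp) H.
Qed.

End orthogonal.

End L2_theory.

(** * The projection on the Gaussian *)

Section projection.
Local Open Scope complex_scope.
Local Open Scope ring_scope.
Notation Re := complex.Re.
Notation Im := complex.Im.
Context {R : realType} (d : nat).
Notation leb := (lebesgue_rV R).
Local Notation V := 'rV[R]_d.
Local Notation leb2 := (leb d \x leb d)%E.
Variable (h : R).
Hypothesis h0 : 0 < h.
Local Notation mh := (@mu_h R d h).

(** The exponent -d/4 of 2 pi h is the one that makes the square of mu_h a
    probability density. *)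
Lemma mu_h_sqr v : mh v ^+ 2 = (Num.sqrt (2 * pi * h) ^+ d)^-1 * gauss (2 * h)^-1 v.
Proof.
have a0 : 0 < 2 * pi * h by rewrite !mulr_gt0// pi_gt0.
rewrite /mu_h exprMn; congr (_ * _); last first.
  rewrite /gauss expr2 -expRD; congr expR.
  by field; rewrite gt_eqF.
rewrite expr2 -powRD; last by rewrite (gt_eqF a0) implybT.
have -> : - (d%:R / 4) + - (d%:R / 4) = 2^-1 * - d%:R :> R by field.
by rewrite powRrM powR12_sqrt ?(ltW a0)// powRN powR_mulrn ?sqrtr_ge0.
Qed.

Lemma measurable_mu_h : measurable_fun [set: V] mh.
Proof. by rewrite /mu_h; meas. Qed.

Lemma integrable_mu_h_sqr : (leb d).-integrable setT (EFin \o (fun v => mh v ^+ 2)).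
Proof.
under eq_fun do rewrite mu_h_sqr.
have i0 : 0 < (2 * h)^-1 by rewrite invr_gt0 mulr_gt0.
exact: (integrableZl measurableT _ (integrable_gauss d i0)).
Qed.

Lemma Rintegral_mu_h_sqr : \int[leb d]_v (mh v ^+ 2) = 1.
Proof.
have i0 : 0 < (2 * h)^-1 by rewrite invr_gt0 mulr_gt0.
have a0 : 0 < 2 * pi * h by rewrite !mulr_gt0// pi_gt0.
under eq_Rintegral do rewrite mu_h_sqr.
rewrite RintegralZl//; last exact: integrable_gauss.
rewrite Rintegral_gauss// invrK (_ : pi * (2 * h) = 2 * pi * h); last by ring.
by rewrite mulVf// expf_neq0// gt_eqF// sqrtr_gt0.
Qed.

Lemma rL2_mu_h : rL2 (leb d) mh.
Proof. by split; [exact: measurable_mu_h|exact: integrable_mu_h_sqr]. Qed.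

Lemma rL2_mu_g g : rL2 (leb d) g -> rL2 leb2 (fun z => mh z.2 * g z.1).
Proof.
move=> [mg ig]; split.
  apply: measurable_funM; first exact: (measurableT_comp measurable_mu_h measurable_snd).
  exact: (measurableT_comp mg measurable_fst).
apply: (@integrable_prod_dom R _ _ V V (leb d) (leb d) (fun z => (mh z.2 * g z.1) ^+ 2) (fun x => g x ^+ 2) (fun v => mh v ^+ 2)) => //.
- apply: measurable_funX; apply: measurable_funM; first exact: (measurableT_comp measurable_mu_h measurable_snd).
  exact: (measurableT_comp mg measurable_fst).
- exact: integrable_mu_h_sqr.
- by move=> x v /=; rewrite ger0_norm ?sqr_ge0// exprMn mulrC.
Qed.

(** Expand the integral of (a - c mu_h)^2, where c is the coefficient of a. *)
Lemma bessel (a : V -> R) : rL2 (leb d) a -> (\int[leb d]_v (a v * mh v)) ^+ 2 <= \int[leb d]_v (a v ^+ 2).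
Proof.
move=> la; set c := \int[leb d]_v (a v * mh v).
have [_ ia] := la; have iam := rL2_mul la rL2_mu_h; have im := integrable_mu_h_sqr.
have i1 : (leb d).-integrable setT (EFin \o (fun v => (- (2 * c)) * (a v * mh v))).
  exact: (integrableZl measurableT (- (2 * c)) iam).
have i2 : (leb d).-integrable setT (EFin \o (fun v => c ^+ 2 * mh v ^+ 2)).
  exact: (integrableZl measurableT (c ^+ 2) im).
have i3 : (leb d).-integrable setT (EFin \o (fun v => - (2 * c) * (a v * mh v) + c ^+ 2 * mh v ^+ 2)).
  exact: (integrableD measurableT i1 i2).
have E : \int[leb d]_v ((a v - c * mh v) ^+ 2) = \int[leb d]_v (a v ^+ 2) - c ^+ 2.
  transitivity (\int[leb d]_v (a v ^+ 2 + (- (2 * c) * (a v * mh v) + c ^+ 2 * mh v ^+ 2))).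
    by apply: eq_Rintegral => v _; ring.
  rewrite RintegralD// RintegralD// RintegralZl// RintegralZl// Rintegral_mu_h_sqr -/c.
  by ring.
rewrite -subr_ge0 -E; apply: Rintegral_ge0 => v _; exact: sqr_ge0.
Qed.

Definition gauss_coef (f : V * V -> R) (x : V) : R := \int[leb d]_v (f (x, v) * mh v).

Section one_function.
Variable f : V * V -> R.
Hypothesis lf : rL2 leb2 f.

Let mf : measurable_fun [set: V * V] f. Proof. by case: lf. Qed.

Let mfm : measurable_fun [set: V * V] (fun z => f z * mh z.2).
Proof.
apply: measurable_funM => //.
exact: (measurableT_comp measurable_mu_h measurable_snd).
Qed.

Lemma measurable_gauss_coef : measurable_fun [set: V] (gauss_coef f).
Proof. exact: (@measurable_fun_Rintegral R _ _ V V (leb d) _ mfm). Qed.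

Lemma ae_rL2_slice : {ae leb d, forall x, rL2 (leb d) (fun v => f (x, v))}.
Proof.
have [_ iff] := lf; have := ae_integrable1 iff; apply: filterS => x ix; split => //.
exact: (measurableT_comp mf (pair1_measurable x)).
Qed.

(** Bessel's inequality on almost every fibre, integrated over x. *)
Lemma rL2_gauss_coef : rL2 (leb d) (gauss_coef f).
Proof.
split; first exact: measurable_gauss_coef.
have [_ iff] := lf.
have iF := integrable_fubini_F iff.
apply/integrableP; split.
  by apply/measurable_EFinP; apply: measurable_funX; exact: measurable_gauss_coef.
have /integrableP[mF] := iF; apply: le_lt_trans.
apply: ae_ge0_le_integral => //.
- by apply: measurableT_comp => //; apply/measurable_EFinP; apply: measurable_funX; exact: measurable_gauss_coef.
- exact: measurableT_comp.
- apply: filterS ae_rL2_slice => x lx _.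
  rewrite /fubini_F; have := bessel lx; rewrite -lee_fin /Rintegral fineK; last first.
    by case: lx => _ ix; exact: (integrable_fin_num measurableT ix).
  rewrite /= ger0_norm ?sqr_ge0// => H; apply: le_trans H _.
  exact: lee_abs.
Qed.

(** Fubini, on the fibres where f is square integrable. *)
Lemma gauss_coef_rinner g : rL2 (leb d) g ->
  rinner leb2 f (fun z => mh z.2 * g z.1) = rinner (leb d) (gauss_coef f) g.
Proof.
move=> lg; rewrite /rinner -(RFubini (rL2_mul lf (rL2_mu_g lg))) /=.
have [mg _] := lg.
apply: Rintegral_ae_eq.
- apply: (@measurable_fun_Rintegral R _ _ V V (leb d) (fun z => f z * (mh z.2 * g z.1))).
  apply: measurable_funM => //; apply: measurable_funM.
    exact: (measurableT_comp measurable_mu_h measurable_snd).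
  exact: (measurableT_comp mg measurable_fst).
- by apply: measurable_funM => //; exact: measurable_gauss_coef.
- apply: filterS ae_rL2_slice => x lx.
  rewrite /gauss_coef mulrC -RintegralZl//; last exact: rL2_mul lx rL2_mu_h.
  by apply: eq_Rintegral => v _; ring.
Qed.

End one_function.

Lemma gauss_coef_mu_g g x : gauss_coef (fun z => mh z.2 * g z.1) x = g x.
Proof.
rewrite /gauss_coef /=; transitivity (\int[leb d]_v (g x * mh v ^+ 2)).
  by apply: eq_Rintegral => v _; ring.
by rewrite RintegralZl ?Rintegral_mu_h_sqr ?mulr1//; exact: integrable_mu_h_sqr.
Qed.

Lemma gauss_coef_orth f g : rL2 leb2 f -> rL2 (leb d) g ->
  rinner leb2 (fun z => mh z.2 * gauss_coef f z.1) (fun z => mh z.2 * g z.1) = rinner leb2 f (fun z => mh z.2 * g z.1).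
Proof.
move=> lf lg; rewrite (gauss_coef_rinner lf lg) (gauss_coef_rinner (rL2_mu_g (rL2_gauss_coef lf)) lg).
by rewrite (_ : gauss_coef (fun z => mh z.2 * gauss_coef f z.1) = gauss_coef f)//; apply/funext => x; exact: gauss_coef_mu_g.
Qed.

Lemma mu_L2x_L2 w : mu_L2x h w -> L2 leb2 w.
Proof.
move=> [g /L2P[gr gi] ->]; apply/L2P; split.
  rewrite (_ : (fun z => _) = (fun z => mh z.2 * Re (g z.1))); first exact: (rL2_mu_g gr).
  by apply/funext => z; rewrite ReZ.
rewrite (_ : (fun z => _) = (fun z => mh z.2 * Im (g z.1))); first exact: (rL2_mu_g gi).
by apply/funext => z; rewrite ImZ.
Qed.

Lemma mu_L2x_sub (v w : V * V -> R[i]) : mu_L2x h v -> mu_L2x h w -> mu_L2x h (fun z => v z - w z).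
Proof.
move=> [g lg ->] [k lk ->]; exists (fun x => g x - k x); first exact: L2_sub.
by apply/funext => z; rewrite mulrBr.
Qed.

Definition gauss_proj (u : V * V -> R[i]) (z : V * V) : R[i] :=
  (mh z.2)%:C * cintegral (leb d) (fun v' => u (z.1, v') * (mh v')%:C).

Lemma gauss_projE u x : cintegral (leb d) (fun v' => u (x, v') * (mh v')%:C) =
  gauss_coef (fun z => Re (u z)) x +i* gauss_coef (fun z => Im (u z)) x.
Proof.
apply: complex_ext => /=; apply: eq_Rintegral => v _.
  by rewrite mulrC ReZ mulrC.
by rewrite mulrC ImZ mulrC.
Qed.

(** Existence of the projection: the candidate has the same coefficients along
    mu_h as u. *)
Lemma gauss_proj_orth u : L2 leb2 u -> is_orth_proj leb2 (mu_L2x h) u (gauss_proj u).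
Proof.
move=> lu; have /L2P[lr li] := lu.
have EP : mu_L2x h (gauss_proj u).
  exists (fun x => cintegral (leb d) (fun v' => u (x, v') * (mh v')%:C)) => //.
  apply/L2P; split; under eq_fun do rewrite gauss_projE /=; exact: rL2_gauss_coef.
split=> // w Ew; have lP := mu_L2x_L2 EP; have lw := mu_L2x_L2 Ew.
rewrite inner_subl// !inner_rinner//.
move: Ew => [g /L2P[gr gi] ->].
have -> : (fun z : V * V => Re ((mh z.2)%:C * g z.1)) = (fun z => mh z.2 * Re (g z.1)).
  by apply/funext => z; rewrite ReZ.
have -> : (fun z : V * V => Im ((mh z.2)%:C * g z.1)) = (fun z => mh z.2 * Im (g z.1)).
  by apply/funext => z; rewrite ImZ.
have -> : (fun z : V * V => Re (gauss_proj u z)) = (fun z => mh z.2 * gauss_coef (fun z => Re (u z)) z.1).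
  by apply/funext => z; rewrite ReZ gauss_projE.
have -> : (fun z : V * V => Im (gauss_proj u z)) = (fun z => mh z.2 * gauss_coef (fun z => Im (u z)) z.1).
  by apply/funext => z; rewrite ImZ gauss_projE.
by rewrite !(gauss_coef_orth (g := fun x => Re (g x)))// !(gauss_coef_orth (g := fun x => Im (g x)))// subrr.
Qed.

Lemma Pi_op_orth u : L2 leb2 u -> is_orth_proj leb2 (mu_L2x h) u (Pi_op h u).
Proof. by move=> /gauss_proj_orth PO; apply: (@xgetPex _ (fun=> 0) [set p | is_orth_proj leb2 (mu_L2x h) u p]); exists (gauss_proj u). Qed.

Lemma schwartz_family_rL2 G s : schwartz_family G -> rL2 leb2 (G s).
Proof.
move=> sG; have [cG _ bG] := sG; have mG := continuous_measurable_rV2 (cG s); split=> //.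
have [C C0 CH] := schwartz_family_wt s sG; have [D DH] := bG s 0%N.
apply: (@integrable_prod_dom R _ _ V V (leb d) (leb d) (fun z => G s z ^+ 2) (fun x => D * C * wt x) (@wt R d)) => //.
- exact: measurable_funX.
- exact: (integrableZl measurableT (D * C) (integrable_wt d)).
- exact: integrable_wt.
- move=> x v; rewrite normrX expr2 -!mulrA; apply: ler_pM => //.
    by have := DH (x, v); rewrite expr0 mul1r.
  by rewrite mulrA; exact: CH.
Qed.

Lemma schwartz_L2 u : schwartz u -> L2 leb2 u.
Proof.
move=> su; apply/L2P; split.
  exact: (schwartz_family_rL2 [::] (schwartz_Re su)).
exact: (schwartz_family_rL2 [::] (schwartz_Im su)).
Qed.

Lemma adj_m_Id : adj_symbol (@m_Id R d h) = m_Id h.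
Proof.
apply/funext => z; apply/matrixP => i j; rewrite !mxE eq_sym.
by case: (_ == _); apply: complex_ext; rewrite /= ?oppr0.
Qed.

Lemma b_weyl_b_gauss_proj u : schwartz u ->
  (b_adj h \o weyl_mx h (m_Id h) \o b_op h) u = fun z => h%:C * (u z - gauss_proj u z).
Proof. by move=> su; apply/funext => -[x v]; rewrite b_weyl_b. Qed.

Lemma factorization_schwartz u : schwartz u ->
  {ae leb2, forall z, Q_op h u z = (b_adj h \o weyl_mx h (m_Id h) \o b_op h) u z}.
Proof.
move=> su; have lu := schwartz_L2 su.
have := orth_proj_unique mu_L2x_L2 mu_L2x_sub lu (Pi_op_orth lu) (gauss_proj_orth lu).
by apply: filterS => z E; rewrite b_weyl_b_gauss_proj// /Q_op E.
Qed.

(** The composition applied to the test function is h (phi - Pi_h phi) pointwise,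
    and Pi_h is symmetric. *)
Lemma factorization_L2 u : L2 leb2 u -> distr_eq h (m_Id h) (Q_op h u) u.
Proof.
move=> lu phi sp; have lp := schwartz_L2 sp.
have oP := Pi_op_orth lu; have oQ := gauss_proj_orth lp.
have lPu := mu_L2x_L2 oP.1; have lPp := mu_L2x_L2 oQ.1.
have lup := L2_sub lu lPu; have lpp := L2_sub lp lPp.
rewrite adj_m_Id b_weyl_b_gauss_proj// /Q_op /lebesgue_space2 inner_scalel//.
rewrite (inner_conj (L2_scale h lpp) lu) inner_scalel// inner_subl// inner_subl//.
rewrite (orth_proj_adj mu_L2x_L2 lu lp oP oQ).
rewrite (inner_conj lu lp) (inner_conj lu lPp).
apply: complex_ext; rewrite /= ?opprK; ring.
Qed.

End projection.

(** * The symbol class *)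

Section symbol.
Local Open Scope complex_scope.
Local Open Scope ring_scope.
Notation Re := complex.Re.
Notation Im := complex.Im.
Context {R : realType} (d : nat).
Notation mu := (@lebesgue_measure R).
Local Notation V := 'rV[R]_d.
Local Notation I2 := ('I_d + 'I_d)%type.

Definition coord (i : I2) (z : V * V) : R :=
  match i with inl j => z.1 ord0 j | inr j => z.2 ord0 j end.

(** The derivative of q along the direction i is [coef i] times the coordinate. *)
Definition coef (i : I2) : R := match i with inl _ => 1 | inr _ => 4 end.
Definition qf (z : V * V) : R := sqnorm z.1 / 2 + 2 * sqnorm z.2.

Lemma qfE z : qf z = \sum_i (coef i / 2) * coord i z ^+ 2.
Proof.
rewrite big_sumType /= /qf !sqnormE mulr_suml mulr_sumr; congr (_ + _); apply: eq_bigr => j _.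
  by rewrite mul1r mulrC.
by congr (_ * _); rewrite -[4]/((2 * 2)%:R) natrM mulfK.
Qed.

Lemma qf_ge0 z : 0 <= qf z.
Proof. by rewrite addr_ge0// ?divr_ge0 ?mulr_ge0 ?sqnorm_ge0. Qed.

Lemma coord_sq i z : coord i z ^+ 2 <= 2 * qf z.
Proof.
have s1 := sqnorm_ge0 z.1; have s2 := sqnorm_ge0 z.2.
case: i => j /=; rewrite /qf.
  by apply: le_trans (coor_sq_le z.1 j) _; lra.
by apply: le_trans (coor_sq_le z.2 j) _; lra.
Qed.

Lemma continuous_coord i : continuous (coord i).
Proof.
case: i => j /= z.
  by apply: (@continuous_comp _ _ _ fst (fun v : V => v ord0 j)); [exact: cvg_fst|exact: continuous_coor].
by apply: (@continuous_comp _ _ _ snd (fun v : V => v ord0 j)); [exact: cvg_snd|exact: continuous_coor].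
Qed.

Lemma continuous_qf : continuous qf.
Proof.
rewrite (_ : qf = fun z => \sum_i (coef i / 2) * coord i z ^+ 2); last by apply/funext => z; exact: qfE.
apply: continuous_sum => i; apply: continuous_mul; first exact: continuous_c.
by apply: continuous_pow; exact: continuous_coord.
Qed.

Lemma coord_line l i z t : coord l (z + t *: dir R i) = coord l z + t * (l == i)%:R.
Proof.
by case: l => l; case: i => i; rewrite /coord /= ?mxE ?eqxx /= ?mulr0 ?addr0// ?mxE ?eqxx.
Qed.

Lemma is_derive_coord l i z : is_derive z (dir R i) (coord l) (l == i)%:R.
Proof.
apply/is_deriveP; under eq_fun do rewrite coord_line.
have := is_derive_add (is_derive_c (0 : R) (1 : R) (coord l z))
  (is_derive_mul (is_derive_id (0 : R) (1 : R)) (is_derive_c (0 : R) (1 : R) (l == i)%:R)).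
by apply: is_derive_val; rewrite mulr0 mulr1 !add0r.
Qed.

Lemma is_derive_qf i z : is_derive z (dir R i) qf (coef i * coord i z).
Proof.
have : is_derive z (dir R i) (fun z => \sum_l (coef l / 2) * coord l z ^+ 2)
    (\sum_l (coef l / 2) * (2 * coord l z ^+ 1 * (l == i)%:R)).
  by apply: is_derive_bigsum => l _; apply: is_derive_scale; apply: is_derive_pow; exact: is_derive_coord.
rewrite (bigD1 i)//= eqxx big1 ?addr0 => [|l /negbTE ->]; last by rewrite !mulr0.
move=> D; have {}D : is_derive z (dir R i) qf (coef i / 2 * (2 * coord i z ^+ 1 * 1)).
  by apply: is_derive_ext D => u; rewrite qfE.
by apply: is_derive_val D; rewrite mulr1 expr1 mulrA divfK.
Qed.

Definition profile_wt (y : R) : R := rho2 y * (1 + y) ^+ d.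

(** The k-th derivative of the radial profile, so that
    m_h(z) = profile 0 h (q z). *)
Definition profile (k : nat) (h s : R) : R :=
  \int[mu]_y (I01 y * (profile_wt y * ((- (y / h)) ^+ k * expR (- (y / h) * s)))).

Lemma continuous_profile_wt : continuous profile_wt.
Proof.
apply: continuous_mul; first exact: continuous_rho2.
by apply: continuous_pow; apply: continuous_add; [exact: continuous_c|move=> y; exact: cvg_id].
Qed.

Lemma profile_wt_bound y : 0 < y <= 1 -> `|profile_wt y| <= 2 * 2 ^+ d.
Proof.
move=> /andP[y0 y1]; rewrite normrM; apply: ler_pM => //; first exact: rho2_bound.
rewrite ger0_norm; last by rewrite exprn_ge0// addr_ge0// ltW.
by apply: lerXn2r; rewrite ?nnegrE ?addr_ge0 ?(ltW y0)//; lra.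
Qed.

Lemma msym_profile h z : 0 < h -> msym h z = profile 0 h (qf z).
Proof.
move=> h0; rewrite msymE//; apply: eq_Rintegral => y _.
rewrite /rho01 /profile_wt /rho2 expr0 mul1r -mulrA -/(qf z); rewrite I01P; case: ifPn => [/andP[y0 _]|_]; last by rewrite !mul0r.
by rewrite (ger0_norm (ltW y0)).
Qed.

Lemma continuous_lin (h : R) : continuous (fun y : R => - (y / h)).
Proof. by apply: continuous_opp; apply: continuous_mul; [move=> y; exact: cvg_id|exact: continuous_c]. Qed.

Lemma is_derive_profile k h s : 0 < h -> is_derive s (1 : R) (profile k h) (profile k.+1 h s).
Proof.
move=> h0; pose A (t y : R) : R := profile_wt y * ((- (y / h)) ^+ k * expR (- (y / h) * t)).
pose dA (t y : R) : R := profile_wt y * ((- (y / h)) ^+ k.+1 * expR (- (y / h) * t)).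
pose B := 2 * 2 ^+ d * (h^-1 ^+ k.+1 * expR (h^-1 * (`|s| + 1))).
apply: (@is_derive_I01 R A dA s B).
- move=> t; apply: continuous_mul; first exact: continuous_profile_wt.
  apply: continuous_mul; first by apply: continuous_pow; exact: continuous_lin.
  by apply: continuous_exp; apply: continuous_mul; [exact: continuous_lin|exact: continuous_c].
- move=> t y; apply: is_derive_scale.
  have D : is_derive t (1 : R) (fun t => - (y / h) * t) (- (y / h) * 1).
    by apply: is_derive_scale; exact: is_derive_id.
  have := is_derive_scale ((- (y / h)) ^+ k) (is_derive_exp D).
  by apply: is_derive_val; rewrite mulr1 exprSr -!mulrA [expR _ * _]mulrC.
- move=> t y ts y01; have /andP[y0 y1] := y01.
  have yh0 : 0 <= y / h by rewrite divr_ge0// ltW.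
  have yh1 : y / h <= h^-1 by rewrite ler_piMl// invr_ge0 ltW.
  rewrite /dA normrM; apply: ler_pM => //; first exact: profile_wt_bound.
  rewrite normrM normrX normrN (ger0_norm yh0) (ger0_norm (expR_ge0 _)).
  apply: ler_pM; [exact: exprn_ge0|exact: expR_ge0| |].
    by apply: lerXn2r; rewrite ?nnegrE ?invr_ge0 ?(ltW h0).
  rewrite ler_expR; apply: le_trans (ler_norm _) _; rewrite normrM normrN (ger0_norm yh0).
  apply: ler_pM => //; rewrite -[t](subrK s) addrC; apply: le_trans (ler_normD _ _) _.
  by rewrite lerD2l ltW.
Qed.

Lemma continuous_profile k h : 0 < h -> continuous (profile k h).
Proof.
by move=> h0 t; apply: differentiable_continuous; apply/derivable1_diffP; have [] := is_derive_profile k t h0.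
Qed.

(** Terms of order n: those bounded by a constant times h^(-n/2). A derivative of
    the profile counts for 2, and each coordinate factor takes off 1. *)
Inductive sterm : nat -> (R -> V * V -> R) -> Prop :=
| sterm_profile k : sterm (2 * k) (fun h z => profile k h (qf z))
| sterm_scale n c F : sterm n F -> sterm n (fun h z => c * F h z)
| sterm_add n F G : sterm n F -> sterm n G -> sterm n (fun h z => F h z + G h z)
| sterm_coord n i F : sterm n.+1 F -> sterm n (fun h z => coord i z * F h z).

Lemma sterm_continuous n F h : 0 < h -> sterm n F -> continuous (F h).
Proof.
move=> h0; elim=> {n F} [k|n c F _ cF|n F G _ cF _ cG|n i F _ cF].
- by apply: continuous_chain; [exact: continuous_profile|exact: continuous_qf].
- by apply: continuous_mul; first exact: continuous_c.
- exact: continuous_add.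
- by apply: continuous_mul; first exact: continuous_coord.
Qed.

(** Differentiating the profile raises its order by 2 and brings down one
    coordinate; differentiating a coordinate removes it. *)
Lemma sterm_derive n F i : sterm n F -> exists2 dF, sterm n.+1 dF &
  forall h z, 0 < h -> is_derive z (dir R i) (F h) (dF h z).
Proof.
elim=> {n F} [k|n c F _ [dF sF DF]|n F G _ [dF sF DF] _ [dG sG DG]|n l F sF0 [dF sF DF]].
- exists (fun h z => coef i * (coord i z * profile k.+1 h (qf z))).
    apply: sterm_scale; apply: sterm_coord.
    by have := sterm_profile k.+1; rewrite mulnS.
  move=> h z h0; have := is_derive_chain (is_derive_profile k (qf z) h0) (is_derive_qf i z).
  by apply: is_derive_val; ring.
- exists (fun h z => c * dF h z); first exact: sterm_scale.
  by move=> h z h0; apply: is_derive_scale; exact: DF.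
- exists (fun h z => dF h z + dG h z); first exact: sterm_add.
  by move=> h z h0; apply: is_derive_add; [exact: DF|exact: DG].
- exists (fun h z => coord l z * dF h z + (l == i)%:R * F h z).
    by apply: sterm_add; [exact: sterm_coord|exact: sterm_scale].
  move=> h z h0; have := is_derive_mul (is_derive_coord l i z) (DF h z h0).
  by apply: is_derive_val; rewrite [F h z * _]mulrC.
Qed.

(** The integrand that controls a term of order n: (y/h)^(n/2) times a Gaussian,
    with a polynomial in (y/h) q that records absorbed coordinates. *)
Definition sbound_integrand n m h z (y : R) : R :=
  Num.sqrt (y / h) ^+ n * ((1 + (y / h) * qf z) ^+ m * expR (- (y / h * qf z))).
Definition sbound n m h z : R := \int[mu]_y (I01 y * sbound_integrand n m h z y).

Lemma continuous_sbound_integrand n m h z : continuous (sbound_integrand n m h z).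
Proof.
have c1 : continuous (fun y : R => y / h) by apply: continuous_mul; [move=> y; exact: cvg_id|exact: continuous_c].
have c2 : continuous (fun y : R => y / h * qf z) by apply: continuous_mul; [exact: c1|exact: continuous_c].
apply: continuous_mul.
  by apply: continuous_pow; apply: (@continuous_chain _ _ Num.sqrt); [exact: sqrt_continuous|exact: c1].
apply: continuous_mul; last by apply: continuous_exp; exact: continuous_opp.
by apply: continuous_pow; apply: continuous_add; first exact: continuous_c.
Qed.

Lemma I01_ge0 (y : R) : 0 <= I01 y.
Proof. by rewrite I01P; case: ifP. Qed.

Lemma Rintegral_I01_mono (f g : R -> R) : continuous f -> continuous g ->
  (forall y, 0 < y <= 1 -> f y <= g y) ->
  \int[mu]_y (I01 y * f y) <= \int[mu]_y (I01 y * g y).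
Proof.
move=> cf cg fg; apply: le_Rintegral => //; try exact: integrable_I01_cont.
move=> y _; rewrite I01P; case: ifPn => y01; last by rewrite !mul0r.
by rewrite !mul1r; exact: fg.
Qed.

Lemma sbound_mono n m m' h z : 0 < h -> (m <= m')%N -> sbound n m h z <= sbound n m' h z.
Proof.
move=> h0 mm; apply: Rintegral_I01_mono; try exact: continuous_sbound_integrand.
move=> y /andP[y0 _]; have yh0 : 0 <= y / h by rewrite divr_ge0// ltW.
apply: ler_wpM2l; first by rewrite exprn_ge0 ?sqrtr_ge0.
apply: ler_wpM2r; first exact: expR_ge0.
by apply: ler_weXn2l => //; rewrite lerDl mulr_ge0 ?qf_ge0.
Qed.

(** |z_i| (y/h)^(1/2) <= 1 + z_i^2 (y/h) <= 2 (1 + (y/h) q). *)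
Lemma sbound_coord n m h z i : 0 < h -> `|coord i z| * sbound n.+1 m h z <= 2 * sbound n m.+1 h z.
Proof.
move=> h0; have cB n' m' : mu.-integrable setT (EFin \o (fun y => I01 y * sbound_integrand n' m' h z y)).
  by apply: integrable_I01_cont; exact: continuous_sbound_integrand.
rewrite /sbound -!RintegralZl//.
under eq_Rintegral do rewrite mulrCA.
under [X in _ <= X]eq_Rintegral do rewrite mulrCA.
apply: Rintegral_I01_mono; try (by apply: continuous_mul; [exact: continuous_c|exact: continuous_sbound_integrand]).
move=> y /andP[y0 _]; have yh0 : 0 <= y / h by rewrite divr_ge0// ltW.
rewrite /sbound_integrand; set S := Num.sqrt (y / h); set E := expR _; set a := `|coord i z|.
have S0 : 0 <= S by exact: sqrtr_ge0.
have S2 : S ^+ 2 = y / h by exact: sqr_sqrtr.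
have a2 : a ^+ 2 <= 2 * qf z by rewrite /a real_normK ?num_real// coord_sq.
(* a S <= 1 + (a S)^2. *)
have key : a * S <= 2 * (1 + y / h * qf z).
  apply: (@le_trans _ _ (1 + a ^+ 2 * S ^+ 2)).
    rewrite -exprMn; have := sqr_ge0 (a * S - 1); have := sqr_ge0 (a * S); nra.
  rewrite S2; have := ler_wpM2r yh0 a2; have := qf_ge0 z; lra.
rewrite exprSr exprS.
have -> : a * (S ^+ n * S * ((1 + y / h * qf z) ^+ m * E)) = (a * S) * (S ^+ n * ((1 + y / h * qf z) ^+ m * E)) by ring.
have -> : 2 * (S ^+ n * ((1 + y / h * qf z) * (1 + y / h * qf z) ^+ m * E)) =
  (2 * (1 + y / h * qf z)) * (S ^+ n * ((1 + y / h * qf z) ^+ m * E)) by ring.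
apply: ler_wpM2r => //; apply: mulr_ge0; first exact: exprn_ge0.
by rewrite mulr_ge0 ?expR_ge0// exprn_ge0// addr_ge0// mulr_ge0 ?qf_ge0.
Qed.

Lemma sterm_sbound n F : sterm n F -> exists C m, 0 <= C /\
  forall h z, 0 < h -> `|F h z| <= C * sbound n m h z.
Proof.
elim=> {n F} [k|n c F _ [C [m [C0 CH]]]|n F G _ [C [m [C0 CH]]] _ [D [l [D0 DH]]]|n i F _ [C [m [C0 CH]]]].
- exists (2 * 2 ^+ d), 0%N; split; first by rewrite mulr_ge0// exprn_ge0.
  move=> h z h0.
  pose f (y : R) := profile_wt y * ((- (y / h)) ^+ k * expR (- (y / h) * qf z)).
  have cf : continuous f.
    apply: continuous_mul; first exact: continuous_profile_wt.
    apply: continuous_mul; first by apply: continuous_pow; exact: continuous_lin.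
    by apply: continuous_exp; apply: continuous_mul; [exact: continuous_lin|exact: continuous_c].
  rewrite /profile; apply: le_trans (le_normr_Rintegral measurableT (integrable_I01_cont cf)) _.
  under eq_Rintegral do rewrite normrM (ger0_norm (I01_ge0 _)).
  rewrite /sbound -RintegralZl//; last by apply: integrable_I01_cont; exact: continuous_sbound_integrand.
  under [X in _ <= X]eq_Rintegral do rewrite mulrCA.
  apply: Rintegral_I01_mono.
  + by apply: continuous_chain; first exact: norm_continuous.
  + by apply: continuous_mul; [exact: continuous_c|exact: continuous_sbound_integrand].
  move=> y y01; have /andP[y0 _] := y01; have yh0 : 0 <= y / h by rewrite divr_ge0// ltW.
  rewrite /f normrM; apply: ler_pM => //; first exact: profile_wt_bound.
  rewrite /sbound_integrand expr0 mul1r normrM normrX normrN (ger0_norm yh0) (ger0_norm (expR_ge0 _)).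
  by rewrite exprM sqr_sqrtr// mulNr.
- exists (`|c| * C), m; split; first exact: mulr_ge0.
  by move=> h z h0; rewrite normrM -mulrA ler_wpM2l//; exact: CH.
- exists (C + D), (maxn m l); split; first exact: addr_ge0.
  move=> h z h0; apply: le_trans (ler_normD _ _) _; rewrite mulrDl; apply: lerD.
    by apply: le_trans (CH h z h0) _; rewrite ler_wpM2l// sbound_mono// leq_maxl.
  by apply: le_trans (DH h z h0) _; rewrite ler_wpM2l// sbound_mono// leq_maxr.
- exists (C * 2), m.+1; split; first exact: mulr_ge0.
  move=> h z h0; rewrite normrM; apply: (@le_trans _ _ (`|coord i z| * (C * sbound n.+1 m h z))).
    by rewrite ler_wpM2l//; exact: CH.
  by rewrite mulrCA -mulrA ler_wpM2l//; exact: sbound_coord.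
Qed.

(** The integral is at most 1, and a times it is 1 - e^(-a), at most 1. *)
Lemma Rintegral_I01_exp (a : R) : 0 <= a ->
  \int[mu]_y (I01 y * expR (- (y * a))) <= 2 / (1 + a).
Proof.
move=> a0; rewrite ler_pdivlMr ?ltr_pwDl//.
have cE : continuous (fun y : R => expR (- (y * a))).
  by apply: continuous_exp; apply: continuous_opp; apply: continuous_mul; [move=> y; exact: cvg_id|exact: continuous_c].
set I := \int[mu]_y _.
have I1 : I <= 1.
  apply: le_trans (ler_norm _) _; apply: Rintegral_I01_le.
    apply: measurable_funM; first exact: measurable_I01.
    exact: continuous_measurable_fun.
  move=> y; rewrite mul1r I01P; case: ifPn => [/andP[y0 _]|_]; last by rewrite mul0r normr0.
  by rewrite mul1r ger0_norm ?expR_ge0// -expR0 ler_expR oppr_le0 mulr_ge0// ltW.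
suff aI : a * I <= 1 by rewrite mulrDr mulr1 mulrC; lra.
pose f (y : R) : R := a * expR (- (y * a)).
pose F (y : R) : R := - expR (- (y * a)).
have cf : continuous f by apply: continuous_mul; [exact: continuous_c|exact: cE].
have DF (y : R) : is_derive y (1 : R) F (f y).
  have D : is_derive y (1 : R) (fun t => - (t * a)) (- a).
    have := is_derive_opp (is_derive_mul (is_derive_id y (1 : R)) (is_derive_c y (1 : R) a)).
    by apply: is_derive_val; rewrite mulr0 add0r mulr1.
  by have := is_derive_opp (is_derive_exp D); apply: is_derive_val; rewrite /f mulrN opprK mulrC.
have -> : a * I = \int[mu]_y (I01 y * f y).
  rewrite /I -RintegralZl//; last exact: integrable_I01_cont.
  by apply: eq_Rintegral => y _; rewrite mulrCA.
rewrite -Rintegral_I01 Rintegral_itv_obnd_cbnd; last first.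
  apply/integrable_mkcond; first exact: measurable_itv.
  have := integrable_I01_cont cf; apply: eq_integrable => // y _ /=.
  by rewrite patchE /I01 indicE; case: ifPn => _; rewrite ?mul1r ?mul0r.
suff -> : \int[mu]_(x in `[0, 1]) f x = F 1 - F 0.
  by rewrite /F mul0r oppr0 expR0 opprK; have := expR_ge0 (- (1 * a)); lra.
have cF : continuous F by apply: continuous_opp.
rewrite /Rintegral (@continuous_FTC2 R f F 0 1 ltr01)//.
- exact: continuous_subspaceT.
- split.
  + by move=> y _; have [] := DF y.
  + by apply: cvg_at_right_filter; exact: cF.
  + by apply: cvg_at_left_filter; exact: cF.
- by move=> y _; rewrite derive1E; have [] := DF y.
Qed.

Lemma jap_qf (z : V * V) : jap z ^+ 2 <= 4 * (1 + qf z / 2).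
Proof.
rewrite sqr_sqrtr; last by rewrite !addr_ge0 ?sqnorm_ge0.
by rewrite /qf; have := sqnorm_ge0 z.1; have := sqnorm_ge0 z.2; lra.
Qed.

Lemma jap_gt0 (z : V * V) : 0 < jap z.
Proof. by rewrite sqrtr_gt0 -addrA ltr_wpDr// addr_ge0 ?sqnorm_ge0. Qed.

(** The polynomial is absorbed by half of the exponent. Then y <= 1 bounds the power
    of y/h, and h <= 1 bounds the remaining exponential by e^(-y q/2). *)
Lemma sbound_le n m : exists2 C, 0 <= C & forall h z, 0 < h <= 1 ->
  sbound n m h z <= C * (Num.sqrt h)^-1 ^+ n * (jap z ^+ 2)^-1.
Proof.
have [C CH] := @expR_poly_bound R m 2^-1 ltac:(by rewrite invr_gt0).
have C0 : 0 <= C.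
  by apply: le_trans (CH 0 (lexx _)); rewrite mulr0 oppr0 expR0 addr0 expr1n mulr1.
exists (C * 8) => [|h z /andP[h0 h1]]; first exact: mulr_ge0.
have sh0 : 0 < Num.sqrt h by rewrite sqrtr_gt0.
have q0 : 0 <= qf z / 2 by rewrite divr_ge0 ?qf_ge0.
have K0 : 0 <= (Num.sqrt h)^-1 ^+ n * C by rewrite mulr_ge0// exprn_ge0// invr_ge0 ltW.
have cE : continuous (fun y : R => expR (- (y * (qf z / 2)))).
  by apply: continuous_exp; apply: continuous_opp; apply: continuous_mul; [move=> y; exact: cvg_id|exact: continuous_c].
apply: (@le_trans _ _ (\int[mu]_y (I01 y * ((Num.sqrt h)^-1 ^+ n * C * expR (- (y * (qf z / 2))))))).
  apply: Rintegral_I01_mono; first exact: continuous_sbound_integrand.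
    by apply: continuous_mul; first exact: continuous_c.
  move=> y /andP[y0 y1]; have yh0 : 0 <= y / h by rewrite divr_ge0// ltW.
  have t0 : 0 <= y / h * qf z by rewrite mulr_ge0 ?qf_ge0.
  rewrite /sbound_integrand -[X in _ <= X]mulrA; apply: ler_pM.
  - by rewrite exprn_ge0 ?sqrtr_ge0.
  - by rewrite mulr_ge0 ?expR_ge0// exprn_ge0// addr_ge0.
  - apply: lerXn2r; rewrite ?nnegrE ?sqrtr_ge0 ?invr_ge0 ?sqrtr_ge0//.
    by rewrite -sqrtrV ?(ltW h0)// ler_wsqrtr// ler_piMl// invr_ge0 ltW.
  - set t := y / h * qf z in t0 *.
    have -> : - t = - (2^-1 * t) + - (2^-1 * t) by field.
    rewrite expRD mulrA; apply: ler_pM; rewrite ?expR_ge0//.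
    + by rewrite mulr_ge0 ?expR_ge0// exprn_ge0// addr_ge0.
    + by rewrite mulrC; exact: CH.
    + rewrite ler_expR lerN2 /t (_ : 2^-1 * _ = y / h * (qf z / 2)); last by ring.
      by apply: ler_wpM2r => //; rewrite ler_peMr ?(ltW y0)// invf_ge1.
under eq_Rintegral do rewrite mulrCA.
rewrite RintegralZl//; last exact: integrable_I01_cont.
apply: (@le_trans _ _ ((Num.sqrt h)^-1 ^+ n * C * (2 / (1 + qf z / 2)))).
  by apply: ler_wpM2l => //; exact: Rintegral_I01_exp.
have j0 : 0 < jap z ^+ 2 by rewrite exprn_gt0// jap_gt0.
have -> : C * 8 * (Num.sqrt h)^-1 ^+ n * (jap z ^+ 2)^-1 = (Num.sqrt h)^-1 ^+ n * C * (8 / jap z ^+ 2) by ring.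
apply: ler_wpM2l => //.
rewrite ler_pdivlMr// mulrAC ler_pdivrMr ?ltr_pwDl//.
by have := jap_qf z; lra.
Qed.

(** The term does not depend on h, which makes the bounds uniform. *)
Lemma partials_m_symbol s : exists2 F, sterm (size s) F &
  forall h, 0 < h -> partials s (@m_symbol R d h) = fun z => (F h z)%:C.
Proof.
elim: s => [|i s [F sF FE]].
  exists (fun h z => profile 0 h (qf z)); first exact: sterm_profile 0.
  by move=> h h0; apply/funext => z; rewrite -msym_profile.
have [dF sdF DF] := sterm_derive i sF; exists dF => // h h0.
apply/funext => z; rewrite /= FE// /partial; apply: complex_ext => /=.
  by have [] := DF h z h0.
by rewrite derive_cst.
Qed.

Lemma m_symbol_smooth h : 0 < h -> smooth (@m_symbol R d h).
Proof.
move=> h0 s; have [F sF FE] := partials_m_symbol s; rewrite FE//; split.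
- exact: sterm_continuous sF.
- exact: continuous_c.
- move=> i z; split; last exact: derivable_cst.
  by have [dF _ DF] := sterm_derive i sF; have [] := DF h z h0.
Qed.

Lemma size_mpartial (alpha : multi_index d) :
  size (flatten [seq nseq (alpha i) i | i <- enum {: I2}]) = mabs alpha.
Proof.
rewrite size_flatten /shape -map_comp sumnE big_map big_enum /=.
by apply: eq_bigr => i _; rewrite size_nseq.
Qed.

Lemma m_symbol_class : symbol_class (1 / 2) (- 2) (@m_symbol R d).
Proof.
split=> [h /andP[h0 _]|alpha]; first exact: m_symbol_smooth.
rewrite /mpartial; set s := flatten _.
have [F sF FE] := partials_m_symbol s.
have [C [m [C0 CH]]] := sterm_sbound sF; have [D D0 DH] := sbound_le (size s) m.
exists (C * D + 1); first by rewrite ltr_wpDl// mulr_ge0.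
move=> h z h01; have /andP[h0 h1] := h01.
rewrite FE// /= expr0n/= addr0 sqrtr_sqr; apply: le_trans (CH h z h0) _.
have -> : h `^ (- (1 / 2 * (mabs alpha)%:R)) = (Num.sqrt h)^-1 ^+ size s.
  rewrite size_mpartial div1r -mulrN powRrM powR12_sqrt ?(ltW h0)// powRN powR_mulrn ?sqrtr_ge0//.
  by rewrite exprVn.
have -> : jap z `^ (- 2) = (jap z ^+ 2)^-1 by rewrite powRN powR_mulrn// ltW// jap_gt0.
apply: le_trans (ler_wpM2l C0 (DH h z h01)) _.
rewrite !mulrA -!mulrA; rewrite [X in _ <= X]mulrDl mul1r -!mulrA lerDl.
by rewrite mulr_ge0// ?invr_ge0 ?exprn_ge0// ?invr_ge0 ?sqrtr_ge0// ltW// jap_gt0.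
Qed.

End symbol.

Unset Implicit Arguments.

Theorem proposition2p2 (R : realType) (d : nat) (d_gt0 : (0 < d)%N) :
  symbol_class (1 / 2) (- 2) (@m_symbol R d) /\
  forall h : R, 0 < h <= 1 ->
    (forall u : 'rV[R]_d * 'rV[R]_d -> complex R, schwartz u ->
       {ae lebesgue_space2 R d, forall z,
         Q_op h u z = (b_adj h \o weyl_mx h (m_Id h) \o b_op h) u z}) /\
    (forall u : 'rV[R]_d * 'rV[R]_d -> complex R,
       L2 (lebesgue_space2 R d) u ->
       distr_eq h (m_Id h) (Q_op h u) u).
Proof.
split; first exact: m_symbol_class.
move=> h /andP[h0 _]; split=> u lu; first exact: factorization_schwartz.
exact: factorization_L2.
Qed.
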